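(* Let $\Pi(\cdot\mid Y,Z)$ be the marginal posterior of $\sigma^2$ under the Gaussian mixture prior described in the context, and let $\Pi_\infty(\cdot\mid Y,Z)$ and $\widetilde\Pi_\infty(\cdot\mid Y)$ be the distributions corresponding to the densities $$\pi_\infty(\sigma^2\mid Y,Z)\propto \mathbf{1}(\sigma^2\geq 0)\, e^{-\frac{n_1}{4\sigma_0^4}(\sigma^2-\overline{Y^2})^2}\bigg[1-\Phi\bigg(\frac{\sqrt{n_2}\,(\sigma^2-\overline{Z^2})}{\sqrt{2}\,(\sigma_0^2+\overline{\mu_0^2})}\bigg)\bigg],$$ $$\widetilde\pi_\infty(\sigma^2\mid Y)\propto \mathbf{1}(\sigma^2\geq 0)\, e^{-\frac{n_1}{4\sigma_0^4}(\sigma^2-\overline{Y^2})^2},$$ respectively. If the prior densities $\gamma,\pi:[0,\infty)\to(0,\infty)$ are positive and uniformly continuous, then, for any compact sets $K\subset(0,\infty)$, $K'\subset(-\infty,\infty)$, and $n\to\infty$, $$\sup_{\sigma_0^2\in K,\ \mu_i^0\in K',\,\forall i}\ E_0^n\Big[\big\|\Pi(\cdot\mid Y,Z)-\Pi_\infty(\cdot\mid Y,Z)\big\|_{\mathrm{TV}}\Big]\to 0.$$ Moreover, if $\inf_{\mu_i^0\in K',\,\forall i}|\mu_i^0|\gg(\log n/n)^{1/4}$, then $$\sup_{\sigma_0^2\in K,\ \mu_i^0\in K',\,\forall i}\ E_0^n\Big[\big\|\Pi(\cdot\mid Y,Z)-\widetilde\Pi_\infty(\cdot\mid Y)\big\|_{\mathrm{TV}}\Big]\to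 0.$$
   Context: Model: for given $0\le\alpha\le1$ and sample size $n$, put $n_1=\lfloor n\alpha\rfloor$ and $n_2=n-n_1$. One observes independent $X_i\sim\mathcal{N}(\mu_i^0\mathbf{1}(i>n\alpha),\sigma_0^2)$, $i=1,\ldots,n$, with $\sigma_0^2>0$ and $\mu_0=(\mu^0_{n_1+1},\ldots,\mu^0_n)\in\mathbb{R}^{n_2}$ unknown. Write $Y=(X_1,\ldots,X_{n_1})$ and $Z=(X_{n_1+1},\ldots,X_n)$. $E_0^n$ denotes expectation under this model with true parameters $(\sigma_0^2,\mu_0)$; ''$\mu_i^0\in K'$, $\forall i$'' refers to all $i=n_1+1,\ldots,n$. For a vector $u\in\mathbb{R}^k$, $\|u\|$ is the Euclidean norm and $\overline{u^2}=\|u\|^2/k$; thus $\overline{Y^2}=\|Y\|^2/n_1$, $\overline{Z^2}=\|Z\|^2/n_2$, $\overline{\mu_0^2}=\|\mu_0\|^2/n_2$. Gaussian mixture prior: $\gamma$ and $\pi$ are Lebesgue probability densities on $[0,\infty)$ not depending on $n$. The variance $\sigma^2$ has prior density $\pi$ and is independent of the mean vector $\mu\in\mathbb{R}^{n_2}$; $\mu$ is generated by first drawing $\theta^2\sim\gamma$ and then, given $\theta^2$, drawing the components $\mu_i\mid\theta^2\sim\mathcal{N}(0,\theta^2)$ independently, $i>n_1$. Let $\nu$ be the resulting prior distribution of $\mu$ on $\mathbb{R}^{n_2}$. Marginal posterior: $\Pi(\cdot\mid Y,Z)$ has density $$\pi(\sigma^2\mid Y,Z)\propto \sigma^{-n}e^{-\frac{\|Y\|^2}{2\sigma^2}}\Big(\int_{\mathbb{R}^{n_2}}e^{-\frac{\|Z-\mu\|^2}{2\sigma^2}}\,d\nu(\mu)\Big)\pi(\sigma^2),\quad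 \sigma^2>0.$$ $\Phi$ is the standard normal c.d.f., $\|\cdot\|_{\mathrm{TV}}$ is the total variation distance, and $a_n\gg b_n$ means $a_n/b_n\to\infty$. The constants of proportionality normalize densities in $\sigma^2$ for fixed $Y,Z$.
   Formalization: The case α = 0 is excluded: there n_1 = 0, so the mean of Y² is undefined, the second limit density cannot be normalized, and the first claim fails in general (the posterior tends to π(v)γ(s−v) on [0,s], where s = σ_0² + mean of μ_0², not to a flat density). *)

(* Defs.v *)
From HB Require Import structures.
From mathcomp Require Import all_boot all_order all_algebra.
From mathcomp Require Import all_classical all_reals all_analysis.
Import Order.TTheory GRing.Theory Num.Theory.
Import numFieldNormedType.Exports.

Set Implicit Arguments.
Unset Strict Implicit.
Unset Printing Implicit Defensive.

Local Open Scope classical_set_scope.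
Local Open Scope ring_scope.

Section tuple_product.
Context d (T : measurableType d) (R : realType).

Definition tuple_cons n (p : T * n.-tuple T) : n.+1.-tuple T :=
  [tuple of p.1 :: p.2].

Lemma measurable_tuple_cons n : measurable_fun setT (@tuple_cons n).
Proof. exact: measurable_cons. Qed.

HB.instance Definition _ n :=
  isMeasurableFun.Build _ _ _ _ (@tuple_cons n) (@measurable_tuple_cons n).

(* Law of (x_0, ..., x_(n-1)) for independent x_i ~ P i. *)
Fixpoint tuple_prob n : ('I_n -> probability T R) -> probability (n.-tuple T) R :=
  match n with
  | 0 => fun _ => \d_([tuple] : 0.-tuple T)
  | m.+1 => fun P =>
      distribution (P ord0 \x^ tuple_prob (fun i => P (lift ord0 i)))%E
                   (@tuple_cons m)
  end.

Lemma tuple_prob_box n (P : 'I_n -> probability T R) (A : 'I_n -> set T) :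
  (forall i, measurable (A i)) ->
  tuple_prob P [set x | forall i, A i (tnth x i)] = (\prod_(i < n) P i (A i))%E.
Proof.
elim: n P A => [|n IH] P A mA.
  by rewrite big_ord0 /= diracE mem_set//= => -[].
rewrite big_ord_recl /= -(IH _ (fun i => A (lift ord0 i)))//.
rewrite /distribution /= /pushforward.
have mB : measurable [set x : n.-tuple T | forall i, A (lift ord0 i) (tnth x i)].
  rewrite (_ : [set _ | _] =
    \bigcap_(i in [set: 'I_n]) ((fun x => tnth x i) @^-1` A (lift ord0 i))).
    apply: fin_bigcap_measurable => // i _.
    by rewrite -[X in measurable X]setTI; apply: measurable_tnth.
  by apply/seteqP; split => [x + i _|x + i] /=; apply.
rewrite -product_measure2E//; congr (_ _).
apply/seteqP; split => [[x y] /= h|[x y] /= [h0 h] i].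
  split; first by have := h ord0; rewrite tnth0.
  by move=> i; have := h (lift ord0 i); rewrite tnthS.
by case: (unliftP ord0 i) => [j|] ->; rewrite ?tnth0 ?tnthS.
Qed.

End tuple_product.

(* The sigma-algebra on R carried by normal_prob and lebesgue_measure. *)
Notation rvec R k := (k.-tuple (measurableTypeR R)).

Section densities.
Context (R : realType).

Definition unif_continuous_on (D : set R) (f : R -> R) :=
  forall e, 0 < e -> exists2 del, 0 < del &
    forall x y, D x -> D y -> `|x - y| < del -> `|f x - f y| < e.

(* The values of f outside [0, +oo[ are irrelevant. *)
Definition prob_density (f : R -> R) :=
  (forall x, 0 <= x -> 0 <= f x) /\
  (\int[lebesgue_measure]_(x in `[0%R, +oo[) (f x)%:E = 1)%E.

(* The law with density proportional to f. *)
Definition law_propto (f : R -> R) (A : set R) : \bar R :=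
  (\int[lebesgue_measure]_(x in A) (f x)%:E /
   \int[lebesgue_measure]_x (f x)%:E)%E.

Definition tv_dist (P Q : set R -> \bar R) : \bar R :=
  ereal_sup [set `|P A - Q A|%E | A in (measurable : set (set R))].

Definition Phi (x : R) : R := fine (normal_prob 0 1 `]-oo, x]).

Definition sqnorm k (u : rvec R k) : R := \sum_(i < k) tnth u i ^+ 2.

Definition mean_sq k (u : rvec R k) : R := sqnorm u / k%:R.

(* Law of k independent N(m_i, v) variables, v being the variance; normal_prob
   takes the standard deviation. *)
Definition normal_tuple k (m : 'I_k -> R) (v : R) : probability (rvec R k) R :=
  tuple_prob (fun i => normal_prob (m i) (Num.sqrt v)).

(* nu is the law of mu when theta^2 ~ gamma and the mu_i are independent
   N(0, theta^2) given theta^2. These values determine nu. (normal_prob 0 0 is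
   not a point mass, but t = 0 is Lebesgue-negligible.) *)
Definition is_gaussian_mixture (gamma : R -> R) k
    (nu : probability (rvec R k) R) :=
  forall A, measurable A ->
    (nu A = \int[lebesgue_measure]_(t in `[0%R, +oo[)
              ((gamma t)%:E * normal_tuple (fun=> 0%R) t A))%E.

End densities.

Section model.
Context (R : realType).

Definition size1 (alpha : R) (n : nat) : nat := Num.truncn (n%:R * alpha).
Definition size2 (alpha : R) (n : nat) : nat := (n - size1 alpha n)%N.

Section fixed_sizes.
Variables n1 n2 : nat.

(* The n1 + n2 = n observations: mean 0 for the first n1, mu0 for the rest. *)
Definition obs_mean (mu0 : rvec R n2) (i : 'I_(n1 + n2)) : R :=
  match fintype.split i with inl _ => 0 | inr j => tnth mu0 j end.

Definition obs_law (v0 : R) (mu0 : rvec R n2) : probability (rvec R (n1 + n2)) R :=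
  normal_tuple (obs_mean mu0) v0.

Definition obsY (x : rvec R (n1 + n2)) : rvec R n1 :=
  [tuple tnth x (lshift n2 i) | i < n1].
Definition obsZ (x : rvec R (n1 + n2)) : rvec R n2 :=
  [tuple tnth x (rshift n1 i) | i < n2].

(* In the densities below, v stands for the variance sigma^2. *)

Definition posterior_dens (nu : probability (rvec R n2) R) (prior : R -> R)
    (Y : rvec R n1) (Z : rvec R n2) (v : R) : R :=
  (0 < v)%R%:R * (Num.sqrt v ^- (n1 + n2) * expR (- (sqnorm Y / (2 * v))) *
    (\int[nu]_m
       expR (- (sqnorm [tuple tnth Z i - tnth m i | i < n2] / (2 * v))))%R *
    prior v).

Definition tilde_limit_dens (v0 : R) (Y : rvec R n1) (v : R) : R :=
  (0 <= v)%R%:R * expR (- (n1%:R / (4 * v0 ^+ 2) * (v - mean_sq Y) ^+ 2)).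

Definition limit_dens (v0 : R) (mu0 : rvec R n2) (Y : rvec R n1)
    (Z : rvec R n2) (v : R) : R :=
  (0 <= v)%R%:R * expR (- (n1%:R / (4 * v0 ^+ 2) * (v - mean_sq Y) ^+ 2)) *
  (1 - Phi (Num.sqrt n2%:R * (v - mean_sq Z) /
            (Num.sqrt 2 * (v0 + mean_sq mu0)))).

Definition tv_risk nu prior (v0 : R) (mu0 : rvec R n2) : \bar R :=
  (\int[obs_law v0 mu0]_x
     tv_dist (law_propto (posterior_dens nu prior (obsY x) (obsZ x)))
             (law_propto (limit_dens v0 mu0 (obsY x) (obsZ x))))%E.

Definition tilde_tv_risk nu prior (v0 : R) (mu0 : rvec R n2) : \bar R :=
  (\int[obs_law v0 mu0]_x
     tv_dist (law_propto (posterior_dens nu prior (obsY x) (obsZ x)))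
             (law_propto (tilde_limit_dens v0 (obsY x))))%E.

Definition box (K' : set R) : set (rvec R n2) :=
  [set m | forall i, K' (tnth m i)].

(* The element 0 makes the supremum of nonnegative values equal to 0 (instead
   of -oo) over an empty parameter set; it has no effect otherwise. *)
Definition sup_risk (K K' : set R) (risk : R -> rvec R n2 -> \bar R) : \bar R :=
  ereal_sup (0%E |` [set risk v0 mu0 | v0 in K & mu0 in box K']).

Definition inf_abs_mean (K' : set R) : \bar R :=
  ereal_inf [set `|tnth mu0 i|%:E | mu0 in box K' & i in [set: 'I_n2]].

End fixed_sizes.
End model.

(* Main.v *)
(* Up to factors not involving the variance v, the likelihood of k centered
   Gaussian variables with mean square a is
     lik k a v = ((a / v) ^ (1/2) * exp ((1 - a / v) / 2)) ^ k,
   which is at most 1, with equality at v = a. Averaging over the mean vector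
   with theta^2 = t turns v into v + t in the likelihood of Z, so the posterior
   density of v is proportional to
     prior v * lik n1 a v * \int_(t > 0) gamma t * lik n2 b (v + t)
   where a and b are the mean squares of Y and Z. The inequality 1 + x <= e^x
   alone bounds lik k a (a + x / sqrt k) by a function 1 / (1 + (x / c)^2) for
   all k >= 8, and the limit in x is exp (- x^2 / (4 a^2)). Dominated
   convergence around b at the scale n2^(-1/2) turns the integral over t into
   1 - Phi; dominated convergence around a at the scale n1^(-1/2) then gives
   convergence in total variation. It is uniform over all parameters and over
   the data with |a - sigma_0^2| <= M / sqrt n1 and
   |b - sigma_0^2 - mean mu0^2| <= M / sqrt n2, because it holds along every
   sequence of such values; by Chernoff bounds, other data have probability
   O(e^(-M)). For the second claim, sqrt n2 * mean mu0^2 -> +oo sends the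
   argument of Phi to -oo. *)

Require Import Defs.
From mathcomp Require Import all_boot all_order all_algebra.
From mathcomp Require Import all_classical all_reals all_analysis.
From mathcomp Require Import measurable_realfun.
From mathcomp Require Import ring lra zify.
Import Order.TTheory GRing.Theory Num.Theory.
Import numFieldNormedType.Exports.

Set Implicit Arguments.
Unset Strict Implicit.
Unset Printing Implicit Defensive.

Local Open Scope classical_set_scope.
Local Open Scope ring_scope.

(** The centres and scales of both limit laws vary with n and with the parameters and need not
    converge, so every limit below states that a difference tends to 0. Ratios such as
    [prior u / prior v] tend to 1 by uniform continuity because [v] stays in a compact set, on which
    the density is bounded below. For [gamma] the reference point is mean mu0^2, which may be 0, so
    densities are continued to the left of 0 as constants. No normalising constant is computed:
    total variation is bounded by twice the L1 distance of the unnormalised densities over a lower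
    bound for the mass of the limit. That mass stays bounded below because the mean square of Z is
    centred at or above sigma_0^2, which bounds the argument of Phi from above near sigma_0^2. In
    the inner integral t is shifted so that the likelihood of Z is centred at b; then 1 - Phi is an
    integral over the same half-line, and the integrands compare pointwise. The risk is bounded by
    monotonicity of integrals of nonnegative functions, which holds without measurability. *)

Section lebesgue_affine.
Context (R : realType).
Notation mu := (@lebesgue_measure R).

Let affine (a k : R) : measurableTypeR R -> measurableTypeR R := fun x => a + k * x.

Let measurable_affine a k : measurable_fun setT (affine a k).
Proof. by apply: measurable_funD => //; apply: measurable_funM. Qed.

(** Half-open intervals determine Lebesgue measure, and on them it agrees with k times its image
    under x -> a + k x. *)
Lemma ge0_integral_affine (a k : R) (f : R -> \bar R) : 0 < k ->
  measurable_fun setT f -> (forall x, (0 <= f x)%E) ->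
  (\int[mu]_x f x = k%:E * \int[mu]_x f (a + k * x)%R)%E.
Proof.
move=> k0 mf f0.
have k0' : (0 <= k)%R by exact: ltW.
rewrite (@eq_measure_integral _ _ _ _
  (mscale (NngNum k0') (pushforward mu (affine a k)))); last first.
  move=> A mA _; apply: lebesgue_measure_unique => // X -[[x y]] _ <-.
  transitivity (k%:E * mu (affine a k @^-1` `]x, y]))%E; last by [].
  have -> : affine a k @^-1` `]x, y] = `](x - a) / k, (y - a) / k]%classic.
    apply/seteqP; split => z /=;
     rewrite !in_itv/= /affine ltr_pdivrMr// ler_pdivlMr//;
     by rewrite ltrBlDl lerBrDl [z * k]mulrC.
  rewrite !lebesgue_measure_itv/= !lte_fin ltr_pM2r ?invr_gt0// ltrD2r.
  case: ifP => _; last by rewrite mule0.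
  by rewrite -!EFinB -EFinM -mulrBl mulrC divfK ?gt_eqF//; congr EFin; ring.
by rewrite ge0_integral_mscale//= ge0_integral_pushforward.
Qed.

End lebesgue_affine.

(** * Integration against mixtures, Gaussian laws and product laws *)

Section mixture.
Context d d' (X : measurableType d) (Y : measurableType d') (R : realType).
Variables (mu : {measure set X -> \bar R}) (D : set X) (mD : measurable D).
Variables (g : X -> R) (k : X -> {measure set Y -> \bar R}).
Variable nu : {measure set Y -> \bar R}.
Hypotheses (mg : measurable_fun D g) (g0 : forall x, D x -> 0 <= g x).
Hypothesis mk : forall A, measurable A -> measurable_fun D (k ^~ A).
Hypothesis nuE : forall A, measurable A ->
  (nu A = \int[mu]_(x in D) ((g x)%:E * k x A))%E.
Import HBNNSimple.

(** Both sides are monotone limits along simple functions, for which the identity is [nuE] summed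
    over finitely many values. It serves for measures with a density, where [k x] is the point mass
    at x, and for the Gaussian mixture prior. *)
Lemma ge0_integral_mixture (f : Y -> \bar R) :
  measurable_fun setT f -> (forall y, (0 <= f y)%E) ->
  (\int[nu]_y f y = \int[mu]_(x in D) ((g x)%:E * \int[k x]_y f y))%E.
Proof.
move=> mf f0.
pose f_ := nnsfun_approx measurableT mf.
have fE (m : {measure set Y -> \bar R}) :
    ((\int[m]_y (f_ n y)%:E) @[n --> \oo] --> \int[m]_y f y)%E.
  have -> : (\int[m]_y f y = \int[m]_y lim ((f_ n y)%:E @[n --> \oo]))%E.
    apply: eq_integral => y _; apply/esym/cvg_lim => //.
    exact: cvg_nnsfun_approx.
  apply: cvg_monotone_convergence => //.
  - by move=> n; exact/measurable_EFinP/measurable_funP.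
  - by move=> n y _; rewrite lee_fin.
  - by move=> y _ m' n mn; rewrite lee_fin; exact/lefP/nd_nnsfun_approx.
have sE (m : {measure set Y -> \bar R}) n : (\int[m]_y (f_ n y)%:E =
    \sum_(r \in range (f_ n)) r%:E * m (f_ n @^-1` [set r]))%E.
  by rewrite integralT_nnsfun sintegralE.
have mi n : measurable_fun D (fun x => \int[k x]_y (f_ n y)%:E)%E.
  under eq_fun do rewrite sE.
  apply: emeasurable_fsum => // r.
  by apply: measurable_funeM; exact: mk.
have mI : measurable_fun D (fun x => \int[k x]_y f y)%E.
  by apply: (emeasurable_fun_cvg (fun n x => \int[k x]_y (f_ n y)%:E)%E).
have mE : measurable_fun D (EFin \o g) by exact/measurable_EFinP.
have nd x m n : (m <= n)%N ->
    (\int[k x]_y (f_ m y)%:E <= \int[k x]_y (f_ n y)%:E)%E.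
  move=> mn; apply: ge0_le_integral => //.
  - by move=> y _; rewrite lee_fin.
  - exact/measurable_EFinP/measurable_funP.
  - exact/measurable_EFinP/measurable_funP.
  - by move=> y _; rewrite lee_fin; exact/lefP/nd_nnsfun_approx.
have RE : ((\int[mu]_(x in D) ((g x)%:E * \int[k x]_y (f_ n y)%:E)) @[n --> \oo]
    --> \int[mu]_(x in D) ((g x)%:E * \int[k x]_y f y))%E.
  have -> : (\int[mu]_(x in D) ((g x)%:E * \int[k x]_y f y) =
      \int[mu]_(x in D) lim ((g x)%:E * \int[k x]_y (f_ n y)%:E @[n --> \oo]))%E.
    apply: eq_integral => x _; apply/esym/cvg_lim => //.
    exact: cvgeZl.
  apply: cvg_monotone_convergence => //.
  - by move=> n; exact: emeasurable_funM.
  - move=> n x Dx; apply: mule_ge0; first by rewrite lee_fin g0.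
    by apply: integral_ge0 => y _; rewrite lee_fin.
  - by move=> x Dx m n mn; apply: lee_wpmul2l; [rewrite lee_fin g0|exact: nd].
apply: cvg_unique (fE nu) _ => //; apply: cvg_trans RE.
apply: near_eq_cvg; near=> n.
have mr r : measurable_fun D (fun x => (g x)%:E * k x (f_ n @^-1` [set r]))%E.
  by apply: emeasurable_funM => //; exact: mk.
have g0k r x : D x -> (0 <= (g x)%:E * k x (f_ n @^-1` [set r]))%E.
  by move=> Dx; rewrite mule_ge0// lee_fin g0.
transitivity (\int[mu]_(x in D) \sum_(r \in range (f_ n))
    r%:E * ((g x)%:E * k x (f_ n @^-1` [set r])))%E.
  apply: eq_integral => x _; rewrite sE ge0_mule_fsumr; last first.
    by move=> r; apply: (mulemu_ge0 (fun r => f_ n @^-1` [set r])) => r0; exact: preimage_nnfun0.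
  by apply: eq_fsbigr => r _; rewrite muleCA.
rewrite ge0_integral_fsum//; last 2 first.
  - by move=> r; apply: measurable_funeM.
  - move=> r x Dx; have [r0|r0] := leP 0 r; first by rewrite mule_ge0 ?g0k.
    by rewrite preimage_nnfun0// measure0 !mule0.
rewrite sE; apply: eq_fsbigr => r _.
have [r0|r0] := leP 0 r; first by rewrite ge0_integralZl//= ?nuE// => x; exact: g0k.
rewrite preimage_nnfun0// measure0 mule0 integral0_eq// => x _.
by rewrite measure0 !mule0.
Unshelve. all: end_near. Qed.

End mixture.

Section normal.
Context (R : realType).
Notation mu := (@lebesgue_measure R).

Lemma ge0_integral_normal_prob (m s : R) (f : measurableTypeR R -> \bar R) :
  measurable_fun setT f -> (forall x, (0 <= f x)%E) ->
  (\int[normal_prob m s]_x f x =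
   \int[mu]_x ((normal_pdf m s x)%:E * f x))%E.
Proof.
move=> mf f0.
rewrite (@ge0_integral_mixture _ _ _ _ _ mu setT measurableT
  (normal_pdf m s) (fun x => \d_x) (normal_prob m s))//=.
- apply: eq_integral => x _; congr (_ * _)%E.
  by rewrite integral_dirac// diracT mul1e.
- exact: measurable_normal_pdf.
- by move=> x _; exact: normal_pdf_ge0.
- by move=> A mA; exact: measurable_fun_dirac.
- move=> A mA; rewrite /normal_prob integral_mkcond.
  apply: eq_integral => x _; rewrite patchE diracE.
  by case: ifPn => _; rewrite ?mule1 ?mule0.
Qed.

Lemma normal_prob_affine (m s : R) (A : set (measurableTypeR R)) : 0 < s ->
  measurable A ->
  normal_prob m s A = normal_prob 0 1 ((fun x => m + s * x) @^-1` A).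
Proof.
move=> s0 mA.
have mp : measurable_fun setT (fun x : measurableTypeR R => m + s * x : measurableTypeR R).
  by apply: measurable_funD => //; apply: measurable_funM.
have mB : measurable ((fun x : measurableTypeR R => m + s * x : measurableTypeR R) @^-1` A).
  by rewrite -[X in measurable X]setTI; exact: mp.
have mf : measurable_fun [set: measurableTypeR R] ((fun x => (normal_pdf m s x)%:E) \_ A).
  apply/(measurable_restrictT _ _).1 => //.
  by apply/measurable_EFinP; apply: measurable_funTS; exact: measurable_normal_pdf.
have f0 x : (0 <= ((fun x => (normal_pdf m s x)%:E) \_ A) x)%E.
  by rewrite patchE; case: ifP => // _; rewrite lee_fin normal_pdf_ge0.
rewrite /normal_prob [LHS]integral_mkcond [RHS]integral_mkcond.
rewrite (@ge0_integral_affine R m s _ s0)//.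
rewrite -ge0_integralZl//; last 2 first.
- exact: (measurableT_comp mf mp).
- by rewrite lee_fin ltW.
apply: eq_integral => x _; rewrite !patchE.
have -> : (x \in (fun x => m + s * x) @^-1` A) = (m + s * x \in A).
  by apply/idP/idP; rewrite !inE.
case: ifP => _; rewrite ?mule0// -EFinM; congr EFin.
rewrite !normal_pdfE ?gt_eqF// mulrA.
have -> : normal_peak s = s^-1 * normal_peak 1.
  rewrite /normal_peak expr1n mul1r -mulrnAr sqrtrM ?sqr_ge0// sqrtr_sqr.
  by rewrite gtr0_norm// invfM.
rewrite mulrA divff ?gt_eqF// mul1r /normal_fun; congr (_ * expR _).
by field; rewrite gt_eqF.
Qed.

(** Completing the square. [k] may be negative as long as q is positive: k = 1 / (2 v) gives a
    likelihood averaged over its mean, k < 0 the exponential moments of a squared normal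
    variable. *)
Lemma normal_pdf_gauss (m s k z x : R) : 0 < s -> 0 < 1 + 2 * k * s ^+ 2 ->
  let q := 1 + 2 * k * s ^+ 2 in
  normal_pdf m s x * expR (- (k * (x - z) ^+ 2)) =
  (Num.sqrt q)^-1 * expR (- (k * (z - m) ^+ 2 / q)) *
  normal_pdf ((m + 2 * k * s ^+ 2 * z) / q) (s / Num.sqrt q) x.
Proof.
move=> s0 q0 q.
have sq0 : 0 < Num.sqrt q by rewrite sqrtr_gt0.
rewrite !normal_pdfE ?gt_eqF ?divr_gt0//.
rewrite /normal_fun.
have -> : normal_peak (s / Num.sqrt q) = Num.sqrt q * normal_peak s.
  have E : (s / Num.sqrt q) ^+ 2 * pi *+ 2 = q^-1 * (s ^+ 2 * pi *+ 2).
    by rewrite expr_div_n sqr_sqrtr ?ltW//; field; rewrite gt_eqF.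
  by rewrite /normal_peak E sqrtrM ?invr_ge0 ?ltW// sqrtrV ?ltW// invfM invrK.
have AC (e r p e' : R) : 0 < r -> r^-1 * e * (r * p * e') = p * (e * e').
  by move=> r0; field; rewrite gt_eqF.
rewrite AC// -[LHS]mulrA -!expRD.
congr (_ * expR _).
rewrite expr_div_n sqr_sqrtr ?ltW//.
rewrite /q; field.
by rewrite !gt_eqF//=.
Qed.

Lemma integral_normal_gauss (m s k z : R) : 0 < s -> 0 < 1 + 2 * k * s ^+ 2 ->
  (\int[normal_prob m s]_x (expR (- (k * (x - z) ^+ 2)))%:E =
   ((Num.sqrt (1 + 2 * k * s ^+ 2))^-1 *
     expR (- (k * (z - m) ^+ 2 / (1 + 2 * k * s ^+ 2))))%:E)%E.
Proof.
move=> s0 q0.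
rewrite ge0_integral_normal_prob; last 2 first.
- apply/measurable_EFinP; apply: measurableT_comp => //.
  apply: measurableT_comp => //; apply: measurable_funM => //.
  by apply: measurable_funX; apply: measurable_funB.
- by move=> x; rewrite lee_fin expR_ge0.
under eq_integral do rewrite -EFinM normal_pdf_gauss// EFinM.
rewrite ge0_integralZl//; first by rewrite integral_normal_pdf mule1.
- by apply/measurable_EFinP; exact: measurable_normal_pdf.
- by move=> x _; rewrite lee_fin normal_pdf_ge0.
Qed.

End normal.

Section tuple_prob_theory.
Context d (T : measurableType d) (R : realType).

Lemma ge0_integral_tuple_probS n (P : 'I_n.+1 -> probability T R)
    (F : n.+1.-tuple T -> \bar R) :
  measurable_fun setT F -> (forall x, (0 <= F x)%E) ->
  (\int[tuple_prob P]_x F x = \int[P ord0]_a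
    \int[tuple_prob (fun i => P (lift ord0 i))]_x F [tuple of a :: x])%E.
Proof.
move=> mF F0.
have mc := @measurable_tuple_cons _ T n.
rewrite /= /distribution/= ge0_integral_pushforward//= preimage_setT.
set Q := tuple_prob _.
rewrite -(@fubini_tonelli1 _ _ _ _ _ (P ord0) Q (F \o @tuple_cons _ T n)); last 2 first.
- exact: measurableT_comp.
- by move=> x /=.
(* [tuple_prob] uses the other of the two constructions of the product measure; they agree on
   rectangles, hence everywhere. *)
apply: eq_measure_integral => A mA _; apply/esym.
by apply: product_measure_unique => // B C mB mC /=; rewrite product_measure2E.
Qed.

Lemma measurable_integral_cons n (Q : probability (n.-tuple T) R)
    (F : n.+1.-tuple T -> \bar R) :
  measurable_fun setT F -> (forall x, (0 <= F x)%E) ->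
  measurable_fun setT (fun a => \int[Q]_x F [tuple of a :: x])%E.
Proof.
move=> mF F0.
apply: (@measurable_fun_fubini_tonelli_F _ _ _ _ _ Q (F \o @tuple_cons _ T n)).
- by apply: measurableT_comp => //; exact: measurable_tuple_cons.
- by move=> x /=.
Qed.

Lemma measurable_prod_tnth n (f : 'I_n -> T -> R) :
  (forall i, measurable_fun setT (f i)) ->
  measurable_fun setT (fun x : n.-tuple T => \prod_i f i (tnth x i)).
Proof.
move=> mf; apply: measurable_prod => i _.
by apply: measurableT_comp => //; exact: measurable_tnth.
Qed.

Lemma integral_tuple_prob_prod n (P : 'I_n -> probability T R)
    (f : 'I_n -> T -> R) :
  (forall i, measurable_fun setT (f i)) -> (forall i x, 0 <= f i x) ->
  (\int[tuple_prob P]_x (\prod_i f i (tnth x i))%:E =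
   \prod_i \int[P i]_x (f i x)%:E)%E.
Proof.
elim: n P f => [|n IH] P f mf f0.
  rewrite big_ord0/= integral_dirac//; first by rewrite diracT mul1e big_ord0.
  by apply/measurable_EFinP; apply: measurable_prod_tnth.
rewrite ge0_integral_tuple_probS; last 2 first.
- by apply/measurable_EFinP; apply: measurable_prod_tnth.
- by move=> x; rewrite lee_fin prodr_ge0.
rewrite big_ord_recl -(IH _ (fun i => f (lift ord0 i)))//.
rewrite -ge0_integralZr//=; last 3 first.
- exact/measurable_EFinP.
- by move=> x _; rewrite lee_fin.
- by apply: integral_ge0 => x _; rewrite lee_fin prodr_ge0.
apply: eq_integral => a _.
rewrite -ge0_integralZl//=; last 3 first.
- by apply/measurable_EFinP; apply: (measurable_prod_tnth (fun i => mf (lift ord0 i))).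
- by move=> x _; rewrite lee_fin prodr_ge0.
- by rewrite lee_fin.
apply: eq_integral => x _; rewrite -EFinM big_ord_recl tnth0; congr (_ * _)%:E.
by apply: eq_bigr => i _; rewrite tnthS.
Qed.

Lemma measurable_map_tuple n (g : T -> T) : measurable_fun setT g ->
  measurable_fun setT (fun x : n.-tuple T => [tuple g (tnth x i) | i < n]).
Proof.
move=> mg; apply/measurable_fun_tnthP => i.
rewrite (_ : _ \o _ = g \o (fun x => tnth x i)).
  by apply: measurableT_comp => //; exact: measurable_tnth.
by apply/funext => x /=; rewrite tnth_mktuple.
Qed.

(** Induction on the number of coordinates, changing variables in the tail and then in the head.
    Applied to multiplication by sqrt t, it replaces a family of laws depending on t by one fixed
    law. *)
Lemma ge0_integral_tuple_prob_map n (P Q : 'I_n -> probability T R) (g : T -> T)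
    (F : n.-tuple T -> \bar R) :
  measurable_fun setT g ->
  (forall i A, measurable A -> P i A = Q i (g @^-1` A)) ->
  measurable_fun setT F -> (forall x, (0 <= F x)%E) ->
  (\int[tuple_prob P]_x F x =
   \int[tuple_prob Q]_x F [tuple g (tnth x i) | i < n])%E.
Proof.
move=> mg; elim: n P Q F => [|n IH] P Q F PQ mF F0.
  by apply: eq_integral => x _; congr F; apply/eq_from_tnth => -[].
have mFc a : measurable_fun setT (fun x : n.-tuple T => F [tuple of a :: x]).
  by apply: measurableT_comp => //; apply: measurable_cons.
have mFg : measurable_fun setT (fun x => F [tuple g (tnth x i) | i < n.+1]).
  by apply: measurableT_comp => //; exact: measurable_map_tuple.
rewrite !ge0_integral_tuple_probS//.
pose Q' i := Q (lift ord0 i).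
transitivity (\int[P ord0]_a \int[tuple_prob Q']_x
    F [tuple of a :: [tuple g (tnth x i) | i < n]])%E.
  apply: eq_integral => a _; apply: IH => //.
  by move=> i A mA; exact: PQ.
rewrite (@eq_measure_integral _ _ _ _ (pushforward (Q ord0) g)); last first.
  by move=> A mA _; exact: PQ.
(* For measurability in a of the inner integral: [G] applies g to all entries but the first, so that
   integral becomes one of F composed with [G] over the tail. *)
pose G (x : n.+1.-tuple T) :=
  [tuple of thead x :: [tuple g (tnth x (lift ord0 i)) | i < n]].
have mG : measurable_fun setT G.
  apply/measurable_fun_tnthP => i; rewrite /G.
  case: (unliftP ord0 i) => [j|] ->.
    rewrite (_ : _ \o _ = g \o (fun x => tnth x (lift ord0 j))).
      by apply: measurableT_comp => //; exact: measurable_tnth.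
    by apply/funext => x /=; rewrite tnthS tnth_mktuple.
  rewrite (_ : _ \o _ = (fun x => tnth x ord0)); first exact: measurable_tnth.
  by apply/funext => x /=; rewrite tnth0.
have mFG : measurable_fun setT (fun a => \int[tuple_prob Q']_x
    F [tuple of a :: [tuple g (tnth x i) | i < n]])%E.
  apply: (eq_measurable_fun (fun a => \int[tuple_prob Q']_x (F \o G) [tuple of a :: x])%E).
    move=> a _; apply: eq_integral => x _; congr F; rewrite /G theadE.
    congr [tuple of _ :: _]; apply/eq_from_tnth => i.
    by rewrite !tnth_mktuple tnthS.
  apply: (@measurable_integral_cons n _ (F \o G)); first exact: measurableT_comp.
  by move=> x /=.
rewrite ge0_integral_pushforward//=; last first.
  by move=> a _; apply: integral_ge0.
apply: eq_integral => a _; apply: eq_integral => x _; congr F.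
apply/eq_from_tnth => i; rewrite tnth_mktuple.
by case: (unliftP ord0 i) => [j|] ->; rewrite ?tnth0 ?tnthS ?tnth_mktuple.
Qed.

End tuple_prob_theory.

Section gaussian_mixture.
Context (R : realType).
Notation mu := (@lebesgue_measure R).

Lemma measurable_sqrtr : measurable_fun [set: R] (@Num.sqrt R).
Proof. apply: continuous_measurable_fun; exact: sqrt_continuous. Qed.

Lemma normal_tuple_scale k (t : R) (A : set (rvec R k)) : 0 < t ->
  measurable A ->
  (normal_tuple (fun=> 0%R) t A =
   \int[tuple_prob (fun _ : 'I_k => normal_prob (0 : R)%R 1%R)]_x
     (\1_A [tuple (Num.sqrt t * tnth x i)%R | i < k])%:E)%E.
Proof.
move=> t0 mA.
have st0 : 0 < Num.sqrt t by rewrite sqrtr_gt0.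
have -> : normal_tuple (fun=> 0) t A = (\int[normal_tuple (fun=> 0%R) t]_x (\1_A x)%:E)%E.
  by rewrite integral_indic// setIT.
apply: (@ge0_integral_tuple_prob_map _ (measurableTypeR R) R k _ _
    (fun x : measurableTypeR R => Num.sqrt t * x) (fun x => (\1_A x)%:E)).
- exact: measurable_funM.
- move=> i B mB; apply: etrans (normal_prob_affine 0 st0 mB) _.
  by under eq_fun do rewrite add0r.
- exact/measurable_EFinP.
- by move=> x; rewrite lee_fin.
Qed.

(** For t > 0 the law is the image of k standard normal variables under scaling by sqrt t, so t
    enters only through a jointly measurable integrand and Tonelli applies. The interval is open
    because [normal_prob 0 0] does not fit this description. *)
Lemma measurable_normal_tuple k (A : set (rvec R k)) : measurable A ->
  measurable_fun (`]0, +oo[%classic : set (measurableTypeR R))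
    (fun t : measurableTypeR R => normal_tuple (fun=> 0%R) t A).
Proof.
move=> mA.
pose Q := tuple_prob (fun _ : 'I_k => normal_prob (0 : R)%R 1%R).
apply: (eq_measurable_fun (fun t : measurableTypeR R => \int[Q]_x
  (\1_A [tuple (Num.sqrt t * tnth x i)%R | i < k])%:E)%E).
  by move=> t; rewrite inE/= in_itv/= andbT => t0; rewrite normal_tuple_scale.
apply: measurable_funTS.
apply: (@measurable_fun_fubini_tonelli_F _ _ (measurableTypeR R) (rvec R k) R Q
  (fun p => (\1_A [tuple (Num.sqrt p.1 * tnth p.2 i)%R | i < k])%:E)); last first.
  by move=> x; rewrite lee_fin.
apply/measurable_EFinP; apply: measurableT_comp; first exact: measurable_indic.
apply/measurable_fun_tnthP => i.
rewrite (_ : _ \o _ = fun p => Num.sqrt p.1 * tnth p.2 i); last first.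
  by apply/funext => p /=; rewrite tnth_mktuple.
apply: measurable_funM; first by apply: measurableT_comp => //; exact: measurable_sqrtr.
apply: (@measurableT_comp _ _ _ _ _ _ (fun x : rvec R k => tnth x i)) => //.
exact: measurable_tnth.
Qed.

Lemma integral_normal_tuple_gauss k (t v : R) (Z : rvec R k) : 0 < t -> 0 < v ->
  (\int[normal_tuple (fun=> 0%R) t]_m
     (expR (- (sqnorm [tuple tnth Z i - tnth m i | i < k] / (2 * v))))%:E =
   ((Num.sqrt (1 + t / v))^-1 ^+ k * expR (- (sqnorm Z / (2 * (v + t)))))%:E)%E.
Proof.
move=> t0 v0.
have -> : (fun m : rvec R k =>
    (expR (- (sqnorm [tuple tnth Z i - tnth m i | i < k] / (2 * v))))%:E) =
  (fun m => (\prod_i expR (- ((2 * v)^-1 * (tnth m i - tnth Z i) ^+ 2)))%:E).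
  apply/funext => m; congr EFin; rewrite -expR_sum; congr expR.
  rewrite sumrN; congr (- _); rewrite /sqnorm mulrC mulr_sumr; apply: eq_bigr => i _.
  by rewrite tnth_mktuple -sqrrN opprB.
have s0 : 0 < Num.sqrt t by rewrite sqrtr_gt0.
have sE : 1 + 2 * (2 * v)^-1 * Num.sqrt t ^+ 2 = 1 + t / v.
  by rewrite sqr_sqrtr ?ltW//; field; rewrite gt_eqF.
have q0 : 0 < 1 + t / v by rewrite addr_gt0// divr_gt0.
rewrite (@integral_tuple_prob_prod _ (measurableTypeR R) R k
  (fun i => normal_prob 0 (Num.sqrt t))
  (fun i x => expR (- ((2 * v)^-1 * (x - tnth Z i) ^+ 2)))); last 2 first.
- move=> i; apply: measurableT_comp => //; apply: measurableT_comp => //.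
  by apply: measurable_funM => //; apply: measurable_funX; apply: measurable_funB.
- by move=> i x; exact: expR_ge0.
under eq_bigr do rewrite integral_normal_gauss ?sE//.
rewrite prodEFin big_split/= prodr_const card_ord -expR_sum.
congr (_ * expR _)%:E.
rewrite sumrN; congr (- _); rewrite /sqnorm mulr_suml; apply: eq_bigr => i _.
by rewrite subr0; field; rewrite !gt_eqF// addr_gt0.
Qed.

Lemma integral_gaussian_mixture k (gamma : R -> R) (nu : probability (rvec R k) R)
    (v : R) (Z : rvec R k) :
  measurable_fun (`]0, +oo[%classic : set (measurableTypeR R)) gamma ->
  (forall t, 0 < t -> 0 <= gamma t) ->
  is_gaussian_mixture gamma nu -> 0 < v ->
  (\int[nu]_m
     (expR (- (sqnorm [tuple tnth Z i - tnth m i | i < k] / (2 * v))))%:E =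
   \int[mu]_(t in `]0%R, +oo[) (gamma t * ((Num.sqrt (1 + t / v))^-1 ^+ k *
     expR (- (sqnorm Z / (2 * (v + t))))))%:E)%E.
Proof.
move=> mg g0 nuE v0.
rewrite (@ge0_integral_mixture _ _ (measurableTypeR R) _ R mu `]0, +oo[ _
  gamma (fun t => normal_tuple (fun=> 0%R) t))//.
- apply: eq_integral => t; rewrite inE/= in_itv/= andbT => t0.
  by rewrite integral_normal_tuple_gauss// -EFinM.
- by move=> t/=; rewrite in_itv/= andbT; exact: g0.
- by move=> A mA; exact: measurable_normal_tuple.
- move=> A mA; apply: etrans (nuE _ mA) _; rewrite -integral_itv_obnd_cbnd//.
  by apply: emeasurable_funM; [exact/measurable_EFinP|exact: measurable_normal_tuple].
- apply/measurable_EFinP; apply: measurableT_comp => //; apply: measurableT_comp => //.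
  apply: measurable_funM => //; apply: measurable_sum => i.
  apply: measurable_funX.
  rewrite (_ : (fun _ => _) = (fun m : rvec R k => tnth Z i - tnth m i)).
    by apply: measurable_funB => //; exact: measurable_tnth.
  by apply/funext => m; rewrite tnth_mktuple.
Qed.

End gaussian_mixture.

(** * The likelihood of a centred Gaussian sample: expansion and domination *)

Section ln_taylor.
Context (R : realType).
(* f is the error of the expansion of psi u = ln u + 1/u - 1 at u = 1, where
   lik k a v = exp (- k / 2 * psi (v / a)); df is its derivative. *)
Let f (u : R) := ln u + u^-1 - ((u - 1) ^+ 2 / 2 + 1).
Let df (u : R) := u^-1 - u ^- 2 - (u - 1).

Let is_derive_f (u : R) : 0 < u -> is_derive u 1 f (df u).
Proof.
move=> u0.
have d1 := is_derive1_ln u0.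
have un : id u != 0 by rewrite /= gt_eqF.
have d2 := is_deriveV un (is_derive_id u 1).
have d3 : is_derive u 1 (fun u => (u - 1) ^+ 2 / 2 + 1) (u - 1).
  apply: is_derive_eq.
  by rewrite /GRing.scale/=; field.
have := is_deriveB (is_deriveD d1 d2) d3.
rewrite /GRing.scale/= mulr1 => h.
exact: h.
Qed.

(** The quotient (1 + u) / u^2 is decreasing and equals 6 at u = 1/2. *)
Let df_bound (u : R) : 2^-1 <= u -> `|df u| <= 6 * (u - 1) ^+ 2.
Proof.
move=> u2; have u0 : 0 < u by apply: lt_le_trans u2; rewrite invr_gt0.
have -> : df u = - ((u - 1) ^+ 2 * ((1 + u) / u ^+ 2)).
  by rewrite /df; field; rewrite gt_eqF.
rewrite normrN normrM ger0_norm ?sqr_ge0// mulrC ger0_norm; last first.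
  by rewrite divr_ge0 ?sqr_ge0//; lra.
apply: ler_wpM2r; first exact: sqr_ge0.
rewrite ler_pdivrMr ?exprn_gt0//; nra.
Qed.

(** Mean value theorem for [f] between 1 and 1 + t: the intermediate point c satisfies |c - 1| <=
    |t|, so [df c] is at most 6 t^2. *)
Lemma ln_taylor (t : R) : - 2^-1 <= t ->
  `|ln (1 + t) - t / (1 + t) - t ^+ 2 / 2| <= 6 * `|t| ^+ 3.
Proof.
move=> t2; have t0 : 0 < 1 + t by lra.
have -> : ln (1 + t) - t / (1 + t) - t ^+ 2 / 2 = f (1 + t) - f 1.
  by rewrite /f ln1 invr1; field; rewrite gt_eqF.
have bound c : 2^-1 <= c -> `|c - 1| <= `|t| -> `|df c * t| <= 6 * `|t| ^+ 3.
  move=> c2 ct; rewrite normrM exprSr mulrA; apply: ler_wpM2r => //.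
  apply: le_trans (df_bound c2) _; apply: ler_wpM2l => //.
  by rewrite -[in leLHS]real_normK ?num_real//; apply: lerXn2r; rewrite ?nnegrE.
have der (a b x : R) : 0 < a -> x \in `]a, b[ -> is_derive x 1 f (df x).
  by move=> a0; rewrite in_itv/= => /andP[ax _]; apply: is_derive_f; lra.
have cont (a b : R) : 0 < a -> {within `[a, b], continuous f}.
  move=> a0; apply: derivable_within_continuous => x.
  rewrite in_itv/= => /andP[x1 _].
  by have [] : is_derive x 1 f (df x) by apply: is_derive_f; lra.
have [tp|tn|<-] := ltgtP 0 t; last by rewrite addr0 subrr normr0 expr0n mulr0.
- have [|c] := MVT _ (fun x => der 1 (1 + t) x ltr01) (cont 1 (1 + t) ltr01).
    by rewrite ltrDl.
  rewrite in_itv/= [1 + t]addrC addrK => /andP[c1 c2] ->.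
  by apply: bound; [lra|rewrite !ger0_norm; lra].
- have [|c] := MVT _ (fun x => der (1 + t) 1 x t0) (cont (1 + t) 1 t0).
    by rewrite gtrDl.
  rewrite in_itv/= distrC => /andP[c1 c2] ->.
  have -> : 1 - (1 + t) = - t by ring.
  rewrite mulrN normrN.
  by apply: bound; [lra|rewrite !ler0_norm; lra].
Qed.

End ln_taylor.

Section lik.
Context (R : realType).

(* The factor (0 < v) makes this vanish at v <= 0, where a / v would still be a
   number. *)
Definition lik (m : nat) (a v : R) : R :=
  (0 < v)%R%:R * (Num.sqrt (a / v) * expR ((1 - a / v) / 2)) ^+ m.

Lemma lik_ge0 m a v : 0 <= lik m a v.
Proof. by rewrite mulr_ge0// exprn_ge0// mulr_ge0 ?sqrtr_ge0// expR_ge0. Qed.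

(* From e^(x/2) >= 1 + x/2, raised to the fourth power. *)
Lemma expR_lower4 (x : R) : -1 <= x -> (1 + x) ^+ 2 + x ^+ 2 / 16 <= expR (2 * x).
Proof.
move=> x1.
apply: (@le_trans _ _ ((1 + x / 2) ^+ 4)).
  rewrite -subr_ge0.
  have -> : (1 + x / 2) ^+ 4 - ((1 + x) ^+ 2 + x ^+ 2 / 16) =
    x ^+ 2 * (1 + x) * (7 + x) / 16 by field.
  by apply: divr_ge0 => //; apply: mulr_ge0; [apply: mulr_ge0; [exact: sqr_ge0|lra]|lra].
have -> : 2 * x = (x / 2) * 4%:R by field.
rewrite expRM_natr; apply: lerXn2r; rewrite ?nnegrE ?expR_ge0//; first lra.
exact: expR_ge1Dx.
Qed.

(** With r = a / v, the eighth power removes the square root and leaves r^4 against exp (4 (r - 1)),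
    that is two factors exp (2 (r - 1)). One absorbs r^2; the other, by [expR_lower4], absorbs r^2
    together with the quadratic gain. *)
Lemma lik_base_le (a v : R) : 0 < a -> 0 < v ->
  (Num.sqrt (a / v) * expR ((1 - a / v) / 2)) ^+ 8 <=
  (1 + ((v - a) / a) ^+ 2 / 16)^-1.
Proof.
move=> a0 v0; set r := a / v.
have r0 : 0 < r by rewrite divr_gt0.
have -> : (Num.sqrt r * expR ((1 - r) / 2)) ^+ 8 = r ^+ 4 / expR (4 * (r - 1)).
  rewrite exprMn (exprM _ 2 4) sqr_sqrtr ?ltW// -expRM_natr -expRN.
  by congr (_ * expR _); field.
rewrite ler_pdivrMr ?expR_gt0// mulrC ler_pdivlMr; last first.
  by rewrite ltr_wpDr// divr_ge0// sqr_ge0.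
have -> : r ^+ 4 * (1 + ((v - a) / a) ^+ 2 / 16) =
  r ^+ 2 * ((1 + (r - 1)) ^+ 2 + (r - 1) ^+ 2 / 16).
  by rewrite /r; field; rewrite !gt_eqF.
have -> : 4 * (r - 1) = 2 * (r - 1) + 2 * (r - 1) by ring.
rewrite expRD; apply: ler_pM; rewrite ?sqr_ge0//.
- by rewrite addr_ge0 ?divr_ge0// sqr_ge0.
- rewrite mulrC expRM_natr; apply: lerXn2r; rewrite ?nnegrE ?expR_ge0 ?(ltW r0)//.
  by apply: le_trans (expR_ge1Dx _); rewrite addrC subrK.
- by apply: expR_lower4; lra.
Qed.

(** The base w is at most 1, so w^m <= (w^8)^(m %/ 8); Bernoulli's inequality then turns the power
    of 1 + t into a linear term. *)
Lemma lik_le m (a v : R) : 0 < a ->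
  lik m a v <= (1 + (m %/ 8)%:R * (((v - a) / a) ^+ 2 / 16))^-1.
Proof.
move=> a0; rewrite /lik; have [v0|v0] := ltP 0 v; last first.
  by rewrite mul0r invr_ge0 addr_ge0// mulr_ge0// divr_ge0// sqr_ge0.
rewrite mulr1n mul1r; set w := _ * expR _; set t := _ / 16.
have w0 : 0 <= w by rewrite mulr_ge0 ?sqrtr_ge0// expR_ge0.
have t0 : 0 <= t by rewrite divr_ge0// sqr_ge0.
have w8 : w ^+ 8 <= (1 + t)^-1 by exact: lik_base_le.
have w1 : w <= 1.
  rewrite -(@ler_pXn2r _ 8)// ?nnegrE// expr1n (le_trans w8)//.
  by rewrite invf_le1 ?lerDl// ltr_wpDr.
apply: (@le_trans _ _ ((w ^+ 8) ^+ (m %/ 8))).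
  rewrite -exprM {1}(divn_eq m 8) exprD mulnC ler_piMr ?exprn_ge0//.
  exact: exprn_ile1.
apply: (@le_trans _ _ ((1 + t)^-1 ^+ (m %/ 8))).
  by apply: lerXn2r; rewrite ?nnegrE ?exprn_ge0// invr_ge0 addr_ge0.
have t1 : 0 < 1 + t by rewrite ltr_wpDr.
have bern n : 1 + n%:R * t <= (1 + t) ^+ n.
  elim: n => [|n IH]; first by rewrite mul0r addr0 expr0.
  rewrite exprS; apply: le_trans (ler_wpM2l (ltW t1) IH).
  rewrite -subr_ge0 -natr1.
  have -> : (1 + t) * (1 + n%:R * t) - (1 + (n%:R + 1) * t) = n%:R * t ^+ 2 by ring.
  by rewrite mulr_ge0// sqr_ge0.
rewrite exprVn lef_pV2// ?posrE ?exprn_gt0//.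
by rewrite ltr_wpDr// mulr_ge0.
Qed.

(** For m >= 8 one has m <= 16 (m %/ 8), so rounding m / 8 down costs only a constant, included in
    the 16 of the bound. *)
Lemma lik_scaled_le m (a A x : R) : 0 < a -> a <= A -> (8 <= m)%N ->
  lik m a (a + x / Num.sqrt m%:R) <= (1 + (x / (16 * A)) ^+ 2)^-1.
Proof.
move=> a0 aA m8; apply: le_trans (lik_le _ _ a0) _.
have m0 : (0 : R) < m%:R by rewrite ltr0n (leq_trans _ m8).
have sm0 : 0 < Num.sqrt m%:R :> R by rewrite sqrtr_gt0.
have A0 : 0 < A by exact: lt_le_trans aA.
rewrite lef_pV2 ?posrE; last 2 first.
- by rewrite ltr_wpDr// mulr_ge0// divr_ge0// sqr_ge0.
- by rewrite ltr_wpDr// sqr_ge0.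
rewrite lerD2l [a + _]addrC addrK.
have -> : (m %/ 8)%:R * ((x / Num.sqrt m%:R / a) ^+ 2 / 16) =
    16 * (m %/ 8)%:R / m%:R * (x / (16 * a)) ^+ 2.
  have mE : m%:R = Num.sqrt m%:R ^+ 2 :> R by rewrite sqr_sqrtr ?ltW.
  rewrite [in RHS]mE.
  by field; rewrite !gt_eqF.
apply: (@le_trans _ _ ((x / (16 * a)) ^+ 2)).
  rewrite !exprMn; apply: ler_wpM2l; first exact: sqr_ge0.
  rewrite !exprVn lef_pV2 ?posrE ?exprn_gt0 ?mulr_gt0//.
  by apply: lerXn2r; rewrite ?nnegrE; lra.
apply: ler_peMl; first exact: sqr_ge0.
rewrite ler_pdivlMr// mul1r -natrM ler_nat.
have := ltn_pmod m (isT : 0 < 8)%N; have := divn_eq m 8.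
have : (0 < m %/ 8)%N by rewrite divn_gt0.
lia.
Qed.

Lemma expR_lip (p q : R) : 0 <= p -> 0 <= q -> `|expR (- p) - expR (- q)| <= `|p - q|.
Proof.
wlog pq : p q / p <= q.
  by move=> H p0 q0; have [/H|/ltW/H] := leP p q; [exact|rewrite distrC [`|p - q|]distrC; exact].
move=> p0 q0; rewrite ger0_norm ?subr_ge0 ?ler_expR ?lerN2// distrC ger0_norm ?subr_ge0//.
have -> : - q = - p + (p - q) by ring.
rewrite expRD -{1}[expR (- p)]mulr1 -mulrBr.
have h1 : 1 - expR (p - q) <= q - p by have := expR_ge1Dx (p - q); lra.
have h2 : 0 <= 1 - expR (p - q) by rewrite subr_ge0 -expR0 ler_expR subr_le0.
apply: le_trans h1; apply: ler_piMl => //.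
by rewrite -expR0 ler_expR oppr_le0.
Qed.

(** With t = x / (a sqrt m), the likelihood is exp (- m / 2 * psi) where psi = ln (1 + t) - t / (1 +
    t) is nonnegative and close to t^2 / 2. As y -> exp (- y) is 1-Lipschitz on y >= 0, exponents
    may be compared: [ln_taylor] gives the first error term, replacing a by v in the variance the
    second. *)
Lemma lik_gauss_le m (a v x : R) : 0 < a -> 0 < v -> (0 < m)%N ->
  `|x| / (a * Num.sqrt m%:R) <= 2^-1 ->
  `|lik m a (a + x / Num.sqrt m%:R) - expR (- (x ^+ 2 / (4 * v ^+ 2)))| <=
  3 * `|x| ^+ 3 / (a ^+ 3 * Num.sqrt m%:R) + x ^+ 2 / 4 * `|a ^- 2 - v ^- 2|.
Proof.
move=> a0 v0 m0; set S := Num.sqrt m%:R => xS.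
have S0 : 0 < S by rewrite sqrtr_gt0 ltr0n.
have mE : m%:R = S ^+ 2 :> R by rewrite sqr_sqrtr.
pose t := x / (a * S).
have aS0 : 0 < a * S by rewrite mulr_gt0.
have at0 : `|t| <= 2^-1 by rewrite /t normrM normfV (gtr0_norm aS0).
have t2 : - 2^-1 <= t by move: at0; rewrite ler_norml => /andP[].
have t0 : 0 < 1 + t by lra.
have vE : a + x / S = a * (1 + t) by rewrite /t; field; rewrite !gt_eqF.
pose psi := ln (1 + t) - t / (1 + t).
have psi0 : 0 <= psi.
  have : ln (1 + t)^-1 <= (1 + t)^-1 - 1.
    rewrite -[X in ln X](addrNK 1) addrC; apply: le_ln1Dx.
    by rewrite ltrBrDr addNr invr_gt0.
  rewrite lnV ?posrE// /psi.
  have -> : t / (1 + t) = 1 - (1 + t)^-1 by field; rewrite gt_eqF.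
  lra.
have likE : lik m a (a + x / S) = expR (- (m%:R / 2 * psi)).
  rewrite /lik vE mulr_gt0// mulr1n mul1r.
  have -> : a / (a * (1 + t)) = (1 + t)^-1 by field; rewrite !gt_eqF.
  have -> : Num.sqrt (1 + t)^-1 = expR (- ln (1 + t) / 2).
    rewrite -[in LHS](@lnK _ (1 + t)) ?posrE// -expRN.
    have -> : - ln (1 + t) = (- ln (1 + t) / 2) * 2%:R by field.
    rewrite expRM_natr sqrtr_sqr ger0_norm ?expR_ge0//.
    by congr expR; field.
  rewrite -expRD -expRM_natr; congr expR; rewrite /psi; field; rewrite gt_eqF//.
rewrite likE; apply: le_trans (expR_lip _ _) _.
- by rewrite mulr_ge0.
- by rewrite divr_ge0 ?sqr_ge0// mulr_ge0// sqr_ge0.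
have -> : m%:R / 2 * psi - x ^+ 2 / (4 * v ^+ 2) =
    m%:R / 2 * (psi - t ^+ 2 / 2) + x ^+ 2 / 4 * (a ^- 2 - v ^- 2).
  by rewrite mE /t; field; rewrite !gt_eqF.
apply: le_trans (ler_normD _ _) _; apply: lerD; last first.
  by rewrite normrM ger0_norm// divr_ge0// sqr_ge0.
rewrite normrM ger0_norm//.
apply: le_trans (ler_wpM2l _ (ln_taylor t2)) _ => //.
rewrite mE /t normrM normfV (gtr0_norm aS0).
rewrite le_eqVlt; apply/orP; left; apply/eqP; field.
by rewrite !gt_eqF.
Qed.

End lik.

Section measurable_lik.
Context (R : realType).

Lemma measurable_fun_pos (h : R -> R) : (forall x, 0 < x -> {for x, continuous h}) ->
  measurable_fun setT (fun x : R => (0 < x)%R%:R * h x).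
Proof.
move=> ch.
rewrite (_ : (fun _ => _) = h \_ `]0, +oo[%classic); last first.
  apply/funext => x; rewrite patchE mem_setE in_itv/= andbT.
  by case: ifP => _; rewrite ?mulr0n ?mul0r ?mulr1n ?mul1r.
apply/(measurable_restrictT _ _).1 => //.
apply: open_continuous_measurable_fun; first exact: interval_open.
by move=> x; rewrite inE/= in_itv/= andbT; exact: ch.
Qed.

Lemma measurable_pos_ind : measurable_fun [set: R] (fun x : R => (0 < x)%R%:R : R).
Proof.
rewrite (_ : (fun _ => _) = \1_(`]0, +oo[%classic : set R)); first exact: measurable_indic.
by apply/funext => x; rewrite indicE mem_setE in_itv/= andbT.
Qed.

Lemma measurable_nneg_ind : measurable_fun [set: R] (fun x : R => (0 <= x)%R%:R : R).
Proof.
rewrite (_ : (fun _ => _) = \1_(`[0, +oo[%classic : set R)); first exact: measurable_indic.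
by apply/funext => x; rewrite indicE mem_setE in_itv/= andbT.
Qed.

Lemma measurable_lik m (a : R) : measurable_fun setT (lik m a).
Proof.
apply: measurable_fun_pos => x x0.
have h : (a / v) @[v --> x] --> a / x.
  by apply: cvgMl_tmp; apply: cvgV => //; rewrite gt_eqF.
have hs : Num.sqrt (a / v) @[v --> x] --> Num.sqrt (a / x).
  by apply: continuous_cvg; [exact: sqrt_continuous|exact: h].
have he : expR ((1 - a / v) / 2) @[v --> x] --> expR ((1 - a / x) / 2).
  apply: continuous_cvg; first exact: continuous_expR.
  by apply: cvgMr_tmp; apply: cvgB => //; exact: cvg_cst.
apply: (@continuous_cvg _ _ _ _ _ _ (fun y : R => y ^+ m)); first exact: exprn_continuous.
exact: cvgM.
Qed.

End measurable_lik.

(** This includes infinite z, since [fine] sends both infinities to 0 and c > 0 preserves them. *)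
Lemma mulr_fine (R : realType) (c : R) (z : \bar R) : 0 < c ->
  c * fine z = fine (c%:E * z)%E.
Proof.
move=> c0; case: z => [r| |] //=; first by rewrite mulr0 gt0_muley.
by rewrite mulr0 gt0_muleNy.
Qed.

(** * Total variation between laws given by unnormalised densities *)

Section ge0_integral_mono.
Context d (T : measurableType d) (R : realType) (mu : {measure set T -> \bar R}).

(** The integral of a nonnegative function is a supremum over simple functions below it, so no
    measurability is involved. This matters for the total variation distance as a function of the
    data, a supremum over all measurable sets. *)
Lemma ge0_integral_mono (f g : T -> \bar R) :
  (forall x, (0 <= f x)%E) -> (forall x, (f x <= g x)%E) ->
  (\int[mu]_x f x <= \int[mu]_x g x)%E.
Proof.
move=> f0 fg.
have g0 x : (0 <= g x)%E by exact: le_trans (fg x).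
rewrite !ge0_integralTE//; apply: le_ereal_sup => _ [h hf <-].
by exists h => // x; exact: le_trans (fg x).
Qed.

Lemma ge0_integral_sub (A : set T) (f : T -> \bar R) :
  (forall x, (0 <= f x)%E) ->
  (\int[mu]_(x in A) f x <= \int[mu]_x f x)%E.
Proof.
move=> f0; rewrite integral_mkcond; apply: ge0_integral_mono => x;
  by rewrite patchE; case: ifP.
Qed.

End ge0_integral_mono.

Section tv.
Context (R : realType).
Notation mu := (@lebesgue_measure R).
Implicit Types (f g : R -> R) (A : set R).

Lemma law_propto_ge0 f A : (forall x, 0 <= f x) -> (0 <= law_propto f A)%E.
Proof.
move=> f0; apply: mule_ge0; first by apply: integral_ge0 => x _; rewrite lee_fin.
by rewrite inve_ge0; apply: integral_ge0 => x _; rewrite lee_fin.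
Qed.

(** The degenerate cases conform: with total mass 0 the numerator is 0 and 0 * +oo = 0, and the
    inverse of an infinite mass is 0. Hence total variation is at most 1 for all data, with no
    integrability to check. *)
Lemma law_propto_le1 f A : (forall x, 0 <= f x) -> (law_propto f A <= 1)%E.
Proof.
move=> f0; rewrite /law_propto.
have : (\int[mu]_(x in A) (f x)%:E <= \int[mu]_x (f x)%:E)%E.
  by apply: ge0_integral_sub => x; rewrite lee_fin.
have : (0 <= \int[mu]_(x in A) (f x)%:E)%E.
  by apply: integral_ge0 => x _; rewrite lee_fin.
case: (\int[mu]_x (f x)%:E)%E => [r| |] I0 Ir.
- have [r0|r0|r0] := ltgtP r 0.
  + by have := le_trans I0 Ir; rewrite lee_fin leNgt r0.
  + by rewrite inver gt_eqF// lee_pdivrMr// mul1e.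
  + move: Ir; rewrite r0 => Ir; have -> : (\int[mu]_(x in A) (f x)%:E)%E = 0%E.
      by apply/eqP; rewrite eq_le I0 Ir.
    by rewrite mul0e lee01.
- by rewrite invey mule0 lee01.
- by have := le_trans I0 Ir.
Qed.

Lemma tv_dist_ge0 (P Q : set R -> \bar R) : (0 <= tv_dist P Q)%E.
Proof.
by apply: (@le_trans _ _ `|P set0 - Q set0|%E) => //; apply: ereal_sup_ubound; exists set0.
Qed.

Lemma tv_dist_law_propto_le1 f g : (forall x, 0 <= f x) -> (forall x, 0 <= g x) ->
  (tv_dist (law_propto f) (law_propto g) <= 1)%E.
Proof.
move=> f0 g0; apply: ub_ereal_sup => _ [A _ <-].
have := law_propto_ge0 A f0; have := law_propto_ge0 A g0.
have := law_propto_le1 A f0; have := law_propto_le1 A g0.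
case: (law_propto f A) => [x| |]//; case: (law_propto g A) => [y| |]//.
rewrite -EFinB/= !lee_fin => y1 x1 y0 x0.
by rewrite ler_norml; lra.
Qed.

(** Only the mass G of g is bounded below. On a set with integrals a and b, a / F - b / G = a / F *
    (G - F) / G + (a - b) / G, and a / F <= 1; each summand is at most the L1 distance over G, hence
    the factor 2. *)
Lemma tv_dist_law_propto_le f g (e c : R) :
  measurable_fun setT f -> measurable_fun setT g ->
  (forall x, 0 <= f x) -> (forall x, 0 <= g x) ->
  0 < c -> (c%:E <= \int[mu]_x (g x)%:E)%E -> (\int[mu]_x (g x)%:E < +oo)%E ->
  (\int[mu]_x `|f x - g x|%:E <= e%:E)%E ->
  (tv_dist (law_propto f) (law_propto g) <= (2 * e / c)%:E)%E.
Proof.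
move=> mf mg f0 g0 c0 cg gy fge.
have ig : mu.-integrable setT (EFin \o g).
  apply/integrableP; split; first exact/measurable_EFinP.
  by under eq_integral do rewrite /= ger0_norm//.
have id : mu.-integrable setT (EFin \o (fun x => f x - g x)).
  apply/integrableP; split; first by apply/measurable_EFinP; apply: measurable_funB.
  exact: le_lt_trans fge (ltry _).
have if_ : mu.-integrable setT (EFin \o f).
  have -> : EFin \o f = (EFin \o (fun x => f x - g x)) \+ (EFin \o g).
    by apply/funext => x /=; rewrite -EFinD subrK.
  exact: integrableD.
pose D := fine (\int[mu]_x `|f x - g x|%:E).
have DE : (\int[mu]_x `|f x - g x|%:E = D%:E)%E.
  rewrite fineK// ge0_fin_numE; first exact: le_lt_trans fge (ltry _).
  by apply: integral_ge0 => x _; rewrite lee_fin.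
have fE (h : R -> R) A : mu.-integrable setT (EFin \o h) -> measurable A ->
    (\int[mu]_(x in A) (h x)%:E = (fine (\int[mu]_(x in A) (h x)%:E)%E)%:E)%E.
  move=> ih mA; rewrite fineK//; apply: integrable_fin_num => //.
  exact: integrableS ih.
have dif A : measurable A ->
    `|fine (\int[mu]_(x in A) (f x)%:E) - fine (\int[mu]_(x in A) (g x)%:E)| <= D.
  move=> mA; rewrite -lee_fin -DE.
  apply: (@le_trans _ _ (\int[mu]_(x in A) `|f x - g x|%:E)%E); last first.
    by apply: ge0_integral_sub => x; rewrite lee_fin.
  set a := fine _; set b := fine _.
  have -> : (`|a - b|%:E = `|\int[mu]_(x in A) (f x)%:E - \int[mu]_(x in A) (g x)%:E|)%E.
    by rewrite (fE f A)// (fE g A)//.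
  rewrite -integralB_EFin//=; last 2 first.
  - exact: integrableS if_.
  - exact: integrableS ig.
  apply: le_abse_integral => //.
  by apply/measurable_EFinP; apply: measurable_funB; exact: measurable_funTS.
apply: ub_ereal_sup => _ [A mA <-].
rewrite /law_propto (fE f A)// (fE g A)// (fE f setT)// (fE g setT)//.
have aF : fine (\int[mu]_(x in A) (f x)%:E) <= fine (\int[mu]_x (f x)%:E).
  by rewrite -lee_fin -!fE//; apply: ge0_integral_sub => x; rewrite lee_fin.
have bG : fine (\int[mu]_(x in A) (g x)%:E) <= fine (\int[mu]_x (g x)%:E).
  by rewrite -lee_fin -!fE//; apply: ge0_integral_sub => x; rewrite lee_fin.
have a0 : 0 <= fine (\int[mu]_(x in A) (f x)%:E).
  by apply: fine_ge0; apply: integral_ge0 => x _; rewrite lee_fin.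
have b0 : 0 <= fine (\int[mu]_(x in A) (g x)%:E).
  by apply: fine_ge0; apply: integral_ge0 => x _; rewrite lee_fin.
have De : D <= e by rewrite -lee_fin -DE.
have cG' : c <= fine (\int[mu]_x (g x)%:E) by rewrite -lee_fin -fE.
have := dif _ mA; have := dif _ (@measurableT _ (measurableTypeR R)).
move: cG' aF bG a0 b0.
move: (fine (\int[mu]_(x in A) (f x)%:E)) => a.
move: (fine (\int[mu]_(x in A) (g x)%:E)) => b.
move: (fine (\int[mu]_x (f x)%:E)) => F.
move: (fine (\int[mu]_x (g x)%:E)) => G.
move=> cG aF bG a0 b0 FGD abD.
have G0 : 0 < G by exact: lt_le_trans cG.
have D0 : 0 <= D by exact: le_trans abD.
have DG : 2 * D / G <= 2 * e / c.
  apply: ler_pM => //; first by rewrite mulr_ge0.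
  - by rewrite invr_ge0 ltW.
  - by rewrite ler_pM2l.
  - by rewrite lef_pV2.
rewrite (inver G) gt_eqF//.
(* The mass of f may be 0; then its law is 0 on every set, and b <= G <= D because G is the
   difference of the masses. *)
have [F0|F0] := ltP 0 F; last first.
  have -> : a = 0 by apply/eqP; rewrite eq_le a0 (le_trans aF F0).
  have F00 : F = 0 by apply/eqP; rewrite eq_le F0 (le_trans a0 aF).
  rewrite mul0e sub0e -EFinM -EFinN abse_EFin lee_fin normrN.
  apply: le_trans DG; rewrite ger0_norm; last by rewrite divr_ge0// ltW.
  rewrite ler_pM2r ?invr_gt0//.
  move: FGD; rewrite F00 sub0r normrN ger0_norm; first by move=> ?; lra.
  exact: ltW.
rewrite (inver F) gt_eqF// -!EFinM -EFinB abse_EFin lee_fin.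
apply: le_trans DG.
have -> : a / F - b / G = a / F * ((G - F) / G) + (a - b) / G.
  by field; rewrite !gt_eqF.
apply: le_trans (ler_normD _ _) _.
have -> : 2 * D / G = D / G + D / G by field; rewrite gt_eqF.
have aF1 : `|a / F| <= 1.
  by rewrite ger0_norm ?divr_ge0 ?(ltW F0)// ler_pdivrMr// mul1r.
rewrite normrM [`|(a - b) / G|]normrM [`|(G - F) / G|]normrM normfV (gtr0_norm G0).
apply: lerD; last first.
  by rewrite ler_pM2r ?invr_gt0.
rewrite -[leRHS]mul1r; apply: ler_pM => //.
- by rewrite mulr_ge0// invr_ge0 ltW.
- by rewrite ler_pM2r ?invr_gt0// distrC.
Qed.

End tv.

(** * Chernoff bounds for sums of squared normal variables *)

Section chernoff.
Context (R : realType).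

(** 1 / (1 - z) = 1 + z / (1 - z), and 1 + y <= exp y. *)
Lemma invr_sqrt_le (z : R) : z < 1 -> (Num.sqrt (1 - z))^-1 <= expR (z / (2 * (1 - z))).
Proof.
move=> z1.
have q0 : 0 < 1 - z by rewrite subr_gt0.
rewrite -sqrtrV ?(ltW q0)// -(ger0_norm (expR_ge0 _)) -sqrtr_sqr; apply: ler_wsqrtr.
rewrite -expRM_natr; apply: le_trans (expR_ge1Dx _).
by rewrite le_eqVlt; apply/orP; left; apply/eqP; field; rewrite gt_eqF.
Qed.

(** The Gaussian integral with k = - l. With z = 2 l s^2, the terms of first order in l cancel and
    the exponent becomes 2 l^2 (s^4 + m^2 s^2) / (1 - z); z <= 1/2 turns the 2 into the 4. *)
Lemma integral_expR_sq_centered (m s l : R) : 0 < s -> `|2 * l * s ^+ 2| <= 2^-1 ->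
  exists2 r, 0 <= r <= expR (4 * l ^+ 2 * (s ^+ 4 + m ^+ 2 * s ^+ 2)) &
  (\int[normal_prob m s]_x (expR (l * (x ^+ 2 - m ^+ 2 - s ^+ 2)))%:E = r%:E)%E.
Proof.
move=> s0 ls; pose z := 2 * l * s ^+ 2.
have /andP[z1 z2] : - 2^-1 <= z <= 2^-1 by rewrite -ler_norml.
have q0 : 0 < 1 - z by lra.
have qE : 1 + 2 * - l * s ^+ 2 = 1 - z by rewrite /z; ring.
exists (expR (- (l * (m ^+ 2 + s ^+ 2))) *
    ((Num.sqrt (1 - z))^-1 * expR (- (- l * (0 - m) ^+ 2 / (1 - z))))).
  apply/andP; split.
    by rewrite mulr_ge0 ?expR_ge0// mulr_ge0 ?invr_ge0 ?sqrtr_ge0 ?expR_ge0.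
  rewrite mulrCA -expRD.
  apply: (@le_trans _ _ (expR (z / (2 * (1 - z))) *
    expR (- (l * (m ^+ 2 + s ^+ 2)) - - l * (0 - m) ^+ 2 / (1 - z)))).
    by rewrite ler_pM2r ?expR_gt0// invr_sqrt_le//; lra.
  rewrite -expRD ler_expR.
  have -> : z / (2 * (1 - z)) + (- (l * (m ^+ 2 + s ^+ 2)) - - l * (0 - m) ^+ 2 / (1 - z)) =
     2 * l ^+ 2 * (s ^+ 4 + m ^+ 2 * s ^+ 2) / (1 - z).
    rewrite /z; field; apply/eqP => h; move: q0; rewrite /z; lra.
  rewrite ler_pdivrMr//.
  have : 0 <= l ^+ 2 * (s ^+ 4 + m ^+ 2 * s ^+ 2).
    apply: mulr_ge0; first exact: sqr_ge0.
    by apply: addr_ge0; [exact: exprn_even_ge0|apply: mulr_ge0; exact: sqr_ge0].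
  rewrite -![_ * l ^+ 2 * _]mulrA; set w := l ^+ 2 * _ => w0.
  nra.
under eq_integral => x _.
  have -> : l * (x ^+ 2 - m ^+ 2 - s ^+ 2) =
    - (l * (m ^+ 2 + s ^+ 2)) + - (- l * (x - 0) ^+ 2) by ring.
  rewrite expRD EFinM.
  over.
rewrite /= ge0_integralZl//=.
- by rewrite integral_normal_gauss ?qE.
- apply/measurable_EFinP; apply: measurableT_comp => //; apply: measurableT_comp => //.
  by apply: measurable_funM => //; apply: measurable_funX; apply: measurable_funB.
Qed.

(** The sum runs over a predicate on the common index set, so that one tail bound under the joint
    law serves for both Y and Z. *)
Definition sq_dev n (J : pred 'I_n) (m : 'I_n -> R) (v : R) (x : rvec R n) :=
  \sum_(i | J i) (tnth x i ^+ 2 - m i ^+ 2 - v).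

Lemma measurable_sq_dev n J m v : measurable_fun setT (@sq_dev n J m v).
Proof.
have -> : @sq_dev n J m v = fun x : rvec R n =>
    \sum_i (J i)%:R * (tnth x i ^+ 2 - m i ^+ 2 - v).
  apply/funext => x; rewrite /sq_dev big_mkcond; apply: eq_bigr => i _.
  by case: ifP => _; rewrite ?mulr0n ?mul0r// mulr1n mul1r.
apply: measurable_sum => i; apply: measurable_funM => //.
apply: measurable_funB => //; apply: measurable_funB => //.
by apply: measurable_funX; exact: measurable_tnth.
Qed.

Lemma integral_expR_sq_dev n (J : pred 'I_n) (m : 'I_n -> R) (v l L : R) :
  0 < v -> `|2 * l * v| <= 2^-1 -> (forall i, `|m i| <= L) ->
  (\int[normal_tuple m v]_x (expR (l * sq_dev J m v x))%:E <=
   (expR (#|J|%:R * (4 * l ^+ 2 * (v ^+ 2 + L ^+ 2 * v))))%:E)%E.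
Proof.
move=> v0 lv mL.
have s0 : 0 < Num.sqrt v by rewrite sqrtr_gt0.
have sE : Num.sqrt v ^+ 2 = v by rewrite sqr_sqrtr ?ltW.
pose f i x : R := if J i then expR (l * (x ^+ 2 - m i ^+ 2 - v)) else 1.
have -> : (fun x : rvec R n => (expR (l * sq_dev J m v x))%:E) =
    (fun x => (\prod_i f i (tnth x i))%:E).
  by apply/funext => x; rewrite /sq_dev mulr_sumr expR_sum big_mkcond.
have /choice[r hr] : forall i, exists r,
   (\int[normal_prob (m i) (Num.sqrt v)]_x (f i x)%:E = r%:E)%E /\
   0 <= r <= if J i then expR (4 * l ^+ 2 * (v ^+ 2 + L ^+ 2 * v)) else 1.
  move=> i; rewrite /f; case: ifP => _.
    have [|r /andP[r0 rb] rE] := @integral_expR_sq_centered (m i) _ l s0; first by rewrite sE.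
    exists r; split; first by rewrite -rE sE.
    rewrite r0/=; apply: le_trans rb _; rewrite ler_expR.
    apply: ler_wpM2l; first by rewrite mulr_ge0 ?sqr_ge0.
    rewrite (exprM _ 2 2) sE lerD2l; apply: ler_wpM2r; first exact: ltW.
    rewrite -[leLHS]real_normK ?num_real//.
    by apply: lerXn2r; rewrite ?nnegrE// (le_trans _ (mL i)).
  exists 1; split; last by rewrite ler01/=.
  by rewrite integral_cst// mul1e; exact: (@probability_setT _ _ _ (normal_prob _ _)).
rewrite (@integral_tuple_prob_prod _ (measurableTypeR R) R n
  (fun i => normal_prob (m i) (Num.sqrt v)) f); last 2 first.
- move=> i; rewrite /f; case: (J i) => //.
  apply: measurableT_comp => //; apply: measurable_funM => //.
  by apply: measurable_funB => //; apply: measurable_funB => //; apply: measurable_funX.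
- by move=> i x; rewrite /f; case: ifP => // _; exact: expR_ge0.
under eq_bigr do rewrite (hr _).1.
rewrite prodEFin lee_fin.
apply: (@le_trans _ _ (\prod_i (if J i then expR (4 * l ^+ 2 * (v ^+ 2 + L ^+ 2 * v)) else 1))).
  by apply: ler_prod => i _; exact: (hr i).2.
by rewrite [#|J|%:R * _]mulrC expRM_natr -big_mkcond prodr_const.
Qed.

(** Markov's inequality for exp (l * [sq_dev]) with l = 1 / sqrt k and l = - 1 / sqrt k, where k =
    #|J|. The moment bound needs |2 l v| <= 1/2, which is the condition 16 v^2 <= k. *)
Lemma sq_dev_tail n (J : pred 'I_n) (m : 'I_n -> R) (v L M : R) :
  0 < v -> (forall i, `|m i| <= L) -> 16 * v ^+ 2 <= #|J|%:R ->
  (normal_tuple m v [set x | (M * Num.sqrt #|J|%:R < `|sq_dev J m v x|)%R] <=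
   (2 * expR (4 * (v ^+ 2 + L ^+ 2 * v) - M))%:E)%E.
Proof.
move=> v0 mL kv; set k : R := #|J|%:R; set S := Num.sqrt k; set C := 4 * _.
have k0 : 0 < k by apply: lt_le_trans kv; rewrite mulr_gt0// exprn_gt0.
have S0 : 0 < S by rewrite sqrtr_gt0.
have SE : S ^+ 2 = k by rewrite sqr_sqrtr ?ltW.
have S4v : 4 * v <= S.
  rewrite -(@ler_pXn2r _ 2)// ?nnegrE ?mulr_ge0 ?(ltW S0) ?(ltW v0)//.
  by rewrite SE exprMn; apply: le_trans kv; rewrite ler_wpM2r ?sqr_ge0// -natrX.
have mS := measurable_sq_dev J m v.
pose P := normal_tuple m v.
have mA e : measurable [set x | (M * S <= e * sq_dev J m v x)%R].
  rewrite -[X in measurable X]setTI.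
  apply: (@measurable_fun_ler _ _ _ _ (fun=> M * S) (fun x => e * sq_dev J m v x)) => //.
  exact: measurable_funM.
have one (e : R) : e ^+ 2 = 1 ->
    (P [set x | (M * S <= e * sq_dev J m v x)%R] <= (expR (C - M))%:E)%E.
  move=> e1; pose l := e / S.
  have l2 : `|2 * l * v| <= 2^-1.
    have en : `|e| = 1.
      by apply/eqP; rewrite -(@eqrXn2 _ 2)// real_normK ?num_real// e1 expr1n.
    rewrite /l !normrM en normfV (gtr0_norm S0) (gtr0_norm v0) mul1r ger0_norm//.
    rewrite mulrAC ler_pdivrMr//; lra.
  have := @integral_expR_sq_dev n J m v l L v0 l2 mL.
  have -> : #|J|%:R * (4 * l ^+ 2 * (v ^+ 2 + L ^+ 2 * v)) = C.
    by rewrite -/k -SE /C /l expr_div_n e1; field; rewrite gt_eqF.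
  move=> H.
  have : ((expR M)%:E * P [set x | (M * S <= e * sq_dev J m v x)%R] <= (expR C)%:E)%E.
    apply: le_trans H.
    rewrite -[X in (_ * P X)%E]setIT -integral_indic// -ge0_integralZl//; last first.
      by apply/measurable_EFinP; exact: measurable_indic.
    apply: ge0_integral_mono => x.
      by rewrite -EFinM lee_fin mulr_ge0// expR_ge0.
    rewrite -EFinM lee_fin indicE; case: (boolP (x \in _)) => [|_].
      by rewrite mulr1 ler_expR inE/= /l mulrAC ler_pdivlMr.
    by rewrite mulr0 expR_ge0.
  rewrite expRD expRN EFinM lee_pdivlMr ?expR_gt0//.
  by rewrite muleC.
have mB : measurable [set x | (M * S < `|sq_dev J m v x|)%R].
  rewrite -[X in measurable X]setTI.
  apply: (@measurable_fun_ltr _ _ _ _ (fun=> M * S) (fun x => `|sq_dev J m v x|)) => //.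
  exact: measurableT_comp.
apply: (@le_trans _ _ (P ([set x | (M * S <= 1 * sq_dev J m v x)%R] `|`
    [set x | (M * S <= -1 * sq_dev J m v x)%R]))).
  apply: le_measure; rewrite ?inE//.
    exact: measurableU.
  move=> x /=; rewrite mul1r mulN1r; have [s0|s0] := leP 0 (sq_dev J m v x).
    by rewrite ger0_norm// => /ltW; left.
  by rewrite ltr0_norm// => /ltW; right.
apply: (le_trans (measureU2 P (mA 1) (mA (-1)))).
by rewrite mulr_natl mulr2n EFinD; apply: leeD; apply: one; rewrite ?expr1n// sqrrN expr1n.
Qed.

End chernoff.

(** * Dominated convergence under a Cauchy-type bound *)

Section cauchy_bound.
Context (R : realType).
Notation mu := (@lebesgue_measure R).

Definition cauchy_fun (c x : R) : R := (1 + (x / c) ^+ 2)^-1.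

Lemma cauchy_fun_ge0 c x : 0 <= cauchy_fun c x.
Proof. by rewrite invr_ge0 addr_ge0// sqr_ge0. Qed.

Lemma measurable_cauchy_fun c : measurable_fun setT (cauchy_fun c).
Proof.
apply: continuous_measurable_fun => x; apply: cvgV.
  by rewrite gt_eqF// ltr_wpDr// sqr_ge0.
apply: cvgD; first exact: cvg_cst.
rewrite expr2; under eq_cvg do rewrite expr2.
by apply: cvgM; apply: cvgMr_tmp; exact: cvg_id.
Qed.

Lemma integral_cauchy_fun_fin c : 0 < c -> (\int[mu]_x (cauchy_fun c x)%:E < +oo)%E.
Proof.
move=> c0.
rewrite (@ge0_integral_affine R 0 c)//; last 2 first.
- by apply/measurable_EFinP; exact: measurable_cauchy_fun.
- by move=> x; rewrite lee_fin cauchy_fun_ge0.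
rewrite lte_mul_pinfty// ?lee_fin ?(ltW c0)//.
under eq_integral do rewrite add0r /cauchy_fun mulrC mulKf ?gt_eqF//.
rewrite (@ge0_symfun_integralT R (fun x => (1 + x ^+ 2)^-1))//.
- have -> : [set x : R | 0 <= x] = `[0, +oo[%classic.
    by apply/seteqP; split => x /=; rewrite in_itv/= andbT.
  by rewrite integral0y_oneDsqr -EFinM ltry.
- by move=> x; rewrite invr_ge0 addr_ge0// sqr_ge0.
- exact: continuous_oneDsqrV.
- by move=> x /=; rewrite sqrrN.
Qed.

Lemma integrable_cauchy_fun c : 0 < c -> mu.-integrable setT (EFin \o cauchy_fun c).
Proof.
move=> c0; apply/integrableP; split.
  by apply/measurable_EFinP; exact: measurable_cauchy_fun.
under eq_integral do rewrite /= ger0_norm ?cauchy_fun_ge0//.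
exact: integral_cauchy_fun_fin.
Qed.

Lemma dominated_integral_to0 (h : nat -> R -> R) (G : R -> R) (N : nat) :
  (forall j, measurable_fun setT (h j)) ->
  (forall x, h j x @[j --> \oo] --> 0) ->
  mu.-integrable setT (EFin \o G) ->
  (forall j x, (N <= j)%N -> `|h j x| <= G x) ->
  forall e, 0 < e -> exists N', forall j, (N' <= j)%N ->
    (\int[mu]_x `|h j x|%:E <= e%:E)%E.
Proof.
move=> mh h0 iG hG e e0.
(* Domination is available only from N on, so the theorem is applied to the sequence shifted by
   N. *)
have [|||||_ cvg0 _] := @dominated_convergence _ _ _ mu setT measurableT
  (fun j x => (h (j + N)%N x)%:E) (cst 0%E) (EFin \o G).
- by move=> j; apply/measurable_EFinP; exact: mh.
- exact: measurable_cst.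
- apply: aeW => x _.
  apply: cvg_EFin; first by apply: nearW.
  have := h0 x; rewrite -(cvg_shiftn N) => H.
  exact: H.
- exact: iG.
- by apply: aeW => x j _; rewrite /= lee_fin; apply: hG; rewrite leq_addl.
have {}cvg0 : (fun j => \int[mu]_x `|h (j + N)%N x|%:E)%E @ \oo --> 0%:E.
  apply: cvg_trans cvg0; apply: near_eq_cvg; apply: nearW => j.
  by apply: eq_integral => x _; rewrite /cst sube0.
have /fine_cvgP[[N1 _ fin] /cvgrPdist_le /(_ _ e0) [N2 _ c0]] := cvg0.
exists (N1 + N2 + N)%N => j jN.
have jE : j = (j - N + N)%N by rewrite subnK// (leq_trans _ jN)// leq_addl.
have j12 : (N1 + N2 <= j - N)%N by rewrite -(leq_add2r N) -jE.
rewrite jE -(fineK (fin (j - N)%N _)) ?lee_fin; last first.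
  by rewrite /= (leq_trans _ j12)// leq_addr.
have := c0 (j - N)%N; rewrite /= sub0r normrN => H.
by apply: le_trans (ler_norm _) (H _); rewrite (leq_trans _ j12)// leq_addl.
Qed.

Lemma abs_fine_integral_sub (f g : R -> R) :
  mu.-integrable setT (EFin \o f) -> mu.-integrable setT (EFin \o g) ->
  (`|fine (\int[mu]_x (f x)%:E) - fine (\int[mu]_x (g x)%:E)|%:E <=
    \int[mu]_x `|f x - g x|%:E)%E.
Proof.
move=> if_ ig.
have -> : (`|fine (\int[mu]_x (f x)%:E) - fine (\int[mu]_x (g x)%:E)|%:E =
    `|\int[mu]_x (f x)%:E - \int[mu]_x (g x)%:E|)%E.
  rewrite -[X in (`|X - _|)%E]fineK; last exact: integrable_fin_num if_.
  by rewrite -[X in (`|_ - X|)%E]fineK//; exact: integrable_fin_num ig.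
rewrite -integralB_EFin//=; apply: le_abse_integral => //.
by apply/measurable_EFinP; apply: measurable_funB; apply/measurable_EFinP;
  [case/integrableP: if_|case/integrableP: ig].
Qed.

(** The substitution u = a + k x multiplies every integral by k, which cancels in e / c. *)
Lemma tv_dist_law_propto_scaled_le (f g : R -> R) (a k e c : R) : 0 < k ->
  measurable_fun setT f -> measurable_fun setT g ->
  (forall x, 0 <= f x) -> (forall x, 0 <= g x) ->
  0 < c -> (c%:E <= \int[mu]_x (g (a + k * x)%R)%:E)%E ->
  (\int[mu]_x (g (a + k * x)%R)%:E < +oo)%E ->
  (\int[mu]_x `|f (a + k * x)%R - g (a + k * x)%R|%:E <= e%:E)%E ->
  (tv_dist (law_propto f) (law_propto g) <= (2 * e / c)%:E)%E.
Proof.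
move=> k0 mf mg f0 g0 c0 cg gy fge.
have -> : 2 * e / c = 2 * (k * e) / (k * c) by field; rewrite !gt_eqF.
have gE : (\int[mu]_x (g x)%:E = k%:E * \int[mu]_x (g (a + k * x)%R)%:E)%E.
  by apply: ge0_integral_affine => //; exact/measurable_EFinP.
apply: tv_dist_law_propto_le => //.
- by rewrite mulr_gt0.
- by rewrite gE EFinM lee_pmul2l.
- by rewrite gE lte_mul_pinfty// lee_fin ltW.
- rewrite (ge0_integral_affine a k0); last 2 first.
  + apply/measurable_EFinP; apply: measurableT_comp => //.
    exact: measurable_funB.
  + by move=> x; rewrite lee_fin.
  by rewrite EFinM lee_pmul2l.
Qed.

End cauchy_bound.

Section cvg0.
Context (R : realType).

Lemma cvg0_le (u w : nat -> R) : (\forall j \near \oo, `|u j| <= w j) ->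
  w j @[j --> \oo] --> 0 -> u j @[j --> \oo] --> 0.
Proof.
move=> uw w0; apply/cvgrPdist_le => e e0.
have /cvgrPdist_le /(_ _ e0) we := w0.
apply: filterS2 uw we => j uj; rewrite !sub0r !normrN => wj.
by apply: le_trans uj _; apply: le_trans (ler_norm _) wj.
Qed.

Lemma cvg0_near (u w : nat -> R) : (\forall j \near \oo, u j = w j) ->
  w j @[j --> \oo] --> 0 -> u j @[j --> \oo] --> 0.
Proof. by move=> uw; apply: cvg_trans; apply: near_eq_cvg; apply: filterS uw => j ->. Qed.

Lemma cvg0D (u w : nat -> R) : u j @[j --> \oo] --> 0 ->
  w j @[j --> \oo] --> 0 -> (u j + w j) @[j --> \oo] --> 0.
Proof. by move=> u0 w0; rewrite -(addr0 0); apply: cvgD. Qed.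

Lemma cvg0M_bounded (u w : nat -> R) (C : R) : (\forall j \near \oo, `|w j| <= C) ->
  u j @[j --> \oo] --> 0 -> (u j * w j) @[j --> \oo] --> 0.
Proof.
move=> wC u0.
apply: (@cvg0_le _ (fun j => `|u j| * C)).
  by apply: filterS wC => j wj; rewrite normrM ler_wpM2l.
rewrite -(mul0r C); apply: cvgMr_tmp.
by rewrite -(@normr0 R R); exact: cvg_norm.
Qed.

Lemma cvg_invr_sqrt (m : nat -> nat) : (forall j, (j <= m j)%N) ->
  (Num.sqrt (m j)%:R)^-1 @[j --> \oo] --> (0 : R).
Proof.
move=> jm; apply/cvgrPdist_le => e e0.
near=> j.
have j0 : (0 : R) < (m j)%:R by rewrite ltr0n (leq_trans _ (jm j))//; near: j; exact: nbhs_infty_gt.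
rewrite sub0r normrN ger0_norm ?invr_ge0 ?sqrtr_ge0//.
rewrite -[e]invrK lef_pV2 ?posrE ?sqrtr_gt0 ?invr_gt0//.
rewrite -(@ler_pXn2r _ 2)// ?nnegrE ?sqrtr_ge0 ?invr_ge0 ?(ltW e0)//.
rewrite sqr_sqrtr ?(ltW j0)//.
apply: (@le_trans _ _ j%:R); last by rewrite ler_nat.
by near: j; exact: nbhs_infty_ger.
Unshelve. all: end_near. Qed.

End cvg0.

(** * Likelihoods along sequences of sample sizes and centres *)

Section lik_asymptotics.
Context (R : realType).
Variables (m : nat -> nat) (a v : nat -> R) (k1 k2 M : R).
Hypothesis jm : forall j, (j <= m j)%N.
Hypotheses (k10 : 0 < k1) (vk : forall j, k1 <= v j <= k2).
Hypothesis av : forall j, `|a j - v j| <= M / Num.sqrt (m j)%:R.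

Lemma center_cvg : (a j - v j) @[j --> \oo] --> 0.
Proof.
apply: cvg0_le; first by apply: nearW => j; exact: av.
by rewrite -(mulr0 M); apply: cvgMl_tmp; exact: cvg_invr_sqrt.
Qed.

Lemma center_bounds : \forall j \near \oo, k1 / 2 <= a j <= 2 * k2.
Proof.
have k12 : k1 <= k2 by have /andP[h1 h2] := vk 0%N; exact: le_trans h2.
have h : 0 < k1 / 2 by rewrite divr_gt0.
have /cvgrPdist_le /(_ _ h) := center_cvg.
apply: filterS => j; rewrite sub0r normrN ler_norml => /andP[h1 h2].
by have /andP[h3 h4] := vk j; apply/andP; split; lra.
Qed.

(** Of the two errors in [lik_gauss_le], the first is of order 1 / sqrt (m j) and the second of
    order |a j - v j|, once a j is bounded below by k1 / 2. *)
Lemma lik_cvg x :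
  (lik (m j) (a j) (a j + x / Num.sqrt (m j)%:R) - expR (- (x ^+ 2 / (4 * v j ^+ 2))))
    @[j --> \oo] --> 0.
Proof.
pose d := k1 / 2.
have d0 : 0 < d by rewrite divr_gt0.
have S0 := @cvg_invr_sqrt R m jm.
apply: (@cvg0_le _ _ (fun j => 3 * `|x| ^+ 3 / d ^+ 3 * (Num.sqrt (m j)%:R)^-1 +
   x ^+ 2 / 4 * (2 * (2 * k2 + k2) / d ^+ 4 * `|a j - v j|))); last first.
  rewrite -[X in _ --> X]addr0; apply: cvgD.
    by rewrite -[X in _ --> X](mulr0 (3 * `|x| ^+ 3 / d ^+ 3)); apply: cvgMl_tmp.
  rewrite -[X in _ --> X](mulr0 (x ^+ 2 / 4)); apply: cvgMl_tmp.
  rewrite -[X in _ --> X](mulr0 (2 * (2 * k2 + k2) / d ^+ 4)); apply: cvgMl_tmp.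
  by rewrite -(@normr0 R R); apply: cvg_norm; exact: center_cvg.
have xS : \forall j \near \oo, `|x| / d * (Num.sqrt (m j)%:R)^-1 <= 2^-1.
  have : (`|x| / d * (Num.sqrt (m j)%:R)^-1) @[j --> \oo] --> (0 : R).
    by rewrite -[X in _ --> X](mulr0 (`|x| / d)); apply: cvgMl_tmp.
  have h2 : (0 : R) < 2^-1 by rewrite invr_gt0.
  move/cvgrPdist_le => /(_ _ h2); apply: filterS => j.
  by rewrite sub0r normrN; apply: le_trans; exact: ler_norm.
have mpos : \forall j \near \oo, (0 < j)%N by exact: nbhs_infty_gt.
have cb := center_bounds.
near=> j.
have j0 : (0 < m j)%N by rewrite (leq_trans _ (jm j))//; near: j.
have /andP[da a2] : d <= a j <= 2 * k2 by near: j.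
have /andP[kv vk2] := vk j.
have a0 : 0 < a j by exact: lt_le_trans da.
have v0 : 0 < v j by exact: lt_le_trans kv.
have dv : d <= v j by rewrite /d; lra.
have Sj0 : (0 : R) < Num.sqrt (m j)%:R by rewrite sqrtr_gt0 ltr0n.
apply: le_trans (@lik_gauss_le R (m j) (a j) (v j) x a0 v0 j0 _) _.
  apply: (@le_trans _ _ (`|x| / d * (Num.sqrt (m j)%:R)^-1)); last by near: j.
  rewrite invfM mulrA ler_pM2r ?invr_gt0//; apply: ler_wpM2l => //.
  by rewrite lef_pV2.
apply: lerD.
  rewrite invfM mulrA ler_pM2r ?invr_gt0//; apply: ler_wpM2l.
    by rewrite mulr_ge0// exprn_ge0.
  rewrite lef_pV2 ?posrE ?exprn_gt0//.
  by apply: lerXn2r; rewrite ?nnegrE ?(ltW d0) ?(ltW a0).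
apply: ler_wpM2l; first by rewrite divr_ge0// sqr_ge0.
have -> : a j ^- 2 - v j ^- 2 = (v j + a j) / (a j ^+ 2 * v j ^+ 2) * (v j - a j).
  by field; rewrite !gt_eqF.
rewrite normrM [`|v j - a j|]distrC; apply: ler_wpM2r => //.
rewrite ger0_norm; last by rewrite divr_ge0 ?mulr_ge0 ?sqr_ge0 ?addr_ge0// ltW.
apply: ler_pM.
- by rewrite addr_ge0// ltW.
- by rewrite invr_ge0 mulr_ge0 ?sqr_ge0.
- by lra.
- rewrite lef_pV2 ?posrE ?mulr_gt0 ?exprn_gt0// (exprD _ 2 2).
  apply: ler_pM; rewrite ?sqr_ge0//;
    by apply: lerXn2r; rewrite ?nnegrE ?(ltW d0) ?(ltW a0) ?(ltW v0).
Unshelve. all: end_near. Qed.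

Lemma lik_dominated : \forall j \near \oo, forall x,
  lik (m j) (a j) (a j + x / Num.sqrt (m j)%:R) <= cauchy_fun (32 * k2) x.
Proof.
have h8 : \forall j \near \oo, (8 <= j)%N by exact: nbhs_infty_ge.
have cb := center_bounds.
near=> j => x.
have j8 : (8 <= m j)%N by rewrite (leq_trans _ (jm j))//; near: j.
have /andP[da a2] : k1 / 2 <= a j <= 2 * k2 by near: j.
have a0 : 0 < a j by apply: lt_le_trans da; rewrite divr_gt0.
rewrite /cauchy_fun.
have -> : 32 * k2 = 16 * (2 * k2) by ring.
exact: lik_scaled_le.
Unshelve. all: end_near. Qed.

(** 1 + y <= exp y, with the constant of [lik_dominated], where 32 k2 is 16 A for A = 2 k2. One
    integrable function thus dominates both the likelihoods and their limits. *)
Lemma gauss_dominated j x : expR (- (x ^+ 2 / (4 * v j ^+ 2))) <= cauchy_fun (32 * k2) x.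
Proof.
have /andP[kv vk2] := vk j.
have v0 : 0 < v j by exact: lt_le_trans kv.
have k20 : 0 < k2 by exact: lt_le_trans vk2.
rewrite expRN /cauchy_fun lef_pV2 ?posrE ?expR_gt0//; last first.
  by rewrite ltr_wpDr// sqr_ge0.
apply: le_trans (expR_ge1Dx _); rewrite lerD2l expr_div_n.
apply: ler_wpM2l; first exact: sqr_ge0.
rewrite lef_pV2 ?posrE ?mulr_gt0 ?exprn_gt0// ?mulr_gt0//.
rewrite exprMn.
have : v j ^+ 2 <= k2 ^+ 2 by apply: lerXn2r; rewrite ?nnegrE ?(ltW v0) ?(ltW k20).
have : 0 <= k2 ^+ 2 by exact: sqr_ge0.
have : (32 : R) ^+ 2 = 1024 by ring.
by move=> ->; lra.
Qed.

End lik_asymptotics.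

(** * Positive uniformly continuous densities *)

Section ucpos.
Context (R : realType).

(* The conditions on gamma and prior, once these are extended to the whole line
   by clamp: uniformly continuous densities are bounded. *)
Definition ucpos (f : R -> R) :=
  [/\ forall x, 0 < f x, exists B, forall x, f x <= B & unif_continuous_on setT f].

Lemma ucpos_continuous f : ucpos f -> continuous f.
Proof.
case=> _ _ uf x; apply/cvgrPdist_lt => e e0.
have [d d0 H] := uf _ e0.
have := @nbhsx_ballx R R x d d0.
by apply: filterS => y; rewrite /ball/= => xy; exact: H.
Qed.

Lemma measurable_ucpos f : ucpos f -> measurable_fun setT f.
Proof. by move/ucpos_continuous; exact: continuous_measurable_fun. Qed.

Lemma ucpos_lower f lo hi : ucpos f -> lo <= hi ->
  exists2 c, 0 < c & forall x, lo <= x <= hi -> c <= f x.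
Proof.
move=> uf lohi.
have [|c cin H] := @EVT_min R f lo hi lohi.
  exact/continuous_subspaceT/ucpos_continuous.
exists (f c); first by case: uf.
by move=> x xin; apply: H; rewrite in_itv.
Qed.

(** The points p j stay in a compact interval without converging: uniform continuity makes the
    numerators close, compactness bounds the denominators below. The points w j may leave the
    interval and even be negative. *)
Lemma ucpos_ratio_cvg f lo hi (w p : nat -> R) : ucpos f -> lo <= hi ->
  (forall j, lo <= p j <= hi) -> (w j - p j) @[j --> \oo] --> 0 ->
  (f (w j) / f (p j) - 1) @[j --> \oo] --> 0.
Proof.
move=> uf lohi pin wp.
have [c c0 cf] := ucpos_lower uf lohi.
apply: (@cvg0_le _ _ (fun j => c^-1 * `|f (w j) - f (p j)|)); last first.
  rewrite -(mulr0 c^-1); apply: cvgMl_tmp.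
  apply/cvgrPdist_lt => e e0; case: uf => _ _ /(_ _ e0)[d d0 H].
  move/cvgrPdist_lt : wp => /(_ _ d0); apply: filterS => j.
  by rewrite !sub0r !normrN normr_id; apply: H.
apply: nearW => j.
have fp : 0 < f (p j) by exact: lt_le_trans (cf _ (pin j)).
have -> : f (w j) / f (p j) - 1 = (f (p j))^-1 * (f (w j) - f (p j)).
  by field; rewrite gt_eqF.
rewrite normrM ler_wpM2r// gtr0_norm ?invr_gt0// lef_pV2 ?posrE//.
exact: cf.
Qed.

End ucpos.

Section tail_dens.
Context (R : realType).

(** The common form of the two limit densities: [J] is 1 - Phi of the rescaled variance for
    [limit_dens] and the constant 1 for [tilde_limit_dens]. *)
Definition tail_dens (n1 : nat) (v a : R) (J : R -> R) (u : R) : R :=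
  (0 <= u)%R%:R * expR (- (n1%:R / (4 * v ^+ 2) * (u - a) ^+ 2)) * J u.

Lemma measurable_tail_dens n1 (v a : R) J : measurable_fun setT J ->
  measurable_fun setT (tail_dens n1 v a J).
Proof.
move=> mJ; apply: measurable_funM => //; apply: measurable_funM.
  exact: measurable_nneg_ind.
apply: measurableT_comp => //; apply: measurableT_comp => //.
by apply: measurable_funM => //; apply: measurable_funX; apply: measurable_funB.
Qed.

End tail_dens.

(** * The limit in the variance *)

Section outer.
Context (R : realType).
Notation mu := (@lebesgue_measure R).
Variables (prior : R -> R) (m : nat -> nat) (a v : nat -> R) (k1 k2 M : R).
Hypothesis up : ucpos prior.
Hypothesis jm : forall j, (j <= m j)%N.
Hypotheses (k10 : 0 < k1) (vk : forall j, k1 <= v j <= k2).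
Hypothesis av : forall j, `|a j - v j| <= M / Num.sqrt (m j)%:R.
Variables (I J : nat -> R -> R) (C c0 : R).
Hypotheses (mI : forall j, measurable_fun setT (I j))
  (mJ : forall j, measurable_fun setT (J j)).
Hypotheses (I0 : forall j u, 0 <= I j u) (J0 : forall j u, 0 <= J j u <= 1).
Hypothesis IC : \forall j \near \oo, forall u, I j u <= C.
(* All indices j satisfy j <= m j, so j -> oo forces the sample sizes to grow. *)
Let pt j x := a j + x / Num.sqrt (m j)%:R.
Hypothesis IJ : forall x, (I j (pt j x) - J j (pt j x)) @[j --> \oo] --> 0.
Hypothesis c00 : 0 < c0.
Hypothesis Jc : \forall j \near \oo, forall x, -1 <= x <= 0 -> c0 <= J j (pt j x).

(** Division by [prior (v j)] does not change the law and makes the prior factor tend to 1. [I] will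
    be the rescaled integral over theta^2, or 1 when there is no Z; [J] will be a normal tail or
    1. *)
Let f j u := prior u / prior (v j) * lik (m j) (a j) u * I j u.
Let g j := tail_dens (m j) (v j) (a j) (J j).

Let pt_pos x : \forall j \near \oo, 0 < pt j x.
Proof.
have h : 0 < k1 / 2 by rewrite divr_gt0.
have : (x / Num.sqrt (m j)%:R) @[j --> \oo] --> (0 : R).
  by rewrite -(mulr0 x); apply: cvgMl_tmp; exact: cvg_invr_sqrt.
move/cvgrPdist_lt => /(_ _ h).
have := center_bounds jm k10 vk av.
apply: filterS2 => j /andP[a1 _]; rewrite sub0r normrN ltr_norml => /andP[h1 _].
by rewrite /pt; lra.
Qed.

Let pt_cvg x : (pt j x - v j) @[j --> \oo] --> (0 : R).
Proof.
have -> : (fun j => pt j x - v j) = (fun j => (a j - v j) + x / Num.sqrt (m j)%:R).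
  by apply/funext => j; rewrite /pt addrAC.
rewrite -[X in _ --> X]addr0; apply: cvgD; first exact: (center_cvg jm av).
by rewrite -(mulr0 x); apply: cvgMl_tmp; exact: cvg_invr_sqrt.
Qed.

Let gE j x : (0 < m j)%N ->
  g j (pt j x) = (0 <= pt j x)%R%:R * (expR (- (x ^+ 2 / (4 * v j ^+ 2))) * J j (pt j x)).
Proof.
move=> j0; rewrite /g /tail_dens -mulrA; congr (_ * (expR (- _) * _)).
have S0 : (0 : R) < Num.sqrt (m j)%:R by rewrite sqrtr_gt0 ltr0n.
have SE : (m j)%:R = Num.sqrt (m j)%:R ^+ 2 :> R by rewrite sqr_sqrtr.
have v0 : 0 < v j by have /andP[h _] := vk j; exact: lt_le_trans h.
have -> : pt j x - a j = x / Num.sqrt (m j)%:R by rewrite /pt; ring.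
rewrite [X in X / (4 * _)]SE; move: (Num.sqrt _) S0 => S S0.
by field; rewrite !gt_eqF.
Qed.

Let g_ge0 j u : 0 <= g j u.
Proof.
by rewrite mulr_ge0 ?mulr_ge0 ?expR_ge0//; case/andP: (J0 j u).
Qed.

Let g_le j x : (0 < m j)%N -> g j (pt j x) <= cauchy_fun (32 * k2) x.
Proof.
move=> j0; rewrite gE//; apply: le_trans (gauss_dominated k10 vk j x).
have /andP[Jge Jle] := J0 j (pt j x).
apply: (@le_trans _ _ (1 * (expR (- (x ^+ 2 / (4 * v j ^+ 2))) * J j (pt j x)))).
  apply: ler_wpM2r; first by rewrite mulr_ge0// expR_ge0.
  by case: (0 <= _).
by rewrite mul1r; apply: ler_piMr => //; exact: expR_ge0.
Qed.

Let mf j : measurable_fun setT (f j).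
Proof.
apply: measurable_funM => //; apply: measurable_funM => //.
- by apply: measurable_funM => //; exact: measurable_ucpos.
- exact: measurable_lik.
Qed.

Let mg j : measurable_fun setT (g j).
Proof. exact: measurable_tail_dens. Qed.

Let f_ge0 j u : 0 <= f j u.
Proof.
case: up => p0 _ _.
by rewrite mulr_ge0// mulr_ge0 ?lik_ge0// divr_ge0// ltW.
Qed.

Let fg_cvg x : (f j (pt j x) - g j (pt j x)) @[j --> \oo] --> 0.
Proof.
have k12 : k1 <= k2 by have /andP[h1 h2] := vk 0%N; exact: le_trans h2.
have h1 := ucpos_ratio_cvg up k12 vk (pt_cvg x).
have h2 := lik_cvg jm k10 vk av x.
have Cb : \forall j \near \oo, `|I j (pt j x)| <= C.
  by apply: filterS IC => j H; rewrite ger0_norm.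
have Lb : \forall j \near \oo, `|lik (m j) (a j) (pt j x) * I j (pt j x)| <= C.
  apply: filterS2 (lik_dominated jm k10 vk av) Cb => j /(_ x) H1 H2.
  rewrite normrM -[C]mul1r; apply: ler_pM => //.
  rewrite ger0_norm ?lik_ge0//; apply: le_trans H1 _.
  by rewrite /cauchy_fun invf_le1 ?lerDl ?sqr_ge0// ltr_wpDr ?sqr_ge0.
have Gb : \forall j \near \oo, `|expR (- (x ^+ 2 / (4 * v j ^+ 2)))| <= 1.
  apply: nearW => j; rewrite ger0_norm ?expR_ge0// -expR0 ler_expR oppr_le0.
  by rewrite divr_ge0 ?sqr_ge0// mulr_ge0 ?sqr_ge0.
(* Telescoping: the prior ratio, the likelihood and [I] are replaced by their limits one after the
   other, the remaining factors being bounded. *)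
have t1 := cvg0M_bounded Lb h1.
have t2 := cvg0M_bounded Cb h2.
have t3 := cvg0M_bounded Gb (IJ x).
apply: cvg0_near (cvg0D t1 (cvg0D t2 t3)).
have j0 : \forall j \near \oo, (0 < j)%N by exact: nbhs_infty_gt.
apply: filterS2 (pt_pos x) j0 => j p0 j0.
rewrite gE ?(leq_trans _ (jm j))// (ltW p0) mulr1n mul1r /f /=.
ring.
Qed.

Lemma tv_limit_outer e : 0 < e -> exists N, forall j, (N <= j)%N ->
  (tv_dist (law_propto (f j)) (law_propto (g j)) <= e%:E)%E.
Proof.
move=> e0.
have k12 : k1 <= k2 by have /andP[h1 h2] := vk 0%N; exact: le_trans h2.
have k20 : 0 < k2 by exact: lt_le_trans k12.
have [p0 [B pB] _] := up.
have [pm pm0 pmin] := ucpos_lower up k12.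
(* Lower bound for the rescaled limit density on -1 <= x <= 0, an interval of length 1: there x^2 <=
   1, v j >= k1 and J >= c0. *)
pose c := expR (- (1 / (4 * k1 ^+ 2))) * c0.
have cc0 : 0 < c by rewrite mulr_gt0 ?expR_gt0.
have C0 : 0 <= C.
  have [N _ H] := IC; exact: le_trans (I0 N 0) (H N (leqnn N) 0).
have B0 : 0 <= B / pm * C + 1.
  by rewrite addr_ge0// mulr_ge0// divr_ge0 ?(ltW pm0)// (le_trans (ltW (p0 0)) (pB 0)).
have near1 : \forall j \near \oo, (0 < j)%N by exact: nbhs_infty_gt.
have near2 : \forall j \near \oo, 0 < pt j (-1) by exact: pt_pos.
have [N _ HN] : \forall j \near \oo, [/\ (0 < j)%N, 0 < pt j (-1),
    (forall x, lik (m j) (a j) (pt j x) <= cauchy_fun (32 * k2) x),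
    (forall u, I j u <= C) & (forall x, -1 <= x <= 0 -> c0 <= J j (pt j x))].
  near=> j; split; near: j => //.
  exact: (lik_dominated jm k10 vk av).
have dom j x : (N <= j)%N ->
    `|f j (pt j x) - g j (pt j x)| <= (B / pm * C + 1) * cauchy_fun (32 * k2) x.
  move=> /HN[j0 _ L_ I_ _].
  apply: le_trans (ler_normB _ _) _.
  rewrite !ger0_norm// mulrDl mul1r; apply: lerD; last first.
    by rewrite g_le// (leq_trans _ (jm j)).
  rewrite /f mulrAC; apply: ler_pM => //.
  - by rewrite mulr_ge0// divr_ge0// ltW.
  - exact: lik_ge0.
  apply: ler_pM => //; first by rewrite divr_ge0// ltW.
  apply: ler_pM => //; first by rewrite ltW.
  - by rewrite invr_ge0 ltW.
  - by rewrite lef_pV2 ?posrE// pmin.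
have e'0 : 0 < e * c / 2 by rewrite divr_gt0// mulr_gt0.
have mpt j : measurable_fun setT (pt j).
  by apply: measurable_funD => //; apply: measurable_funM.
have mfg j : measurable_fun setT (fun x => f j (pt j x) - g j (pt j x)).
  by apply: measurable_funB; apply: measurableT_comp.
have iG : mu.-integrable setT (EFin \o (fun x => (B / pm * C + 1) * cauchy_fun (32 * k2) x)).
  have -> : EFin \o (fun x => (B / pm * C + 1) * cauchy_fun (32 * k2) x) =
      (fun x => (B / pm * C + 1)%:E * (EFin \o cauchy_fun (32 * k2)) x)%E by [].
  by apply: integrableZl => //; apply: integrable_cauchy_fun; rewrite mulr_gt0.
have [N' HN'] := dominated_integral_to0 mfg fg_cvg iG dom e'0.
exists (N + N')%N => j jN.
have /HN[j0 ptN _ _ J_] : (N <= j)%N by rewrite (leq_trans _ jN)// leq_addr.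
have m0 : (0 < m j)%N by rewrite (leq_trans _ (jm j)).
have S0 : (0 : R) < (Num.sqrt (m j)%:R)^-1 by rewrite invr_gt0 sqrtr_gt0 ltr0n.
have ptE x : a j + (Num.sqrt (m j)%:R)^-1 * x = pt j x by rewrite /pt mulrC.
have -> : e = 2 * (e * c / 2) / c by field; rewrite gt_eqF.
apply: (@tv_dist_law_propto_scaled_le _ _ _ (a j) _ _ _ S0) => //.
- under eq_integral do rewrite ptE.
  apply: (@le_trans _ _ (\int[mu]_(x in `[(-1)%R, 0%R]) c%:E)%E).
    rewrite integral_cst//= lebesgue_measure_itv/= lte_fin ltrN10.
    by rewrite -EFinD -EFinM lee_fin opprK add0r mulr1.
  rewrite [X in (X <= _)%E]integral_mkcond; apply: ge0_integral_mono => x; rewrite patchE; case: ifPn => //.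
  + by move=> _; rewrite lee_fin ltW.
  + rewrite inE/= in_itv/= => /andP[x1 x0]; rewrite lee_fin gE//.
    have -> : 0 <= pt j x.
      apply: (le_trans (ltW ptN)); rewrite /pt lerD2l ler_wpM2r// ltW//.
    rewrite mulr1n mul1r; apply: ler_pM; rewrite ?expR_ge0 ?(ltW c00)//; last first.
      by apply: J_; rewrite x1.
    have /andP[v1 v2] := vk j.
    have v0 : 0 < v j by exact: lt_le_trans v1.
    rewrite ler_expR lerN2; apply: ler_pM; rewrite ?sqr_ge0 ?invr_ge0//.
    - by rewrite mulr_ge0// sqr_ge0.
    - by rewrite -sqrrN -[leRHS](expr1n _ 2); apply: lerXn2r; rewrite ?nnegrE; lra.
    - rewrite lef_pV2 ?posrE ?mulr_gt0 ?exprn_gt0// ?(lt_le_trans k10)//.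
      by rewrite ler_pM2l//; apply: lerXn2r; rewrite ?nnegrE ?(ltW k10)// (le_trans (ltW k10)).
  (* Outside [-1, 0] the restricted function takes the default value [point], which is 0 in the
     extended reals. *)
  + by move=> _; rewrite -[point]/(0%E) lee_fin.
- under eq_integral do rewrite ptE.
  apply: le_lt_trans (@integral_cauchy_fun_fin R (32 * k2) _); last by rewrite mulr_gt0.
  by apply: ge0_integral_mono => x; rewrite lee_fin// g_le.
- under eq_integral do rewrite ptE.
  by apply: HN'; rewrite (leq_trans _ jN)// leq_addl.
Unshelve. all: end_near. Qed.

End outer.

(** * The integral over theta^2 and its normal tail limit *)

Section mixture_tail.
Context (R : realType).
Notation mu := (@lebesgue_measure R).

Definition mix_lik (gamma : R -> R) (l : nat) (b u : R) : R :=
  fine (\int[mu]_(t in `]0%R, +oo[) (gamma t * lik l b (u + t))%:E)%E.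

Definition normal_tail (l : nat) (b s u : R) : R :=
  1 - Phi (Num.sqrt l%:R * (u - b) / (Num.sqrt 2 * s)).

(** The maximum of the N(0, 2 s^2) density: multiplied by exp (- y^2 / (4 s^2)) it integrates to
    1. *)
Definition tail_const (s : R) : R := (Num.sqrt 2 * s)^-1 * normal_peak 1.

Lemma tail_const_gt0 x : 0 < x -> 0 < tail_const x.
Proof.
move=> x0; apply: mulr_gt0; last exact: normal_peak_gt0 (oner_neq0 _).
by rewrite invr_gt0 mulr_gt0// sqrtr_gt0.
Qed.

Lemma ge0_integral_pos_affine (c k : R) (h : R -> R) : 0 < k ->
  measurable_fun setT h -> (forall t, 0 <= h t) ->
  (\int[mu]_(t in `]0%R, +oo[) (h t)%:E =
   k%:E * \int[mu]_y ((0 < c + k * y)%R%:R * h (c + k * y)%R)%:E)%E.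
Proof.
move=> k0 mh h0.
transitivity (\int[mu]_t ((0 < t)%R%:R * h t)%:E)%E.
  rewrite integral_mkcond; apply: eq_integral => t _.
  rewrite patchE mem_setE in_itv/= andbT.
  by case: ifP => _; rewrite ?mulr1n ?mul1r ?mulr0n ?mul0r.
apply: (ge0_integral_affine c k0); last first.
  by move=> t; rewrite lee_fin mulr_ge0.
apply/measurable_EFinP; apply: measurable_funM => //.
exact: (@measurable_pos_ind R).
Qed.

Lemma measurable_mix_lik gamma l b : ucpos gamma ->
  measurable_fun setT (mix_lik gamma l b).
Proof.
move=> ug; have [g0 _ _] := ug.
apply: measurableT_comp => //.
rewrite (_ : (fun x => _) =
    fun u => \int[mu]_t ((0 < t)%R%:R * (gamma t * lik l b (u + t)))%:E)%E; last first.
  apply/funext => u; rewrite integral_mkcond; apply: eq_integral => t _.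
  rewrite patchE mem_setE in_itv/= andbT.
  by case: ifP => _; rewrite ?mulr1n ?mul1r ?mulr0n ?mul0r.
apply: (@measurable_fun_fubini_tonelli_F _ _ (measurableTypeR R) (measurableTypeR R) R mu
  (fun p => ((0 < p.2)%R%:R * (gamma p.2 * lik l b (p.1 + p.2)))%:E)); last first.
  by move=> p; rewrite lee_fin mulr_ge0// mulr_ge0 ?lik_ge0// ltW.
have m2 : measurable_fun setT (fun p : measurableTypeR R * measurableTypeR R => p.2).
  exact: measurable_snd.
apply/measurable_EFinP; apply: measurable_funM.
  exact: (measurableT_comp (@measurable_pos_ind R) m2).
apply: measurable_funM.
  exact: (measurableT_comp (measurable_ucpos ug) m2).
by apply: (measurableT_comp (measurable_lik l b)); apply: measurable_funD.
Qed.

(** Rescaling by sqrt 2 * s turns 1 - Phi into the N(0, 2 s^2) mass of y > sqrt l (u - b). This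
    condition reads t > 0 for t = b - u + y / sqrt l, the substitution also used in [mix_lik], so
    that the two integrals share their domain. *)
Lemma normal_tailE (l : nat) (b s u : R) : (0 < l)%N -> 0 < s ->
  ((normal_tail l b s u)%:E =
   \int[mu]_y ((0 < b - u + (Num.sqrt l%:R)^-1 * y)%R%:R *
     (tail_const s * expR (- (y ^+ 2 / (4 * s ^+ 2)))))%:E)%E.
Proof.
move=> l0 s0; set c := Num.sqrt l%:R * (u - b) / (Num.sqrt 2 * s).
have -> : ((normal_tail l b s u)%:E = normal_prob 0 1 `]c, +oo[%classic)%E.
  rewrite /normal_tail -/c /Phi EFinB fineK; last first.
    by rewrite fin_num_measure.
  rewrite -(@probability_setC _ _ _ (normal_prob 0 1)) ?setCitvl//.
have ss0 : 0 < Num.sqrt 2 * s :> R by rewrite mulr_gt0// sqrtr_gt0.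
have sl0 : (0 : R) < Num.sqrt l%:R by rewrite sqrtr_gt0 ltr0n.
rewrite /normal_prob integral_mkcond.
have mind : measurable_fun setT (fun y : R => (c < y)%R%:R : R).
  rewrite (_ : (fun _ => _) = (fun x : R => (0 < x)%R%:R) \o (fun y : R => y - c)).
    apply: measurableT_comp; first exact: (@measurable_pos_ind R).
    exact: measurable_funB.
  by apply/funext => y /=; rewrite subr_gt0.
transitivity (\int[mu]_y ((c < y)%R%:R * normal_pdf 0 1 y)%:E)%E.
  apply: eq_integral => t _; rewrite patchE mem_setE in_itv/= andbT.
  by case: ifP => _; rewrite ?mulr1n ?mul1r ?mulr0n ?mul0r.
have k0 : 0 < (Num.sqrt 2 * s)^-1 by rewrite invr_gt0.
rewrite (ge0_integral_affine 0 k0); last 2 first.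
- by apply/measurable_EFinP; apply: measurable_funM => //; exact: measurable_normal_pdf.
- by move=> y; rewrite lee_fin mulr_ge0// normal_pdf_ge0.
rewrite -ge0_integralZl//; last 3 first.
- apply/measurable_EFinP; apply: (@measurableT_comp _ _ _ _ _ _
    (fun y : R => (c < y)%R%:R * normal_pdf 0 1 y)).
    by apply: measurable_funM => //; exact: measurable_normal_pdf.
  by apply: measurable_funD => //; exact: measurable_funM.
- by move=> y _; rewrite lee_fin mulr_ge0// normal_pdf_ge0.
- by rewrite lee_fin ltW.
apply: eq_integral => y _; rewrite -EFinM add0r; congr EFin.
have -> : (c < (Num.sqrt 2 * s)^-1 * y) = (0 < b - u + (Num.sqrt l%:R)^-1 * y).
  rewrite /c mulrC ltr_pM2l// -subr_gt0.
  have -> : y - Num.sqrt l%:R * (u - b) = Num.sqrt l%:R * (b - u + (Num.sqrt l%:R)^-1 * y).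
    by field; rewrite gt_eqF.
  by rewrite pmulr_rgt0.
rewrite normal_pdfE ?oner_neq0// /normal_fun /tail_const.
rewrite mulrCA; congr (_ * _); rewrite mulrA; congr (_ * expR _).
rewrite subr0 exprMn exprVn exprMn sqr_sqrtr// expr1n.
by field; rewrite gt_eqF.
Qed.

Lemma normal_tail01 l b s u : 0 <= normal_tail l b s u <= 1.
Proof.
rewrite /normal_tail /Phi; set P := normal_prob 0 1 _.
have P0 : (0 <= P)%E by exact: measure_ge0.
have P1 : (P <= 1)%E by exact: (@probability_le1 _ _ _ (normal_prob 0 1)).
have : P \is a fin_num by rewrite ge0_fin_numE// (le_lt_trans P1) ?ltry.
move: P P0 P1 => [x| |]//=; rewrite !lee_fin => x0 x1 _.
by rewrite subr_ge0 x1 gerBl.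
Qed.

Lemma measurable_Phi : measurable_fun setT (@Phi R).
Proof.
apply: measurableT_comp => //.
pose B := [set p : measurableTypeR R * measurableTypeR R | p.2 <= p.1].
have mB : measurable B.
  rewrite -[X in measurable X]setTI.
  apply: (@measurable_fun_ler _ _ _ setT
    (fun p : measurableTypeR R * measurableTypeR R => p.2) (fun p => p.1)) => //.
    exact: measurable_snd.
  exact: measurable_fst.
have := measurable_fun_xsection (normal_prob 0 1) mB.
rewrite (_ : _ \o _ = fun x => normal_prob 0 1 `]-oo, x]%classic)//.
apply/funext => x /=; congr (normal_prob _ _ _).
by apply/seteqP; split => y /=; rewrite /xsection/= in_itv/= inE.
Qed.

Lemma measurable_normal_tail l b s : measurable_fun setT (normal_tail l b s).
Proof.
apply: measurable_funB => //; apply: (measurableT_comp measurable_Phi).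
by apply: measurable_funM => //; apply: measurable_funM => //; exact: measurable_funB.
Qed.

End mixture_tail.

(** * Convergence of the rescaled integral over theta^2 *)

Section inner.
Context (R : realType).
Notation mu := (@lebesgue_measure R).
Variables (gamma : R -> R) (l : nat -> nat) (b s v : nat -> R) (k1 k3 L M : R).
Hypothesis ug : ucpos gamma.
Hypothesis jl : forall j, (j <= l j)%N.
Hypotheses (k10 : 0 < k1) (sk : forall j, k1 <= s j <= k3).
Hypothesis bs : forall j, `|b j - s j| <= M / Num.sqrt (l j)%:R.
Hypothesis sv : forall j, 0 <= s j - v j <= L.

(* Scaled so as to approximate normal_tail (l j) (b j) (s j) u for u near v j. *)
Definition scaled_mix j u :=
  Num.sqrt (l j)%:R * tail_const (s j) / gamma (s j - v j) * mix_lik gamma (l j) (b j) u.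

Let k j : R := (Num.sqrt (l j)%:R)^-1.
(** The integrands of [scaled_mix] and [normal_tail] after t = b j - u + y / sqrt (l j). Then u + t
    = b j + y / sqrt (l j), so the likelihood is centred at b j; for u near v j, t is near s j - v
    j, whence the division by gamma at that point. *)
Let A j u y := (0 < b j - u + k j * y)%R%:R *
  (tail_const (s j) * (gamma (b j - u + k j * y) / gamma (s j - v j)) *
   lik (l j) (b j) (b j + y / Num.sqrt (l j)%:R)).
Let B j u y := (0 < b j - u + k j * y)%R%:R *
  (tail_const (s j) * expR (- (y ^+ 2 / (4 * s j ^+ 2)))).

Let gamma0 x : 0 < gamma x. Proof. by case: ug. Qed.

Let s0 j : 0 < s j.
Proof. by have /andP[h _] := sk j; exact: lt_le_trans h. Qed.

Let tc_bounds j : 0 < tail_const (s j) <= tail_const k1.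
Proof.
have sq2 : 0 < Num.sqrt 2 :> R by rewrite sqrtr_gt0.
rewrite tail_const_gt0//= /tail_const ler_pM2r; last exact: normal_peak_gt0 (oner_neq0 _).
rewrite lef_pV2 ?posrE ?mulr_gt0// ler_pM2l//.
by have /andP[] := sk j.
Qed.

Let mA j u : measurable_fun setT (A j u).
Proof.
have ma : measurable_fun setT (fun y : R => b j - u + k j * y).
  by apply: measurable_funD => //; apply: measurable_funM.
apply: measurable_funM.
  exact: (measurableT_comp (@measurable_pos_ind R) ma).
apply: measurable_funM.
  apply: measurable_funM => //; apply: measurable_funM => //.
  exact: (measurableT_comp (measurable_ucpos ug) ma).
apply: (measurableT_comp (measurable_lik _ _)).
by apply: measurable_funD => //; apply: measurable_funM.
Qed.

Let mB j u : measurable_fun setT (B j u).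
Proof.
have ma : measurable_fun setT (fun y : R => b j - u + k j * y).
  by apply: measurable_funD => //; apply: measurable_funM.
apply: measurable_funM.
  exact: (measurableT_comp (@measurable_pos_ind R) ma).
apply: measurable_funM => //; apply: measurableT_comp => //; apply: measurableT_comp => //.
by apply: measurable_funM => //; apply: measurable_funX.
Qed.

Let A_ge0 j u y : 0 <= A j u y.
Proof.
rewrite mulr_ge0// mulr_ge0 ?lik_ge0// mulr_ge0//; first by have /andP[/ltW] := tc_bounds j.
by rewrite divr_ge0// ltW.
Qed.

Let B_ge0 j u y : 0 <= B j u y.
Proof.
by rewrite mulr_ge0// mulr_ge0 ?expR_ge0//; have /andP[/ltW] := tc_bounds j.
Qed.

Let scaled_mixE j u : (0 < l j)%N -> scaled_mix j u = fine (\int[mu]_y (A j u y)%:E)%E.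
Proof.
move=> l0; rewrite /scaled_mix /mix_lik.
have S0 : (0 : R) < Num.sqrt (l j)%:R by rewrite sqrtr_gt0 ltr0n.
have kk0 : 0 < k j by rewrite invr_gt0.
have /andP[tc0 _] := tc_bounds j.
rewrite mulr_fine; last by rewrite divr_gt0// mulr_gt0.
congr fine.
have mu_ : measurable_fun setT (fun t : R => u + t) by exact: measurable_funD.
rewrite (ge0_integral_pos_affine (b j - u)
  (h := fun t => gamma t * lik (l j) (b j) (u + t)) kk0); last 2 first.
- apply: measurable_funM; first exact: measurable_ucpos.
  exact: (measurableT_comp (measurable_lik _ _)).
- by move=> t; rewrite mulr_ge0 ?lik_ge0// ltW.
rewrite muleA -EFinM.
have -> : Num.sqrt (l j)%:R * tail_const (s j) / gamma (s j - v j) * k j =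
    tail_const (s j) / gamma (s j - v j).
  by rewrite /k; field; rewrite !gt_eqF.
rewrite -ge0_integralZl//; last 3 first.
- apply/measurable_EFinP.
  have ma : measurable_fun setT (fun y : R => b j - u + k j * y).
    by apply: measurable_funD => //; apply: measurable_funM.
  apply: measurable_funM.
    exact: (measurableT_comp (@measurable_pos_ind R) ma).
  apply: measurable_funM; first exact: (measurableT_comp (measurable_ucpos ug) ma).
  apply: (measurableT_comp (measurable_lik _ _)).
  exact: (measurableT_comp mu_ ma).
- by move=> y _; rewrite lee_fin mulr_ge0// mulr_ge0 ?lik_ge0// ltW.
- by rewrite lee_fin divr_ge0// ltW.
apply: eq_integral => y _; rewrite -EFinM; congr EFin.
rewrite /A -[y / _]mulrC -/(k j).
have -> : u + (b j - u + k j * y) = b j + k j * y by ring.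
by rewrite mulrCA; congr (_ * _); ring.
Qed.

(** The bound is uniform in u, as domination in the variance will require. The ratio of values of
    gamma is at most [Bg / c], where c is a lower bound of gamma on [0, L], which contains s j - v
    j. *)
Let dom : exists2 C, 0 < C & \forall j \near \oo, forall u y,
  A j u y <= C * cauchy_fun (32 * k3) y /\ B j u y <= C * cauchy_fun (32 * k3) y.
Proof.
have L0 : 0 <= L by have /andP[h1 h2] := sv 0%N; exact: le_trans h2.
have [c c0 cg] := ucpos_lower ug L0.
have [_ [Bg gB] _] := ug.
have Bg0 : 0 < Bg by apply: lt_le_trans (gB 0).
have tk : 0 < tail_const k1 by have /andP[h1 h2] := tc_bounds 0%N; exact: lt_le_trans h2.
exists (tail_const k1 * (Bg / c) + tail_const k1); first by rewrite addr_gt0// mulr_gt0// divr_gt0.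
have := lik_dominated jl k10 sk bs.
apply: filterS => j H u y.
have /andP[tc0 tck] := tc_bounds j.
have cf0 := cauchy_fun_ge0 (32 * k3) y.
have ind (x r : R) : 0 <= r -> (0 < x)%R%:R * r <= r.
  by move=> r0; case: (0 < x); rewrite ?mulr1n ?mul1r// mulr0n mul0r.
split.
- apply: le_trans (ind _ _ _) _.
    by rewrite mulr_ge0 ?lik_ge0// mulr_ge0 ?(ltW tc0)// divr_ge0// ltW.
  apply: (@le_trans _ _ (tail_const k1 * (Bg / c) * cauchy_fun (32 * k3) y)).
    apply: ler_pM => //; rewrite ?lik_ge0//.
      by rewrite mulr_ge0 ?(ltW tc0)// divr_ge0// ltW.
    apply: ler_pM; rewrite ?(ltW tc0)// ?divr_ge0 ?(ltW (gamma0 _))//.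
    apply: ler_pM; rewrite ?invr_ge0 ?(ltW (gamma0 _))// lef_pV2 ?posrE//.
    exact: cg.
  by apply: ler_wpM2r => //; rewrite lerDl ltW.
- apply: le_trans (ind _ _ _) _.
    by rewrite mulr_ge0 ?expR_ge0// ltW.
  apply: (@le_trans _ _ (tail_const k1 * cauchy_fun (32 * k3) y)).
    apply: ler_pM; rewrite ?expR_ge0 ?(ltW tc0)//.
    exact: (gauss_dominated k10 sk).
  by apply: ler_wpM2r => //; rewrite lerDr ltW// mulr_gt0// divr_gt0.
Qed.

Let k3_gt0 : 0 < k3.
Proof. by have /andP[h1 h2] := sk 0%N; apply: lt_le_trans h2; exact: lt_le_trans h1. Qed.

Lemma scaled_mix_bounded : exists C, \forall j \near \oo, forall u, scaled_mix j u <= C.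
Proof.
have [C C0 CAB] := dom.
have c32 : 0 < 32 * k3 by rewrite mulr_gt0.
exists (C * fine (\int[mu]_y (cauchy_fun (32 * k3) y)%:E)%E).
have j0 : \forall j \near \oo, (0 < j)%N by exact: nbhs_infty_gt.
apply: filterS2 CAB j0 => j H j0 u.
rewrite scaled_mixE ?(leq_trans _ (jl j))// mulr_fine//.
have mc : measurable_fun setT (EFin \o cauchy_fun (32 * k3)).
  by apply/measurable_EFinP; exact: measurable_cauchy_fun.
have CE : (C%:E * (\int[mu]_y (cauchy_fun (32 * k3) y)%:E) =
    \int[mu]_y (C * cauchy_fun (32 * k3) y)%:E)%E.
  rewrite -ge0_integralZl//; last by rewrite lee_fin ltW.
  by move=> x _; rewrite lee_fin cauchy_fun_ge0.
have le : (\int[mu]_y (A j u y)%:E <= \int[mu]_y (C * cauchy_fun (32 * k3) y)%:E)%E.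
  by apply: ge0_integral_mono => y; rewrite lee_fin; [exact: A_ge0|case: (H u y)].
have fin : (\int[mu]_y (C * cauchy_fun (32 * k3) y)%:E < +oo)%E.
  by rewrite -CE lte_mul_pinfty// ?lee_fin ?(ltW C0)//; exact: integral_cauchy_fun_fin.
rewrite CE; apply: fine_le => //.
- rewrite ge0_fin_numE; first exact: le_lt_trans fin.
  by apply: integral_ge0 => y _; rewrite lee_fin A_ge0.
- rewrite ge0_fin_numE// integral_ge0// => y _.
  by rewrite lee_fin mulr_ge0 ?cauchy_fun_ge0// ltW.
Qed.

(** The indicator of t > 0 is the same in both integrands, so its behaviour as j grows is
    irrelevant: the difference tends to 0 through the gamma ratio and the likelihood alone. *)
Lemma scaled_mix_cvg u : (u j - v j) @[j --> \oo] --> 0 ->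
  (scaled_mix j (u j) - normal_tail (l j) (b j) (s j) (u j)) @[j --> \oo] --> 0.
Proof.
move=> uv.
have [C C0 CAB] := dom.
have c32 : 0 < 32 * k3 by rewrite mulr_gt0.
have j0 : \forall j \near \oo, (0 < j)%N by exact: nbhs_infty_gt.
have [N _ HN] : \forall j \near \oo, (0 < j)%N /\ forall u y,
  A j u y <= C * cauchy_fun (32 * k3) y /\ B j u y <= C * cauchy_fun (32 * k3) y.
  by apply: filterS2 j0 CAB => j.
have iG c : mu.-integrable setT (EFin \o (fun x => c * cauchy_fun (32 * k3) x)).
  have -> : EFin \o (fun x => c * cauchy_fun (32 * k3) x) =
      (fun x => c%:E * (EFin \o cauchy_fun (32 * k3)) x)%E by [].
  by apply: integrableZl => //; apply: integrable_cauchy_fun; rewrite mulr_gt0.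
have iA j u' : (N <= j)%N -> mu.-integrable setT (EFin \o A j u').
  move=> /HN[_ H]; apply: le_integrable (iG C) => //.
    by apply/measurable_EFinP; exact: mA.
  move=> y _; rewrite /= lee_fin !ger0_norm//; first by case: (H u' y).
  by rewrite mulr_ge0 ?cauchy_fun_ge0// ltW.
have iB j u' : (N <= j)%N -> mu.-integrable setT (EFin \o B j u').
  move=> /HN[_ H]; apply: le_integrable (iG C) => //.
    by apply/measurable_EFinP; exact: mB.
  move=> y _; rewrite /= lee_fin !ger0_norm//; first by case: (H u' y).
  by rewrite mulr_ge0 ?cauchy_fun_ge0// ltW.
have mAB j : measurable_fun setT (fun y => A j (u j) y - B j (u j) y).
  exact: measurable_funB.
have domAB j y : (N <= j)%N -> `|A j (u j) y - B j (u j) y| <= (C + C) * cauchy_fun (32 * k3) y.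
  move=> /HN[_ H]; apply: le_trans (ler_normB _ _) _; rewrite !ger0_norm// mulrDl.
  by case: (H (u j) y) => h1 h2; exact: lerD.
have cAB y : (A j (u j) y - B j (u j) y) @[j --> \oo] --> 0.
  have L0 : 0 <= L by have /andP[h1 h2] := sv 0%N; exact: le_trans h2.
  have w : (b j - u j + k j * y - (s j - v j)) @[j --> \oo] --> 0.
    have t1 : (k j * y) @[j --> \oo] --> 0.
      by rewrite -(mul0r y); apply: cvgMr_tmp; exact: cvg_invr_sqrt.
    have t2 : (- (u j - v j)) @[j --> \oo] --> 0 by rewrite -oppr0; exact: cvgN.
    apply: cvg0_near (cvg0D (center_cvg jl bs) (cvg0D t1 t2)).
    by apply: nearW => j; ring.
  have h1 := ucpos_ratio_cvg ug L0 sv w.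
  have h2 := lik_cvg jl k10 sk bs y.
  have Lb : \forall j \near \oo, `|(0 < b j - u j + k j * y)%R%:R *
     (tail_const (s j) * lik (l j) (b j) (b j + y / Num.sqrt (l j)%:R))| <= tail_const k1.
    apply: filterS (lik_dominated jl k10 sk bs) => j /(_ y) H.
    have /andP[tc0 tck] := tc_bounds j.
    have lik1 : lik (l j) (b j) (b j + y / Num.sqrt (l j)%:R) <= 1.
      apply: le_trans H _.
      by rewrite /cauchy_fun invf_le1 ?lerDl ?sqr_ge0// ltr_wpDr ?sqr_ge0.
    have p0 : 0 <= tail_const (s j) * lik (l j) (b j) (b j + y / Num.sqrt (l j)%:R).
      by apply: mulr_ge0; [exact: ltW|exact: lik_ge0].
    rewrite normrM (ger0_norm p0) -[tail_const k1]mul1r; apply: ler_pM => //.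
    - by case: (0 < _); rewrite ?normr1 ?normr0.
    - rewrite -[tail_const k1]mulr1; apply: ler_pM => //; first exact: ltW.
      exact: lik_ge0.
  have Tb : \forall j \near \oo,
      `|(0 < b j - u j + k j * y)%R%:R * tail_const (s j)| <= tail_const k1.
    apply: nearW => j; have /andP[tc0 tck] := tc_bounds j.
    rewrite normrM (gtr0_norm tc0) -[tail_const k1]mul1r; apply: ler_pM => //.
    - exact: ltW.
    - by case: (0 < _); rewrite ?normr1 ?normr0.
  apply: cvg0_near (cvg0D (cvg0M_bounded Lb h1) (cvg0M_bounded Tb h2)).
  by apply: nearW => j; rewrite /A /B; ring.
apply/cvgrPdist_le => e e0.
have [N' HN'] := dominated_integral_to0 mAB cAB (iG (C + C)) domAB e0.
exists (N + N')%N => // j /= jN.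
have jN1 : (N <= j)%N by rewrite (leq_trans _ jN)// leq_addr.
have jN2 : (N' <= j)%N by rewrite (leq_trans _ jN)// leq_addl.
have l0 : (0 < l j)%N by have [h _] := HN j jN1; rewrite (leq_trans h).
rewrite sub0r normrN scaled_mixE// -[normal_tail _ _ _ _]/(fine (normal_tail _ _ _ _)%:E).
rewrite normal_tailE// -lee_fin.
apply: le_trans (abs_fine_integral_sub (iA _ _ jN1) (iB _ _ jN1)) _.
exact: HN'.
Qed.

End inner.

(** * Prior densities continued to the whole line *)

Section clamp.
Context (R : realType).
Notation mu := (@lebesgue_measure R).

(** Continuing by the value at 0 keeps positivity and uniform continuity, and allows evaluation at
    arguments that are only asymptotically nonnegative. *)
Definition clamp (f : R -> R) (x : R) := f (Num.max x 0).

Lemma clampE f x : 0 <= x -> clamp f x = f x.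
Proof. by move=> x0; rewrite /clamp max_l. Qed.

Lemma ucpos_clamp (f : R -> R) : prob_density f -> (forall x, 0 <= x -> 0 < f x) ->
  unif_continuous_on `[0, +oo[ f -> ucpos (clamp f).
Proof.
move=> [f0 f1] fpos uf.
have max0 (x : R) : 0 <= Num.max x 0 by rewrite le_max lexx orbT.
have ge0 (x : R) : `[0, +oo[%classic (Num.max x 0) by rewrite /= in_itv/= max0.
split.
- by move=> x; exact: fpos.
(* Near a point where f > 1 + 2/d, f exceeds 2/d on an interval of length d/2,
   and f would have integral greater than 1. *)
- have [d d0 H] := uf _ ltr01.
  exists (1 + 2 / d) => x; rewrite /clamp; move: (max0 x); move: (Num.max x 0) => {}x x0.
  rewrite leNgt; apply/negP => fx.
  pose h := f x - 1.
  have h0 : 2 / d < h by rewrite /h; lra.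
  have : (h%:E * (d / 2)%:E <= \int[mu]_(x in `[0%R, +oo[) (f x)%:E)%E.
    apply: (@le_trans _ _ (\int[mu]_(y in `[x, (x + d / 2)%R]) h%:E)%E).
      rewrite integral_cst//= lebesgue_measure_itv/= lte_fin ltrDl divr_gt0//.
      by rewrite -EFinD addrAC subrr add0r.
    rewrite [X in (X <= _)%E]integral_mkcond [X in (_ <= X)%E]integral_mkcond.
    have h00 : 0 <= h by apply: le_trans (ltW h0); rewrite divr_ge0// ltW.
    apply: ge0_integral_mono => y; rewrite !patchE.
      by case: ifP => _; rewrite ?lee_fin//.
    rewrite !mem_setE !in_itv/= andbT; case: ifPn => [/andP[xy yx]|_].
      have y0 : 0 <= y by exact: le_trans xy.
      rewrite y0 lee_fin.
      have := H x y; rewrite /= !in_itv/= !andbT => /(_ x0 y0).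
      rewrite distrC ger0_norm ?subr_ge0// => /(_ _).
      have yd : y - x < d by rewrite ltrBlDl; apply: le_lt_trans yx _; rewrite ltrD2l; lra.
      move=> /(_ yd); rewrite ltr_norml => /andP[h1 h2]; rewrite /h; lra.
    by case: ifP => y0; rewrite ?lee_fin// f0.
  rewrite f1 -EFinM lee_fin; apply/negP; rewrite -ltNge.
  by have := h0; rewrite ltr_pdivrMr// => h1; lra.
- move=> e e0; have [d d0 H] := uf _ e0.
  exists d => // x y _ _ xy; apply: H => //.
  (* Taking the maximum with 0 is 1-Lipschitz. *)
  apply: le_lt_trans xy.
  by rewrite /Num.max /Order.max; case: ltP => hx; case: ltP => hy;
    rewrite ?subrr ?normr0// ler_norml;
    apply/andP; split; have := ler_norm (x - y); have := ler_norm (y - x); rewrite distrC; lra.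
Qed.

End clamp.

(** * Bounds on the standard normal distribution function *)

Section Phi_facts.
Context (R : realType).
Notation mu := (@lebesgue_measure R).

Lemma PhiE (x : R) : ((Phi x)%:E = normal_prob 0 1 `]-oo, x]%classic)%E.
Proof. by rewrite /Phi fineK// fin_num_measure. Qed.

Lemma Phi_ge0 (x : R) : 0 <= Phi x.
Proof. by rewrite -lee_fin PhiE measure_ge0. Qed.

Lemma le_Phi (x y : R) : x <= y -> Phi x <= Phi y.
Proof.
move=> xy; rewrite -lee_fin !PhiE; apply: le_measure; rewrite ?inE//.
by move=> z /=; rewrite !in_itv/= => zx; exact: le_trans xy.
Qed.

(** On [x, x + 1] the density is at least its value at |x| + 1, so the mass to the right of x is
    positive. *)
Lemma Phi_lt1 (x : R) : Phi x < 1.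
Proof.
have P1 := @probability_setT _ _ _ (normal_prob (0 : R) 1).
have : ((Phi x)%:E + normal_prob 0 1 `]x, +oo[%classic = 1)%E.
  rewrite PhiE -P1 -measureU//.
    by congr (normal_prob _ _ _); rewrite -setCitvl setUv.
  by rewrite -setCitvl setICr.
suff : (0 < normal_prob 0 1 `]x, +oo[%classic)%E.
  have : normal_prob 0 1 `]x, +oo[%classic \is a fin_num by rewrite fin_num_measure.
  case: (normal_prob _ _ _) => [r| |]//= _; rewrite lte_fin => r0.
  by rewrite -EFinD => -[<-]; rewrite ltrDl.
pose q := normal_peak 1 * expR (- ((`|x| + 1) ^+ 2 / 2)).
have q0 : 0 < q by rewrite mulr_gt0 ?expR_gt0//; exact: normal_peak_gt0 (oner_neq0 _).
apply: (@lt_le_trans _ _ (\int[mu]_(y in `[x, (x + 1)%R]) q%:E)%E).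
  rewrite integral_cst//= lebesgue_measure_itv/= lte_fin ltrDl ltr01.
  by rewrite -EFinD addrAC subrr add0r mule1 lte_fin.
rewrite /normal_prob.
have -> : (\int[mu]_(x0 in `]x, +oo[) (normal_pdf 0 1 x0)%:E =
  \int[mu]_(x0 in `[x, +oo[) (normal_pdf 0 1 x0)%:E)%E.
  apply: integral_itv_obnd_cbnd; apply/measurable_EFinP; apply: measurable_funTS.
  exact: measurable_normal_pdf.
rewrite [X in (X <= _)%E]integral_mkcond [X in (_ <= X)%E]integral_mkcond.
apply: ge0_integral_mono => y; rewrite !patchE.
  by case: ifP => _; rewrite ?lee_fin// ltW.
rewrite !mem_setE !in_itv/= andbT; case: ifPn => [/andP[xy yx]|_]; last first.
  by case: ifP => _ //; rewrite lee_fin normal_pdf_ge0.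
rewrite xy lee_fin normal_pdfE ?oner_neq0// ler_pM2l; last exact: normal_peak_gt0 (oner_neq0 _).
rewrite ler_expR subr0 expr1n -[1 *+ 2]/2%:R mulNr lerN2 ler_pM2r ?invr_gt0//.
rewrite -[leLHS]real_normK ?num_real//; apply: lerXn2r; rewrite ?nnegrE ?addr_ge0//.
rewrite -{1}(subrK x y) addrC; apply: le_trans (ler_normD _ _) _.
by rewrite lerD2l ger0_norm ?subr_ge0//; lra.
Qed.

(** Markov's inequality for exp (X^2 / 4) with X standard normal, whose expectation is sqrt 2; for X
    <= z <= 0 it is at least 1 + z^2 / 4. *)
Lemma Phi_le (z : R) : z <= 0 -> Phi z <= Num.sqrt 2 / (1 + z ^+ 2 / 4).
Proof.
move=> z0.
have q0 : 0 < 1 + z ^+ 2 / 4 by rewrite ltr_wpDr// divr_ge0// sqr_ge0.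
rewrite ler_pdivlMr//.
have qE : 1 + 2 * - 4^-1 * 1 ^+ 2 = 2^-1 :> R by field.
have := @integral_normal_gauss R 0 1 (- 4^-1) 0 ltr01; rewrite qE => /(_ _).
rewrite invr_gt0 => /(_ (ltr0Sn R 1)).
rewrite subrr expr0n/= mulr0 mul0r [- 0]oppr0 expR0 mulr1 sqrtrV// invrK => E.
rewrite -lee_fin -E EFinM PhiE muleC.
rewrite -[X in (_ * normal_prob _ _ X)%E]setIT -integral_indic// -ge0_integralZl//; last 2 first.
- exact/measurable_EFinP.
- by rewrite lee_fin ltW.
apply: ge0_integral_mono => x.
  by rewrite -EFinM lee_fin mulr_ge0// ltW.
rewrite -EFinM lee_fin indicE mem_setE in_itv/= ?oppr0 addr0 mulNr opprK.
have [xz|xz] := boolP (x <= z); last by rewrite mulr0 expR_ge0.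
rewrite mulr1n mulr1; apply: le_trans (expR_ge1Dx _); rewrite lerD2l mulrC; apply: ler_wpM2l => //.
by rewrite -sqrrN -[leRHS]sqrrN; apply: lerXn2r; rewrite ?nnegrE; lra.
Qed.

End Phi_facts.

(** * The posterior density in terms of [lik] *)

Section posterior.
Context (R : realType).
Notation mu := (@lebesgue_measure R).

(** The mass of f may be 0 or infinite: by the conventions for inverses both laws then vanish on
    A. *)
Lemma law_propto_scale (c : R) (f : R -> R) (A : set R) : 0 < c -> measurable A ->
  measurable_fun setT f -> (forall x, 0 <= f x) ->
  law_propto (fun x => c * f x) A = law_propto f A.
Proof.
move=> c0 mA mf f0; rewrite /law_propto.
have scale B : measurable B ->
    (\int[mu]_(x in B) (c * f x)%:E = c%:E * \int[mu]_(x in B) (f x)%:E)%E.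
  move=> mB; rewrite -ge0_integralZl//; last 3 first.
  - by apply/measurable_EFinP; exact: measurable_funTS.
  - by move=> x _; rewrite lee_fin.
  - by rewrite lee_fin ltW.
rewrite !scale//.
have : (\int[mu]_(x in A) (f x)%:E <= \int[mu]_x (f x)%:E)%E.
  by apply: ge0_integral_sub => x; rewrite lee_fin.
have : (0 <= \int[mu]_(x in A) (f x)%:E)%E.
  by apply: integral_ge0 => x _; rewrite lee_fin.
case: (\int[mu]_x (f x)%:E)%E => [r| |] I0 Ir; last by have := le_trans I0 Ir.
- have := le_trans I0 Ir; rewrite lee_fin le_eqVlt => /predU1P[r0|r0].
    move: I0 Ir; rewrite -r0; case: (\int[mu]_(x in A) _)%E => [y| |]//.
    rewrite !lee_fin => y0 y1; have -> : y = 0 by apply/eqP; rewrite eq_le y0 y1.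
    by rewrite mule0.
  rewrite -EFinM !inver !gt_eqF ?mulr_gt0// muleAC -EFinM.
  have -> : c * (c * r)^-1 = r^-1 by field; rewrite !gt_eqF.
  by rewrite muleC.
- by rewrite gt0_muley ?lte_fin// !invey !mule0.
Qed.

(** The posterior density up to a factor free of u; the data enter only through the mean squares a
    and b. *)
Definition post_dens (gamma prior : R -> R) (n1 n2 : nat) (a b u : R) : R :=
  prior u * lik n1 a u * mix_lik gamma n2 b u.

(** The contribution of one observation, with its maximum over v split off; the maximum is attained
    at v = a. *)
Lemma lik_base_split (a v : R) : 0 < a -> 0 < v ->
  (Num.sqrt v)^-1 * expR (- (a / (2 * v))) =
  (Num.sqrt a * expR 2^-1)^-1 * (Num.sqrt (a / v) * expR ((1 - a / v) / 2)).
Proof.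
move=> a0 v0.
have sa : 0 < Num.sqrt a by rewrite sqrtr_gt0.
have sv : 0 < Num.sqrt v by rewrite sqrtr_gt0.
rewrite sqrtrM ?(ltW a0)// sqrtrV ?(ltW v0)//.
have -> : (1 - a / v) / 2 = 2^-1 + - (a / (2 * v)) by field; rewrite gt_eqF.
by rewrite expRD; field; rewrite !gt_eqF// expR_gt0.
Qed.

(** a and b are constrained only through the squared norms, so that n2 = 0 is covered: the mean
    square of an empty Z is 0 by convention, but any positive b satisfies the equation. *)
Lemma posterior_densE n1 n2 (gamma prior : R -> R) (nu : probability (rvec R n2) R)
    (Y : rvec R n1) (Z : rvec R n2) (a b v : R) :
  ucpos (clamp gamma) -> is_gaussian_mixture gamma nu ->
  0 < a -> 0 < b -> sqnorm Y = n1%:R * a -> sqnorm Z = n2%:R * b ->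
  posterior_dens nu prior Y Z v =
  (Num.sqrt a * expR 2^-1)^-1 ^+ n1 * (Num.sqrt b * expR 2^-1)^-1 ^+ n2 *
  post_dens (clamp gamma) (clamp prior) n1 n2 a b v.
Proof.
move=> ug nuE a0 b0 Ya Zb; rewrite /posterior_dens /post_dens.
have [v0|v0] := ltP 0 v; last by rewrite /lik ltNge v0/= mulr0n !(mul0r, mulr0).
have sv0 : 0 < Num.sqrt v by rewrite sqrtr_gt0.
rewrite mulr1n mul1r clampE ?(ltW v0)//.
have g0 x : 0 < clamp gamma x by case: ug.
have mg : measurable_fun (`]0, +oo[%classic : set (measurableTypeR R)) gamma.
  apply: (eq_measurable_fun (clamp gamma)).
    by move=> x; rewrite inE/= in_itv/= andbT => x0; rewrite clampE// ltW.
  by apply: measurable_funTS; exact: measurable_ucpos.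
have gge0 t : 0 < t -> 0 <= gamma t by move=> t0; rewrite -clampE ?ltW.
rewrite /Rintegral (integral_gaussian_mixture _ mg gge0 nuE v0).
set D1 := _ ^-1 ^+ n1; set D2 := _ ^-1 ^+ n2.
have D20 : 0 < D2 by rewrite exprn_gt0// invr_gt0 mulr_gt0 ?sqrtr_gt0 ?expR_gt0.
have -> : Num.sqrt v ^- (n1 + n2) * expR (- (sqnorm Y / (2 * v))) =
    D1 * lik n1 a v * Num.sqrt v ^- n2.
  rewrite exprD invfM mulrAC; congr (_ * _).
  rewrite /lik v0 mulr1n mul1r -exprMn -lik_base_split// exprMn exprVn; congr (_ * _).
  by rewrite Ya -expRM_natr; congr expR; field; rewrite gt_eqF.
suff -> : (\int[mu]_(t in `]0%R, +oo[) (gamma t * ((Num.sqrt (1 + t / v))^-1 ^+ n2 *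
     expR (- (sqnorm Z / (2 * (v + t))))))%:E =
   (D2 / Num.sqrt v ^- n2)%:E *
   \int[mu]_(t in `]0%R, +oo[) (clamp gamma t * lik n2 b (v + t))%:E)%E.
  have Dn0 : 0 < D2 / Num.sqrt v ^- n2.
    by apply: divr_gt0 => //; rewrite invr_gt0 exprn_gt0.
  rewrite -mulr_fine// /mix_lik.
  field.
  by rewrite expf_neq0// gt_eqF.
rewrite -ge0_integralZl//; last 3 first.
- apply/measurable_EFinP; apply: measurable_funTS.
  apply: measurable_funM; first exact: measurable_ucpos.
  by apply: (measurableT_comp (measurable_lik _ _)); exact: measurable_funD.
- by move=> t _; rewrite lee_fin mulr_ge0 ?lik_ge0// ltW.
- by rewrite lee_fin divr_ge0 ?invr_ge0 ?exprn_ge0// ltW.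
apply: eq_integral => t; rewrite inE/= in_itv/= andbT => t0.
rewrite -EFinM; congr EFin; rewrite clampE ?(ltW t0)// [RHS]mulrCA; congr (_ * _).
have vt0 : 0 < v + t by rewrite addr_gt0.
have svt0 : 0 < Num.sqrt (v + t) by rewrite sqrtr_gt0.
have -> : 1 + t / v = (v + t) / v by field; rewrite gt_eqF.
rewrite sqrtrM ?(ltW vt0)// sqrtrV ?(ltW v0)// invfM invrK exprMn.
have LE : D2 * lik n2 b (v + t) =
    (Num.sqrt (v + t))^-1 ^+ n2 * expR (- (sqnorm Z / (2 * (v + t)))).
  rewrite /lik vt0 mulr1n mul1r /D2 -exprMn -lik_base_split// exprMn -expRM_natr.
  by rewrite Zb; congr (_ * expR _); field; rewrite gt_eqF.
by rewrite invrK [RHS]mulrAC LE mulrAC.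
Qed.

Lemma measurable_post_dens (gamma prior : R -> R) n1 n2 a b : ucpos gamma -> ucpos prior ->
  measurable_fun setT (post_dens gamma prior n1 n2 a b).
Proof.
move=> ug up; apply: measurable_funM; last exact: measurable_mix_lik.
by apply: measurable_funM; [exact: measurable_ucpos|exact: measurable_lik].
Qed.

Lemma mix_lik_ge0 (gamma : R -> R) l b u : ucpos gamma -> 0 <= mix_lik gamma l b u.
Proof.
case=> g0 _ _; apply: fine_ge0; apply: integral_ge0 => t _.
by rewrite lee_fin mulr_ge0 ?lik_ge0// ltW.
Qed.

Lemma post_dens_ge0 (gamma prior : R -> R) n1 n2 a b u : ucpos gamma -> ucpos prior ->
  0 <= post_dens gamma prior n1 n2 a b u.
Proof.
move=> ug [p0 _ _]; rewrite mulr_ge0 ?mix_lik_ge0//.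
by rewrite mulr_ge0 ?lik_ge0// ltW.
Qed.

End posterior.

(** * Total variation limits along sequences *)

Section tv_sequences.
Context (R : realType).

Lemma eq_tv_dist (P P' Q Q' : set R -> \bar R) :
  (forall A, measurable A -> P A = P' A) -> (forall A, measurable A -> Q A = Q' A) ->
  tv_dist P Q = tv_dist P' Q'.
Proof.
move=> PP QQ; congr ereal_sup; apply/seteqP; split => _ [A mA <-]; exists A => //;
  by rewrite PP ?QQ.
Qed.

Variables (gamma prior : R -> R) (m l : nat -> nat) (a b v s : nat -> R).
Variables (k1 k2 L M C : R).
Hypotheses (ug : ucpos gamma) (up : ucpos prior).
Hypotheses (jm : forall j, (j <= m j)%N) (jl : forall j, (j <= l j)%N).
Hypothesis lm : forall j, (l j)%:R <= C ^+ 2 * (m j)%:R.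
Hypotheses (k10 : 0 < k1) (vk : forall j, k1 <= v j <= k2).
Hypotheses (C0 : 0 <= C) (M0 : 0 <= M).
Hypothesis av : forall j, `|a j - v j| <= M / Num.sqrt (m j)%:R.
Hypothesis bs : forall j, `|b j - s j| <= M / Num.sqrt (l j)%:R.
Hypothesis sv : forall j, 0 <= s j - v j <= L.

Let sk j : k1 <= s j <= k2 + L.
Proof. by have /andP[h1 h2] := vk j; have /andP[h3 h4] := sv j; apply/andP; split; lra. Qed.

Let pt j x := a j + x / Num.sqrt (m j)%:R.

(** Up to a positive factor, the left side is the argument of Phi. Replacing a by v and b by s costs
    a bounded amount because C bounds sqrt (l / m). The remaining term is never positive, which
    bounds the tail from below, and it diverges when the signal is strong. *)
Let arg_le j x : (0 < j)%N ->
  Num.sqrt (l j)%:R * (pt j x - b j) <=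
  - (Num.sqrt (l j)%:R * (s j - v j)) + (M * C + M + C * `|x|).
Proof.
move=> j0.
have l0 : (0 : R) < Num.sqrt (l j)%:R by rewrite sqrtr_gt0 ltr0n (leq_trans j0 (jl j)).
have m0 : (0 : R) < Num.sqrt (m j)%:R by rewrite sqrtr_gt0 ltr0n (leq_trans j0 (jm j)).
have lmS : Num.sqrt (l j)%:R <= C * Num.sqrt (m j)%:R.
  rewrite -{1}(ger0_norm C0) -sqrtr_sqr -sqrtrM ?sqr_ge0//.
  exact: ler_wsqrtr.
have -> : Num.sqrt (l j)%:R * (pt j x - b j) = - (Num.sqrt (l j)%:R * (s j - v j)) +
    (Num.sqrt (l j)%:R * (a j - v j) + Num.sqrt (l j)%:R * - (b j - s j) +
     Num.sqrt (l j)%:R * (x / Num.sqrt (m j)%:R)).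
  by rewrite /pt; ring.
rewrite lerD2l.
have h1 : Num.sqrt (l j)%:R * (a j - v j) <= M * C.
  apply: (@le_trans _ _ (C * Num.sqrt (m j)%:R * (M / Num.sqrt (m j)%:R))).
    apply: (@le_trans _ _ (Num.sqrt (l j)%:R * (M / Num.sqrt (m j)%:R))).
      by rewrite ler_pM2l//; apply: le_trans (ler_norm _) (av j).
    by apply: ler_wpM2r => //; rewrite divr_ge0// ltW.
  by rewrite le_eqVlt; apply/orP; left; apply/eqP; field; rewrite gt_eqF.
have h2 : Num.sqrt (l j)%:R * - (b j - s j) <= M.
  apply: (@le_trans _ _ (Num.sqrt (l j)%:R * (M / Num.sqrt (l j)%:R))).
    by rewrite ler_pM2l//; apply: le_trans (ler_norm _) _; rewrite normrN.
  by rewrite le_eqVlt; apply/orP; left; apply/eqP; field; rewrite gt_eqF.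
have h3 : Num.sqrt (l j)%:R * (x / Num.sqrt (m j)%:R) <= C * `|x|.
  apply: (@le_trans _ _ (C * Num.sqrt (m j)%:R * (`|x| / Num.sqrt (m j)%:R))).
    apply: (@le_trans _ _ (Num.sqrt (l j)%:R * (`|x| / Num.sqrt (m j)%:R))).
      by rewrite ler_pM2l// ler_pM2r ?invr_gt0// ler_norm.
    by apply: ler_wpM2r => //; rewrite divr_ge0// ltW.
  by rewrite le_eqVlt; apply/orP; left; apply/eqP; field; rewrite gt_eqF.
by apply: lerD => //; apply: lerD.
Qed.

Let pt_cvg x : (pt j x - v j) @[j --> \oo] --> (0 : R).
Proof.
have t : (x / Num.sqrt (m j)%:R) @[j --> \oo] --> (0 : R).
  by rewrite -(mulr0 x); apply: cvgMl_tmp; exact: cvg_invr_sqrt.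
apply: cvg0_near (cvg0D (center_cvg jm av) t).
by apply: nearW => j; rewrite /pt; ring.
Qed.

Let c0 : R := 1 - Phi ((M * C + M + C) / (Num.sqrt 2 * k1)).

(** Since s j >= v j, the signal term in [arg_le] only lowers the argument of Phi, and s j >= k1
    bounds the denominator; [c0] uses |x| <= 1. *)
Let tail_lower : \forall j \near \oo, forall x, -1 <= x <= 0 ->
  c0 <= normal_tail (l j) (b j) (s j) (pt j x).
Proof.
have j0 : \forall j \near \oo, (0 < j)%N by exact: nbhs_infty_gt.
apply: filterS j0 => j j0 x /andP[x1 x0].
rewrite /normal_tail lerD2l lerN2; apply: le_Phi.
have /andP[ks _] := sk j.
have s0 : 0 < s j by exact: lt_le_trans ks.
have sq2 : 0 < Num.sqrt 2 :> R by rewrite sqrtr_gt0.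
apply: (@le_trans _ _ ((M * C + M + C) / (Num.sqrt 2 * s j))).
  rewrite ler_pM2r ?invr_gt0 ?mulr_gt0//.
  apply: le_trans (arg_le x j0) _.
  have h1 : 0 <= Num.sqrt (l j)%:R * (s j - v j).
    by rewrite mulr_ge0// ?sqrtr_ge0//; have /andP[] := sv j.
  have h2 : C * `|x| <= C.
    by apply: ler_piMr => //; rewrite ler0_norm// lerNl.
  lra.
apply: ler_wpM2l; first by rewrite !addr_ge0// mulr_ge0.
by rewrite lef_pV2 ?posrE ?mulr_gt0// ler_pM2l.
Qed.

Let I := scaled_mix gamma l b s v.

Let post_scaled j A : (0 < j)%N -> measurable A ->
  law_propto (fun u => prior u / prior (v j) * lik (m j) (a j) u * I j u) A =
  law_propto (post_dens gamma prior (m j) (l j) (a j) (b j)) A.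
Proof.
move=> j0 mA.
have [g0 _ _] := ug; have [p0 _ _] := up.
have l0 : (0 : R) < Num.sqrt (l j)%:R by rewrite sqrtr_gt0 ltr0n (leq_trans j0 (jl j)).
have s0 : 0 < s j by have /andP[h _] := sk j; exact: lt_le_trans h.
have tc0 : 0 < tail_const (s j) by exact: tail_const_gt0.
rewrite -[RHS](@law_propto_scale _
  (Num.sqrt (l j)%:R * tail_const (s j) / gamma (s j - v j) / prior (v j)))//.
- congr law_propto; apply/funext => u; rewrite /I /scaled_mix /post_dens.
  by field; rewrite !gt_eqF.
- by rewrite divr_gt0// divr_gt0// mulr_gt0.
- exact: measurable_post_dens.
- by move=> x; exact: post_dens_ge0.
Qed.

Let mI j : measurable_fun setT (I j).
Proof. by apply: measurable_funM => //; exact: measurable_mix_lik. Qed.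

Let I0 j u : 0 <= I j u.
Proof.
have [g0 _ _] := ug.
have s0 : 0 < s j by have /andP[h _] := sk j; exact: lt_le_trans h.
apply: mulr_ge0; last exact: mix_lik_ge0.
apply: divr_ge0; last exact: ltW.
by apply: mulr_ge0; [exact: sqrtr_ge0|apply/ltW/tail_const_gt0].
Qed.

Lemma tv_limit_seq e : 0 < e -> exists N, forall j, (N <= j)%N ->
  (tv_dist (law_propto (post_dens gamma prior (m j) (l j) (a j) (b j)))
     (law_propto (tail_dens (m j) (v j) (a j) (normal_tail (l j) (b j) (s j)))) <= e%:E)%E.
Proof.
move=> e0.
have [D ID] := scaled_mix_bounded ug jl k10 sk bs sv.
have c00 : 0 < c0 by rewrite subr_gt0 Phi_lt1.
have IJ x := scaled_mix_cvg ug jl k10 sk bs sv (pt_cvg x).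
have [N HN] := tv_limit_outer up jm k10 vk av mI
  (fun j => measurable_normal_tail (l j) (b j) (s j)) I0
  (fun j u => normal_tail01 (l j) (b j) (s j) u) ID IJ c00 tail_lower e0.
exists N.+1 => j jN; apply: le_trans (HN j (ltnW jN)).
rewrite le_eqVlt; apply/orP; left; apply/eqP; apply: eq_tv_dist => // A mA.
by rewrite post_scaled// (leq_trans _ jN).
Qed.

(** Divergence of sqrt n2 times mean mu0^2, in the form that [uniform_of_sequences] delivers: the
    j-th parameters satisfy the lower bound j. *)
Hypothesis sep : forall j, j%:R <= Num.sqrt (l j)%:R * (s j - v j).

Let tail_cvg x : (normal_tail (l j) (b j) (s j) (pt j x) - 1) @[j --> \oo] --> 0.
Proof.
pose T := M * C + M + C * `|x|.
have T0 : 0 <= T by rewrite !addr_ge0// mulr_ge0.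
have k30 : 0 < k2 + L.
  by have /andP[h1 h2] := sk 0%N; apply: lt_le_trans h2; exact: lt_le_trans h1.
have sq2 : 0 < Num.sqrt 2 :> R by rewrite sqrtr_gt0.
pose D := Num.sqrt 2 * (k2 + L).
have D0 : 0 < D by rewrite mulr_gt0.
apply: (@cvg0_le _ _ (fun j => Num.sqrt 2 * (4 * D) / (j%:R - T))); last first.
  rewrite -(mulr0 (Num.sqrt 2 * (4 * D))); apply: cvgMl_tmp.
  apply/cvgrPdist_le => e e0.
  have := @nbhs_infty_ger R (T + e^-1); apply: filterS => j jT.
  have jT' : e^-1 <= j%:R - T by rewrite lerBrDl.
  have ei : 0 < e^-1 by rewrite invr_gt0.
  rewrite sub0r normrN gtr0_norm ?invr_gt0 ?(lt_le_trans ei)//.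
  by rewrite -[e]invrK lef_pV2 ?posrE// (lt_le_trans ei).
have h1 := @nbhs_infty_ger R (T + D).
have h2 : \forall j \near \oo, (0 < j)%N by exact: nbhs_infty_gt.
apply: filterS2 h1 h2 => j jT j0.
rewrite /normal_tail addrAC subrr sub0r normrN ger0_norm ?Phi_ge0//.
have /andP[ks sk3] := sk j.
have s0 : 0 < s j by exact: lt_le_trans ks.
(* The argument of Phi is at most - z, by [arg_le], [sep] and sqrt 2 * s j <= D. In [Phi_le], z <=
   z^2 for z >= 1 leaves a bound of order 1 / (j - T). *)
pose z := (j%:R - T) / D.
have z1 : 1 <= z by rewrite /z ler_pdivlMr// mul1r; lra.
apply: (@le_trans _ _ (Phi (- z))).
  apply: le_Phi; rewrite ler_pdivrMr ?mulr_gt0//.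
  apply: le_trans (arg_le x j0) _.
  have : z * (Num.sqrt 2 * s j) <= j%:R - T.
    rewrite /z mulrAC ler_pdivrMr//; apply: ler_wpM2l; first lra.
    by rewrite ler_pM2l.
  have := sep j; rewrite -/T mulNr => ? ?; lra.
apply: le_trans (Phi_le _) _; first by rewrite oppr_le0; lra.
rewrite -mulrA; apply: ler_wpM2l; first exact: ltW.
have jT0 : 0 < j%:R - T by lra.
rewrite sqrrN -[leRHS]invrK lef_pV2 ?posrE; last 2 first.
- by rewrite ltr_wpDr// divr_ge0// sqr_ge0.
- by rewrite invr_gt0 divr_gt0// mulr_gt0.
have -> : (4 * D / (j%:R - T))^-1 = z / 4 by rewrite /z; field; rewrite !gt_eqF.
have : z <= z ^+ 2 by rewrite expr2; apply: ler_peMr => //; lra.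
lra.
Qed.

Lemma tv_tilde_limit_seq (e : R) : 0 < e -> exists N, forall j, (N <= j)%N ->
  (tv_dist (law_propto (post_dens gamma prior (m j) (l j) (a j) (b j)))
     (law_propto (tail_dens (m j) (v j) (a j) (cst 1%R))) <= e%:E)%E.
Proof.
move=> e0.
have [D ID] := scaled_mix_bounded ug jl k10 sk bs sv.
have IJ x : (I j (pt j x) - 1) @[j --> \oo] --> 0.
  apply: cvg0_near (cvg0D (scaled_mix_cvg ug jl k10 sk bs sv (pt_cvg x)) (tail_cvg x)).
  by apply: nearW => j; rewrite /I; ring.
have J0 (j : nat) (u : R) : 0 <= cst (1 : R) u <= 1 by rewrite ler01 lexx.
have Jc : \forall j \near \oo, forall x, -1 <= x <= 0 -> 1 <= cst 1 (pt j x) :> R.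
  by apply: nearW => j x _; exact: lexx.
have mJ (j : nat) : measurable_fun setT (cst 1 : R -> R) by exact: measurable_cst.
have [N HN] := @tv_limit_outer R prior m a v k1 k2 M up jm k10 vk av I (fun=> cst 1) D 1
  mI mJ I0 J0 ID IJ ltr01 Jc e e0.
exists N.+1 => j jN; apply: le_trans (HN j (ltnW jN)).
rewrite le_eqVlt; apply/orP; left; apply/eqP; apply: eq_tv_dist => // A mA.
by rewrite post_scaled// (leq_trans _ jN).
Qed.

End tv_sequences.

Section tv_sequence_no_signal.
Context (R : realType).
Notation mu := (@lebesgue_measure R).
Variables (gamma prior : R -> R) (m : nat -> nat) (a v : nat -> R).
Variables (k1 k2 M b : R).
Hypotheses (ug : ucpos gamma) (up : ucpos prior).
Hypothesis g1 : (\int[mu]_(t in `]0%R, +oo[) (gamma t)%:E = 1)%E.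
Hypothesis jm : forall j, (j <= m j)%N.
Hypotheses (k10 : 0 < k1) (vk : forall j, k1 <= v j <= k2).
Hypothesis av : forall j, `|a j - v j| <= M / Num.sqrt (m j)%:R.

(** An empty sample has likelihood 1, so only the total mass of gamma remains. *)
Let mix_lik0 u : 0 < u -> mix_lik gamma 0 b u = 1.
Proof.
move=> u0; rewrite /mix_lik (_ : 1 = fine 1%:E)// -g1; congr fine.
apply: eq_integral => t; rewrite inE/= in_itv/= andbT => t0.
by rewrite /lik addr_gt0// expr0 mulr1n !mulr1.
Qed.

Lemma tv_no_signal_seq e : 0 < e -> exists N, forall j, (N <= j)%N ->
  (tv_dist (law_propto (post_dens gamma prior (m j) 0 (a j) b))
     (law_propto (tail_dens (m j) (v j) (a j) (cst 1%R))) <= e%:E)%E.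
Proof.
move=> e0; have [p0 _ _] := up.
have I0 (j : nat) (u : R) : 0 <= cst (1 : R) u by exact: ler01.
have J0 (j : nat) (u : R) : 0 <= cst (1 : R) u <= 1 by rewrite ler01 lexx.
have IC : \forall j \near \oo, forall u : R, cst (1 : R) u <= 1.
  by apply: nearW => j u; exact: lexx.
have IJ (x : R) : (cst 1 (a j + x / Num.sqrt (m j)%:R) -
    cst 1 (a j + x / Num.sqrt (m j)%:R)) @[j --> \oo] --> (0 : R).
  by rewrite /cst subrr; exact: cvg_cst.
have Jc : \forall j \near \oo, forall x, -1 <= x <= 0 ->
    1 <= cst 1 (a j + x / Num.sqrt (m j)%:R) :> R.
  by apply: nearW => j x _; exact: lexx.
have mJ (j : nat) : measurable_fun setT (cst 1 : R -> R) by exact: measurable_cst.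
have [N HN] := @tv_limit_outer R prior m a v k1 k2 M up jm k10 vk av (fun=> cst 1) (fun=> cst 1)
  1 1 mJ mJ I0 J0 IC IJ ltr01 Jc e e0.
exists N => j jN; apply: le_trans (HN j jN).
rewrite le_eqVlt; apply/orP; left; apply/eqP; apply: eq_tv_dist => // A mA.
rewrite -[LHS](@law_propto_scale _ (prior (v j))^-1)//.
- congr law_propto; apply/funext => u; rewrite /post_dens mulr1.
  have [u0|u0] := ltP 0 u; first by rewrite mix_lik0//; ring.
  by rewrite /lik ltNge u0/= mulr0n !(mul0r, mulr0).
- by rewrite invr_gt0.
- exact: measurable_post_dens.
- by move=> x; exact: post_dens_ge0.
Qed.

End tv_sequence_no_signal.

(* Turns convergence along sequences into uniform convergence. *)
Lemma uniform_of_sequences (T : Type) (D : nat -> T -> Prop) (P : T -> Prop) :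
  (forall th : nat -> T, (forall j, D j (th j)) -> exists j, P (th j)) ->
  exists N, forall th, D N th -> P th.
Proof.
move=> H; apply: contrapT => /forallNP H'.
have /choice[th Hth] : forall N, exists th, D N th /\ ~ P th.
  move=> N; have := H' N => /existsNP[th /not_implyP[h1 h2]].
  by exists th.
have [j Pj] := H th (fun j => (Hth j).1).
exact: (Hth j).2.
Qed.

(** * Uniform total variation limits *)

Section uniform_tv.
Context (R : realType).
Notation mu := (@lebesgue_measure R).
Variables (gamma prior : R -> R) (k1 k2 L M C e : R).
Hypotheses (ug : ucpos gamma) (up : ucpos prior).
Hypotheses (k10 : 0 < k1) (C0 : 0 <= C) (M0 : 0 <= M) (e0 : 0 < e).

(** All varying quantities are packed into one tuple, and the domain with index N requires n1, n2 >=
    N, so a sequence drawn from these domains has sizes tending to infinity. *)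
Lemma tv_limit_uniform : exists N, forall n1 n2 v s a b,
  (N <= n1)%N -> (N <= n2)%N -> n2%:R <= C ^+ 2 * n1%:R ->
  k1 <= v <= k2 -> 0 <= s - v <= L ->
  `|a - v| <= M / Num.sqrt n1%:R -> `|b - s| <= M / Num.sqrt n2%:R ->
  (tv_dist (law_propto (post_dens gamma prior n1 n2 a b))
     (law_propto (tail_dens n1 v a (normal_tail n2 b s))) <= e%:E)%E.
Proof.
have [|N HN] := @uniform_of_sequences ((nat * nat) * ((R * R) * (R * R)))
    (fun N t => let n1 := t.1.1 in let n2 := t.1.2 in
      let v := t.2.1.1 in let s := t.2.1.2 in let a := t.2.2.1 in let b := t.2.2.2 in
      [/\ (N <= n1)%N, (N <= n2)%N & n2%:R <= C ^+ 2 * n1%:R] /\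
      [/\ k1 <= v <= k2, 0 <= s - v <= L,
        `|a - v| <= M / Num.sqrt n1%:R & `|b - s| <= M / Num.sqrt n2%:R])
    (fun t => let n1 := t.1.1 in let n2 := t.1.2 in
      let v := t.2.1.1 in let s := t.2.1.2 in let a := t.2.2.1 in let b := t.2.2.2 in
      (tv_dist (law_propto (post_dens gamma prior n1 n2 a b))
        (law_propto (tail_dens n1 v a (normal_tail n2 b s))) <= e%:E)%E); last first.
  exists N => n1 n2 v s a b h1 h2 h3 h4 h5 h6 h7.
  exact: (HN ((n1, n2), ((v, s), (a, b))) (conj (And3 h1 h2 h3) (And4 h4 h5 h6 h7))).
move=> th /all_and2[/all_and3[jm jl lm] /all_and4[vk sv av bs]].
have [N HN] := tv_limit_seq ug up jm jl lm k10 vk C0 M0 av bs sv e0.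
by exists N; exact: HN.
Qed.

Lemma tv_tilde_limit_uniform : exists N, forall n1 n2 v s a b,
  (N <= n1)%N -> (N <= n2)%N -> n2%:R <= C ^+ 2 * n1%:R ->
  k1 <= v <= k2 -> 0 <= s - v <= L ->
  `|a - v| <= M / Num.sqrt n1%:R -> `|b - s| <= M / Num.sqrt n2%:R ->
  N%:R <= Num.sqrt n2%:R * (s - v) ->
  (tv_dist (law_propto (post_dens gamma prior n1 n2 a b))
     (law_propto (tail_dens n1 v a (cst 1%R))) <= e%:E)%E.
Proof.
have [|N HN] := @uniform_of_sequences ((nat * nat) * ((R * R) * (R * R)))
    (fun N t => let n1 := t.1.1 in let n2 := t.1.2 in
      let v := t.2.1.1 in let s := t.2.1.2 in let a := t.2.2.1 in let b := t.2.2.2 in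
      [/\ (N <= n1)%N, (N <= n2)%N, n2%:R <= C ^+ 2 * n1%:R & N%:R <= Num.sqrt n2%:R * (s - v)] /\
      [/\ k1 <= v <= k2, 0 <= s - v <= L,
        `|a - v| <= M / Num.sqrt n1%:R & `|b - s| <= M / Num.sqrt n2%:R])
    (fun t => let n1 := t.1.1 in let n2 := t.1.2 in
      let v := t.2.1.1 in let s := t.2.1.2 in let a := t.2.2.1 in let b := t.2.2.2 in
      (tv_dist (law_propto (post_dens gamma prior n1 n2 a b))
        (law_propto (tail_dens n1 v a (cst 1%R))) <= e%:E)%E); last first.
  exists N => n1 n2 v s a b h1 h2 h3 h4 h5 h6 h7 h8.
  exact: (HN ((n1, n2), ((v, s), (a, b))) (conj (And4 h1 h2 h3 h8) (And4 h4 h5 h6 h7))).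
move=> th /all_and2[/all_and4[jm jl lm sep] /all_and4[vk sv av bs]].
have [N HN] := tv_tilde_limit_seq ug up jm jl lm k10 vk C0 M0 av bs sv sep e0.
by exists N; exact: HN.
Qed.

Lemma tv_no_signal_uniform (b : R) :
  (\int[mu]_(t in `]0%R, +oo[) (gamma t)%:E = 1)%E ->
  exists N, forall n1 v a, (N <= n1)%N -> k1 <= v <= k2 ->
  `|a - v| <= M / Num.sqrt n1%:R ->
  (tv_dist (law_propto (post_dens gamma prior n1 0 a b))
     (law_propto (tail_dens n1 v a (cst 1%R))) <= e%:E)%E.
Proof.
move=> g1.
have [|N HN] := @uniform_of_sequences (nat * (R * R))
    (fun N t => let n1 := t.1 in let v := t.2.1 in let a := t.2.2 in
      [/\ (N <= n1)%N, k1 <= v <= k2 & `|a - v| <= M / Num.sqrt n1%:R])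
    (fun t => let n1 := t.1 in let v := t.2.1 in let a := t.2.2 in
      (tv_dist (law_propto (post_dens gamma prior n1 0 a b))
        (law_propto (tail_dens n1 v a (cst 1%R))) <= e%:E)%E); last first.
  by exists N => n1 v a h1 h2 h3; exact: (HN (n1, (v, a))).
move=> th /all_and3[jm vk av].
have [N HN] := tv_no_signal_seq b ug up g1 jm k10 vk av e0.
by exists N; exact: HN.
Qed.

End uniform_tv.

(** * Sample sizes *)

Section sizes.
Context (R : realType) (alpha : R).
Hypothesis a01 : 0 < alpha <= 1.

Lemma size1_large N : exists n0, forall n, (n0 <= n)%N -> (N <= size1 alpha n)%N.
Proof.
have /andP[a0 a1] := a01.
exists (Num.truncn (N%:R / alpha)).+1 => n nN.
rewrite /size1 truncn_ge_nat; last by rewrite mulr_ge0// ltW.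
rewrite -ler_pdivrMr//; apply: ltW.
by apply: lt_le_trans (truncnS_gt _) _; rewrite ler_nat.
Qed.

Lemma size1_le n : (size1 alpha n)%:R <= n%:R * alpha.
Proof. by have /andP[a0 _] := a01; rewrite truncn_le mulr_ge0// ltW. Qed.

Lemma size1_le_n n : (size1 alpha n <= n)%N.
Proof.
have /andP[a0 a1] := a01.
by rewrite -(ler_nat R); apply: le_trans (size1_le n) _; apply: ler_piMr.
Qed.

Lemma size2_ge n : n%:R * (1 - alpha) <= (size2 alpha n)%:R.
Proof.
rewrite /size2 natrB ?size1_le_n// mulrBr mulr1 lerD2l lerN2.
exact: size1_le.
Qed.

Lemma size2_large N : alpha < 1 -> exists n0, forall n, (n0 <= n)%N -> (N <= size2 alpha n)%N.
Proof.
move=> a1; have a1' : 0 < 1 - alpha by rewrite subr_gt0.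
exists (Num.truncn (N%:R / (1 - alpha))).+1 => n nN.
rewrite -(ler_nat R); apply: le_trans (size2_ge n).
rewrite -ler_pdivrMr//; apply: ltW.
by apply: lt_le_trans (truncnS_gt _) _; rewrite ler_nat.
Qed.

Lemma size2_eq0 n : alpha = 1 -> size2 alpha n = 0%N.
Proof. by move=> ->; rewrite /size2 /size1 mulr1 natrK subnn. Qed.

(** n * alpha < n1 + 1 <= 2 n1: the factor 2 pays for rounding down. *)
Lemma size2_le n : (0 < size1 alpha n)%N ->
  (size2 alpha n)%:R <= 2 / alpha * (size1 alpha n)%:R.
Proof.
have /andP[a0 a1] := a01 => n1.
apply: (@le_trans _ _ n%:R); first by rewrite ler_nat leq_subr.
rewrite mulrAC ler_pdivlMr//; apply: ltW; apply: lt_le_trans (truncnS_gt _) _.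
by rewrite -/(size1 alpha n) -natrM ler_nat mul2n -addnn -addn1 leq_add2l.
Qed.

End sizes.

(** * Deviations of the data and the risk *)

Section observations.
Context (R : realType).
Variables n1 n2 : nat.

Definition is_first (i : 'I_(n1 + n2)) :=
  if fintype.split i is inl _ then true else false.

Lemma is_first_lshift i : is_first (lshift n2 i).
Proof. by rewrite /is_first (unsplitK (inl i)). Qed.

Lemma is_first_rshift i : is_first (rshift n1 i) = false.
Proof. by rewrite /is_first (unsplitK (inr i)). Qed.

Lemma obs_mean_lshift (mu0 : rvec R n2) (i : 'I_n1) : obs_mean mu0 (lshift n2 i) = 0.
Proof. by rewrite /obs_mean (unsplitK (inl i)). Qed.

Lemma obs_mean_rshift (mu0 : rvec R n2) i : obs_mean mu0 (rshift n1 i) = tnth mu0 i.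
Proof. by rewrite /obs_mean (unsplitK (inr i)). Qed.

Lemma card_is_first : #|is_first| = n1.
Proof.
rewrite -sum1_card big_split_ord/=.
under eq_bigl do rewrite /in_mem/= is_first_lshift.
under [X in (_ + X)%N]eq_bigl do rewrite /in_mem/= is_first_rshift.
by rewrite big_pred0_eq addn0 sum1_card card_ord.
Qed.

Lemma card_not_first : #|[pred i | ~~ is_first i]| = n2.
Proof.
rewrite -sum1_card big_split_ord/=.
under eq_bigl do rewrite inE is_first_lshift.
under [X in (_ + X)%N]eq_bigl do rewrite inE is_first_rshift.
by rewrite big_pred0_eq add0n sum1_card card_ord.
Qed.

Lemma sq_dev_first (mu0 : rvec R n2) (v : R) (x : rvec R (n1 + n2)) : (0 < n1)%N ->
  sq_dev is_first (obs_mean mu0) v x = n1%:R * (mean_sq (obsY x) - v).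
Proof.
move=> n10; rewrite /sq_dev big_split_ord/=.
under eq_bigl do rewrite is_first_lshift.
under [X in _ + X]eq_bigl do rewrite is_first_rshift.
rewrite big_pred0_eq addr0.
under eq_bigr do rewrite obs_mean_lshift expr0n subr0.
rewrite sumrB sumr_const card_ord mulrBr [_ * v]mulr_natl; congr (_ - _).
rewrite /mean_sq mulrC divfK ?pnatr_eq0 -?lt0n//.
by apply: eq_bigr => i _; rewrite tnth_mktuple.
Qed.

Lemma sq_dev_not_first (mu0 : rvec R n2) (v : R) (x : rvec R (n1 + n2)) : (0 < n2)%N ->
  sq_dev [pred i | ~~ is_first i] (obs_mean mu0) v x =
  n2%:R * (mean_sq (obsZ x) - (v + mean_sq mu0)).
Proof.
move=> n20; rewrite /sq_dev big_split_ord/=.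
under eq_bigl do rewrite is_first_lshift.
under [X in _ + X]eq_bigl do rewrite is_first_rshift.
rewrite big_pred0_eq add0r.
under eq_bigr do rewrite obs_mean_rshift.
have n2n : n2%:R != 0 :> R by rewrite pnatr_eq0 -lt0n.
rewrite !sumrB sumr_const card_ord mulrBr mulrDr opprD addrA -addrA [- _ - _]addrC addrA.
rewrite [_ * v]mulr_natl; congr (_ - _ - _).
  rewrite /mean_sq mulrC divfK//.
  by apply: eq_bigr => i _; rewrite tnth_mktuple.
by rewrite /mean_sq mulrC divfK.
Qed.

Lemma obs_mean_bound (mu0 : rvec R n2) L (i : 'I_(n1 + n2)) : 0 <= L ->
  (forall i, `|tnth mu0 i| <= L) -> `|obs_mean mu0 i| <= L.
Proof. by move=> L0 H; rewrite /obs_mean; case: fintype.split => // _; rewrite normr0. Qed.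

Lemma mean_sq_bounds (mu0 : rvec R n2) L : 0 <= L ->
  (forall i, `|tnth mu0 i| <= L) -> 0 <= mean_sq mu0 <= L ^+ 2.
Proof.
move=> L0 H; rewrite /mean_sq divr_ge0//=; last by rewrite sumr_ge0// => i _; exact: sqr_ge0.
have [n20|n20] := posnP n2.
  by rewrite (_ : n2%:R = 0) ?invr0 ?mulr0 ?sqr_ge0// n20.
rewrite ler_pdivrMr ?ltr0n//.
have -> : L ^+ 2 * n2%:R = \sum_(i < n2) L ^+ 2 by rewrite sumr_const card_ord mulr_natr.
apply: ler_sum => i _; rewrite -[leLHS]real_normK ?num_real//.
by apply: lerXn2r; rewrite ?nnegrE.
Qed.

Lemma mean_sq_lower (mu0 : rvec R n2) c : 0 <= c -> (0 < n2)%N ->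
  (forall i, c <= `|tnth mu0 i|) -> c ^+ 2 <= mean_sq mu0.
Proof.
move=> c0 n20 H; rewrite /mean_sq ler_pdivlMr ?ltr0n//.
have -> : c ^+ 2 * n2%:R = \sum_(i < n2) c ^+ 2 by rewrite sumr_const card_ord mulr_natr.
apply: ler_sum => i _; rewrite -[leRHS]real_normK ?num_real//.
by apply: lerXn2r; rewrite ?nnegrE.
Qed.

(** F is at most e off the two deviation events and at most 1 on them, and each event has
    probability at most 2 exp (4 (v^2 + L^2 v) - M). *)
Lemma risk_le (F : rvec R (n1 + n2) -> \bar R) (mu0 : rvec R n2) (v L M e : R) :
  0 < v -> 0 <= L -> 0 <= e -> (forall i, `|tnth mu0 i| <= L) ->
  (0 < n1)%N -> 16 * v ^+ 2 <= n1%:R -> ((0 < n2)%N -> 16 * v ^+ 2 <= n2%:R) ->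
  (forall x, (0 <= F x <= 1)%E) ->
  (forall x, `|mean_sq (obsY x) - v| <= M / Num.sqrt n1%:R ->
    ((0 < n2)%N -> `|mean_sq (obsZ x) - (v + mean_sq mu0)| <= M / Num.sqrt n2%:R) ->
    (F x <= e%:E)%E) ->
  (\int[obs_law n1 v mu0]_x F x <= (e + 4 * expR (4 * (v ^+ 2 + L ^+ 2 * v) - M))%:E)%E.
Proof.
move=> v0 L0 e0 muL n10 n1v n2v F01 Fe.
pose B1 := [set x | (M * Num.sqrt #|is_first|%:R < `|sq_dev is_first (obs_mean mu0) v x|)%R].
(* With n2 = 0 there is no deviation of Z to exclude, and the size condition of [sq_dev_tail]
   fails. *)
pose B2 := if (0 < n2)%N then [set x | (M * Num.sqrt #|[pred i | ~~ is_first i]|%:R <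
   `|sq_dev [pred i | ~~ is_first i] (obs_mean mu0) v x|)%R] else set0.
have mB (J : pred 'I_(n1 + n2)) :
    measurable [set x | (M * Num.sqrt #|J|%:R < `|sq_dev J (obs_mean mu0) v x|)%R].
  rewrite -[X in measurable X]setTI.
  apply: (@measurable_fun_ltr _ _ _ _ (fun=> M * Num.sqrt #|J|%:R)
    (fun x => `|sq_dev J (obs_mean mu0) v x|)) => //.
  by apply: measurableT_comp => //; exact: measurable_sq_dev.
have mB1 : measurable B1 by exact: mB.
have mB2 : measurable B2 by rewrite /B2; case: ifP => _; [exact: mB|exact: measurable0].
have mL (i : 'I_(n1 + n2)) : `|obs_mean mu0 i| <= L by exact: obs_mean_bound.
pose P := obs_law n1 v mu0.
have P1 : (P B1 <= (2 * expR (4 * (v ^+ 2 + L ^+ 2 * v) - M))%:E)%E.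
  by apply: sq_dev_tail => //; rewrite card_is_first.
have P2 : (P B2 <= (2 * expR (4 * (v ^+ 2 + L ^+ 2 * v) - M))%:E)%E.
  rewrite /B2; case: ifPn => n20; last by rewrite measure0 lee_fin mulr_ge0// expR_ge0.
  by apply: sq_dev_tail => //; rewrite card_not_first n2v.
have P12 : (P (B1 `|` B2) <= (4 * expR (4 * (v ^+ 2 + L ^+ 2 * v) - M))%:E)%E.
  apply: (le_trans (measureU2 P mB1 mB2)); apply: le_trans (leeD P1 P2) _.
  by rewrite -EFinD lee_fin; lra.
have mB12 : measurable (B1 `|` B2) by exact: measurableU.
apply: (@le_trans _ _ (\int[P]_x (e%:E + (\1_(B1 `|` B2) x)%:E))%E).
  apply: ge0_integral_mono => x; first by case/andP: (F01 x).
  have [xB|xB] := boolP (x \in B1 `|` B2).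
    rewrite indicE xB -EFinD; case/andP: (F01 x) => _ h; apply: le_trans h _.
    by rewrite lee_fin lerDr.
  rewrite indicE (negbTE xB) adde0; apply: Fe.
    move: xB; rewrite notin_setE /= => /not_orP[h _].
    move/negP: h; rewrite -leNgt card_is_first sq_dev_first// normrM ger0_norm// => h.
    have s1 : (0 : R) < Num.sqrt n1%:R by rewrite sqrtr_gt0 ltr0n.
    rewrite ler_pdivlMr// -(ler_pM2r s1) -mulrA -expr2 sqr_sqrtr//.
    by rewrite mulrC.
  move=> n20; move: xB; rewrite notin_setE /= => /not_orP[_]; rewrite /B2 n20.
  move/negP; rewrite -leNgt card_not_first sq_dev_not_first// normrM ger0_norm// => h.
  have s1 : (0 : R) < Num.sqrt n2%:R by rewrite sqrtr_gt0 ltr0n.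
  rewrite ler_pdivlMr// -(ler_pM2r s1) -mulrA -expr2 sqr_sqrtr//.
  by rewrite mulrC.
rewrite ge0_integralD//; last first.
  by apply/measurable_EFinP; exact: measurable_indic.
rewrite integral_cst// integral_indic// setIT EFinD.
apply: leeD P12.
rewrite -[X in (_ <= X)%E]mule1; apply: lee_wpmul2l; first by rewrite lee_fin.
exact: probability_le1.
Qed.

End observations.

(** * From uniform bounds on likely data to the supremum of the risk *)

Section sup_risk_convergence.
Context (R : realType) (alpha : R).
Notation n1 := (size1 alpha).
Notation n2 := (size2 alpha).
Hypothesis a01 : 0 < alpha <= 1.

Lemma size2_eq0_or_large N : (forall n, n2 n = 0%N) \/
  exists n0, forall n, (n0 <= n)%N -> (N <= n2 n)%N.
Proof.
have /andP[_] := a01; rewrite le_eqVlt => /predU1P[a1|a1].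
  by left => n; exact: size2_eq0.
by right; exact: size2_large.
Qed.

Lemma ereal_cvg0 (u : nat -> \bar R) : (forall n, (0 <= u n)%E) ->
  (forall e, 0 < e -> \forall n \near \oo, (u n <= e%:E)%E) -> u n @[n --> \oo] --> 0%E.
Proof.
move=> u0 H; apply/fine_cvgP; split.
  apply: filterS (H 1 ltr01) => n h.
  by rewrite ge0_fin_numE// (le_lt_trans h) ?ltry.
apply/cvgrPdist_le => e e0; apply: filterS (H e e0) => n h.
rewrite sub0r normrN /= ger0_norm ?fine_ge0//.
rewrite -lee_fin fineK// ge0_fin_numE// (le_lt_trans h) ?ltry//.
Qed.

Variables (K : set R) (K'_ : nat -> set R) (k1 k2 L : R).
Variable F : forall n, R -> rvec R (n2 n) -> rvec R (n1 n + n2 n) -> \bar R.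
Hypotheses (k10 : 0 < k1) (Kk : forall v, K v -> k1 <= v <= k2).
Hypotheses (L0 : 0 <= L) (K'L : forall n x, K'_ n x -> `|x| <= L).
Hypothesis F01 : forall n v mu0 x, (0 <= @F n v mu0 x <= 1)%E.
Hypothesis Fsmall : forall M e, 0 <= M -> 0 < e ->
  \forall n \near \oo, forall v (mu0 : rvec R (n2 n)) (x : rvec R (n1 n + n2 n)),
    K v -> box (K'_ n) mu0 ->
    `|mean_sq (obsY x) - v| <= M / Num.sqrt (n1 n)%:R ->
    ((0 < n2 n)%N ->
      `|mean_sq (obsZ x) - (v + mean_sq mu0)| <= M / Num.sqrt (n2 n)%:R) ->
    (@F n v mu0 x <= e%:E)%E.

(** [F] stands for either total variation distance. M is fixed from e so that unlikely data
    contribute at most e / 2; for this M, [Fsmall] handles the other data once n is large. *)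
Lemma sup_risk_cvg0 :
  sup_risk K (K'_ n) (fun v mu0 => (\int[obs_law (n1 n) v mu0]_x @F n v mu0 x)%E)
    @[n --> \oo] --> 0%E.
Proof.
apply: ereal_cvg0 => [n|e e0]; first by apply: ereal_sup_ubound; left.
(* The absolute value covers an empty K, where nothing determines the sign of k2. *)
pose C := 4 * (k2 ^+ 2 + L ^+ 2 * `|k2|).
have C0 : 0 <= C.
  apply: mulr_ge0 => //; apply: addr_ge0; first exact: sqr_ge0.
  by apply: mulr_ge0 => //; exact: sqr_ge0.
(* Then 4 exp (C - M) = 4 exp (- 8 / e) <= 4 / (8 / e) = e / 2. *)
pose M := C + 8 / e.
have e8 : 0 < 8 / e by rewrite divr_gt0.
have M0 : 0 <= M by rewrite addr_ge0// ltW.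
have tail : 4 * expR (C - M) <= e / 2.
  have -> : C - M = - (8 / e) by rewrite /M; ring.
  rewrite expRN ler_pdivrMr ?expR_gt0//.
  apply: (@le_trans _ _ (e / 2 * (8 / e))).
    by rewrite le_eqVlt; apply/orP; left; apply/eqP; field; rewrite gt_eqF.
  apply: ler_wpM2l; first by rewrite divr_ge0// ltW.
  by apply: le_trans (expR_ge1Dx _); rewrite lerDr.
have e2 : 0 < e / 2 by rewrite divr_gt0.
have large1 : \forall n \near \oo, (0 < n1 n)%N /\ 16 * k2 ^+ 2 <= (n1 n)%:R.
  have [n0 H] := size1_large a01 (Num.truncn (16 * k2 ^+ 2)).+1.
  exists n0 => // n /= /H nn; split; first by rewrite (leq_trans _ nn).
  by apply/ltW; apply: lt_le_trans (truncnS_gt _) _; rewrite ler_nat.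
have large2 : \forall n \near \oo, (0 < n2 n)%N -> 16 * k2 ^+ 2 <= (n2 n)%:R.
  have [H|[n0 H]] := size2_eq0_or_large (Num.truncn (16 * k2 ^+ 2)).+1.
    by apply: nearW => n; rewrite H.
  exists n0 => // n /= /H nn _.
  by apply/ltW; apply: lt_le_trans (truncnS_gt _) _; rewrite ler_nat.
apply: filterS3 large1 large2 (Fsmall M0 e2) => n [n10 h1] h2 Fn.
apply: ub_ereal_sup => _ [->|[v Kv [mu0 Kmu <-]]]; first by rewrite lee_fin ltW.
have /andP[kv vk] := Kk Kv.
have v0 : 0 < v by exact: lt_le_trans kv.
have k20 : 0 < k2 by exact: lt_le_trans vk.
have vk2 : v ^+ 2 <= k2 ^+ 2 by apply: lerXn2r; rewrite ?nnegrE ?(ltW v0) ?(ltW k20).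
have v16 : 16 * v ^+ 2 <= 16 * k2 ^+ 2 by rewrite ler_pM2l.
have := @risk_le R (n1 n) (n2 n) (@F n v mu0) mu0 v L M (e / 2) v0 L0 (ltW e2)
  (fun i => K'L (Kmu i)) n10 (le_trans v16 h1) (fun n20 => le_trans v16 (h2 n20))
  (fun x => @F01 n v mu0 x) (fun x hY hZ => Fn v mu0 x Kv Kmu hY hZ).
move=> H; apply: le_trans H _; rewrite lee_fin.
apply: (@le_trans _ _ (e / 2 + e / 2)); last first.
  by rewrite le_eqVlt; apply/orP; left; apply/eqP; field.
rewrite lerD2l; apply: le_trans tail; rewrite ler_pM2l// ler_expR lerD2r ler_pM2l//.
apply: lerD => //; apply: ler_wpM2l; first exact: sqr_ge0.
by apply: le_trans vk (ler_norm _).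
Qed.

End sup_risk_convergence.

Section compact_bounds.
Context (R : realType).

(** K is closed and misses 0, so a ball around 0 misses K; its radius is k1. *)
Lemma compact_pos_bounds (K : set R) : compact K -> K `<=` `]0, +oo[ ->
  exists k1 k2, 0 < k1 /\ forall x, K x -> k1 <= x <= k2.
Proof.
move=> cK K0.
have [k2 [_ Hk2]] := compact_bounded cK.
have cl : closed K by apply: compact_closed cK; exact: Rhausdorff.
have /nbhs_ballP[k1 /= k10 Hk1] : nbhs (0 : R) (~` K).
  apply: open_nbhs_nbhs; split; first exact: closed_openC.
  by move=> /K0 /=; rewrite in_itv/= ltxx.
exists k1, (k2 + 1); split => // x Kx.
have x0 : 0 < x by have := K0 _ Kx; rewrite /= in_itv/= andbT.
apply/andP; split; last first.
  by apply: le_trans (ler_norm _) _; apply: (Hk2 (k2 + 1)) => //; rewrite ltrDl.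
rewrite leNgt; apply/negP => xk; apply: (Hk1 x) => //.
by rewrite /ball/= sub0r normrN gtr0_norm.
Qed.

Lemma compact_abs_bound (K : set R) : compact K ->
  exists2 L, 0 <= L & forall x, K x -> `|x| <= L.
Proof.
move=> cK; have [k2 [_ Hk2]] := compact_bounded cK.
exists (`|k2| + 1); first by rewrite addr_ge0.
move=> x Kx; apply: (Hk2 (`|k2| + 1)) => //.
by apply: le_lt_trans (ler_norm _) _; rewrite ltrDl.
Qed.

End compact_bounds.

Section densities.
Context (R : realType).
Notation mu := (@lebesgue_measure R).

(** For n > (M / k1)^2 the deviation M / sqrt n is below k1. Positivity of the mean squares is what
    rewriting the posterior with [lik] requires. *)
Lemma center_gt0 (n : nat) (k1 v a M : R) : 0 < k1 -> k1 <= v ->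
  (Num.truncn ((M / k1) ^+ 2) < n)%N -> `|a - v| <= M / Num.sqrt n%:R -> 0 < a.
Proof.
move=> k10 kv nM av.
have n0 : (0 : R) < Num.sqrt n%:R by rewrite sqrtr_gt0 ltr0n (leq_ltn_trans _ nM).
have nM' : (M / k1) ^+ 2 < n%:R.
  by apply: lt_le_trans (truncnS_gt _) _; rewrite ler_nat.
have Mk : M / Num.sqrt n%:R < k1.
  rewrite ltr_pdivrMr// mulrC -ltr_pdivrMr//.
  apply: le_lt_trans (ler_norm _) _; rewrite -sqrtr_sqr ltr_sqrt// .
  exact: le_lt_trans (sqr_ge0 _) nM'.
by move: av; rewrite ler_norml => /andP[h _]; lra.
Qed.

Lemma sqnorm_mean_sq k (u : rvec R k) : (0 < k)%N -> sqnorm u = k%:R * mean_sq u.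
Proof. by move=> k0; rewrite /mean_sq mulrC divfK// pnatr_eq0 -lt0n. Qed.

Lemma sqnorm_eq0 k (u : rvec R k) : k = 0%N -> sqnorm u = 0.
Proof. by move=> k0; subst k; rewrite /sqnorm big_ord0. Qed.

Lemma law_posterior n1 n2 (gamma prior : R -> R) (nu : probability (rvec R n2) R)
    (Y : rvec R n1) (Z : rvec R n2) (a b : R) (A : set R) :
  ucpos (clamp gamma) -> ucpos (clamp prior) -> is_gaussian_mixture gamma nu ->
  0 < a -> 0 < b -> sqnorm Y = n1%:R * a -> sqnorm Z = n2%:R * b -> measurable A ->
  law_propto (posterior_dens nu prior Y Z) A =
  law_propto (post_dens (clamp gamma) (clamp prior) n1 n2 a b) A.
Proof.
move=> ug up nuE a0 b0 Ya Zb mA.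
have -> : posterior_dens nu prior Y Z = fun v =>
    (Num.sqrt a * expR 2^-1)^-1 ^+ n1 * (Num.sqrt b * expR 2^-1)^-1 ^+ n2 *
    post_dens (clamp gamma) (clamp prior) n1 n2 a b v.
  by apply/funext => v; exact: posterior_densE.
apply: law_propto_scale => //.
- by rewrite mulr_gt0// exprn_gt0// invr_gt0 mulr_gt0 ?sqrtr_gt0 ?expR_gt0.
- exact: measurable_post_dens.
- by move=> v; exact: post_dens_ge0.
Qed.

Lemma posterior_dens_ge0 n1 n2 (prior : R -> R) (nu : probability (rvec R n2) R)
    (Y : rvec R n1) (Z : rvec R n2) v :
  (forall x, 0 <= x -> 0 < prior x) -> 0 <= posterior_dens nu prior Y Z v.
Proof.
move=> p0; rewrite /posterior_dens.
have [v0|v0] := ltP 0 v; last by rewrite mulr0n mul0r.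
rewrite mulr1n mul1r mulr_ge0 ?(ltW (p0 _ (ltW v0)))// mulr_ge0//.
by apply: Rintegral_ge0 => x _; exact: expR_ge0.
Qed.

Lemma limit_dens_ge0 n1 n2 (v : R) mu0 (Y : rvec R n1) (Z : rvec R n2) u :
  0 <= limit_dens v mu0 Y Z u.
Proof.
rewrite /limit_dens mulr_ge0 ?mulr_ge0 ?expR_ge0//.
by case/andP: (normal_tail01 n2 (mean_sq Z) (v + mean_sq mu0) u).
Qed.

Lemma tilde_limit_dens_ge0 n1 (v : R) (Y : rvec R n1) u :
  0 <= tilde_limit_dens v Y u.
Proof. by rewrite /tilde_limit_dens mulr_ge0 ?expR_ge0. Qed.

Lemma tilde_limit_densE n1 (v : R) (Y : rvec R n1) :
  tilde_limit_dens v Y = tail_dens n1 v (mean_sq Y) (cst 1).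
Proof. by apply/funext => u; rewrite /tail_dens mulr1. Qed.

(** The factor sqrt n2 = 0 makes the argument of Phi vanish, and the positive constant 1 - Phi 0
    disappears in the normalisation. *)
Lemma law_limit_no_signal n1 n2 (v : R) mu0 (Y : rvec R n1) (Z : rvec R n2) A :
  n2 = 0%N -> measurable A ->
  law_propto (limit_dens v mu0 Y Z) A = law_propto (tilde_limit_dens v Y) A.
Proof.
move=> n20 mA; rewrite tilde_limit_densE.
rewrite -[RHS](@law_propto_scale _ (1 - Phi 0))//.
- congr law_propto; apply/funext => u; rewrite /limit_dens /tail_dens.
  by rewrite [X in Num.sqrt X](_ : _ = 0) ?n20// sqrtr0 !mul0r mulr1 mulrC.
- by rewrite subr_gt0 Phi_lt1.
- by apply: measurable_tail_dens; exact: measurable_cst.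
- by move=> u; rewrite mulr_ge0 ?mulr_ge0 ?expR_ge0.
Qed.

Lemma prob_density_clamp (gamma : R -> R) : measurable_fun setT (clamp gamma) ->
  prob_density gamma ->
  (\int[mu]_(t in `]0%R, +oo[) (clamp gamma t)%:E = 1)%E.
Proof.
move=> mg [g0 g1]; rewrite -g1 integral_itv_obnd_cbnd; last first.
  by apply/measurable_EFinP; exact: measurable_funTS.
by apply: eq_integral => t; rewrite inE/= in_itv/= andbT => t0; rewrite clampE.
Qed.

End densities.

(** * The two risks *)

Section risk_limits.
Context (R : realType) (alpha : R) (gamma prior : R -> R).
Notation n1 := (size1 alpha).
Notation n2 := (size2 alpha).
Variable nu : forall n, probability (rvec R (n2 n)) R.
Variables (K : set R) (K'_ : nat -> set R) (k1 k2 L : R).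
Hypothesis a01 : 0 < alpha <= 1.
Hypotheses (dg : prob_density gamma) (prior0 : forall x, 0 <= x -> 0 < prior x).
Hypotheses (ug : ucpos (clamp gamma)) (up : ucpos (clamp prior)).
Hypothesis nuE : forall n, is_gaussian_mixture gamma (nu n).
Hypotheses (k10 : 0 < k1) (Kk : forall v, K v -> k1 <= v <= k2).
Hypotheses (L0 : 0 <= L) (K'L : forall n x, K'_ n x -> `|x| <= L).

Let g1 := prob_density_clamp (measurable_ucpos ug) dg.

Let C : R := Num.sqrt (2 / alpha).

Let C0 : 0 <= C. Proof. exact: sqrtr_ge0. Qed.

Let ratio n : (0 < n1 n)%N -> (n2 n)%:R <= C ^+ 2 * (n1 n)%:R.
Proof.
have /andP[a0 _] := a01 => n10.
by rewrite sqr_sqrtr ?divr_ge0 ?(ltW a0)//; exact: size2_le.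
Qed.

Let sv n (v : R) (mu0 : rvec R (n2 n)) : box (K'_ n) mu0 -> 0 <= (v + mean_sq mu0) - v <= L ^+ 2.
Proof.
move=> Kmu; rewrite addrAC subrr add0r; apply: mean_sq_bounds => // i.
exact: K'L (Kmu i).
Qed.

(* The case alpha = 1: there is no Z, and the factor 1 - Phi is constant. *)
Let no_signal M e : 0 <= M -> 0 < e -> (forall n, n2 n = 0%N) ->
  \forall n \near \oo, forall v (mu0 : rvec R (n2 n)) (x : rvec R (n1 n + n2 n)),
    K v -> `|mean_sq (obsY x) - v| <= M / Num.sqrt (n1 n)%:R ->
    (tv_dist (law_propto (posterior_dens (nu n) prior (obsY x) (obsZ x)))
       (law_propto (tilde_limit_dens v (obsY x))) <= e%:E)%E.
Proof.
move=> M0 e0 n20.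
have [N HN] := tv_no_signal_uniform k2 M ug up k10 e0 1 g1.
have [N1 H1] := size1_large a01 (maxn N (Num.truncn ((M / k1) ^+ 2)).+1).
exists N1 => // n /= /H1; rewrite geq_max => /andP[h1 h2] v mu0 x Kv aY.
have n10 : (0 < n1 n)%N by exact: leq_ltn_trans h2.
have /andP[kv vk] := Kk Kv.
apply: le_trans (HN (n1 n) v (mean_sq (obsY x)) h1 (Kk Kv) aY).
rewrite le_eqVlt; apply/orP; left; apply/eqP; apply: eq_tv_dist => A mA.
  rewrite -[X in post_dens _ _ _ X](n20 n); apply: law_posterior => //.
  - exact: center_gt0 k10 kv h2 aY.
  - exact: sqnorm_mean_sq.
  - by rewrite mulr1 sqnorm_eq0 n20.
by rewrite tilde_limit_densE.
Qed.

Let signal_posterior M n v (mu0 : rvec R (n2 n)) (x : rvec R (n1 n + n2 n)) A :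
  (Num.truncn ((M / k1) ^+ 2) < n1 n)%N -> (Num.truncn ((M / k1) ^+ 2) < n2 n)%N ->
  K v -> box (K'_ n) mu0 -> `|mean_sq (obsY x) - v| <= M / Num.sqrt (n1 n)%:R ->
  `|mean_sq (obsZ x) - (v + mean_sq mu0)| <= M / Num.sqrt (n2 n)%:R -> measurable A ->
  law_propto (posterior_dens (nu n) prior (obsY x) (obsZ x)) A =
  law_propto (post_dens (clamp gamma) (clamp prior) (n1 n) (n2 n)
    (mean_sq (obsY x)) (mean_sq (obsZ x))) A.
Proof.
move=> h1 h2 Kv Kmu aY bZ mA.
have n10 : (0 < n1 n)%N by exact: leq_ltn_trans h1.
have n20 : (0 < n2 n)%N by exact: leq_ltn_trans h2.
have /andP[kv vk] := Kk Kv.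
have /andP[s0 _] := sv v Kmu.
apply: law_posterior => //.
- exact: center_gt0 k10 kv h1 aY.
- by apply: center_gt0 k10 _ h2 bZ; lra.
- exact: sqnorm_mean_sq.
- exact: sqnorm_mean_sq.
Qed.

Lemma tv_risk_cvg0 :
  sup_risk K (K'_ n) (@tv_risk R (n1 n) (n2 n) (nu n) prior) @[n --> \oo] --> 0%E.
Proof.
apply: (@sup_risk_cvg0 R alpha a01 K K'_ k1 k2 L (fun n v mu0 x =>
  tv_dist (law_propto (posterior_dens (nu n) prior (obsY x) (obsZ x)))
     (law_propto (limit_dens v mu0 (obsY x) (obsZ x))))) => //.
  move=> n v mu0 x; rewrite tv_dist_ge0/=; apply: tv_dist_law_propto_le1.
    by move=> u; exact: posterior_dens_ge0.
  by move=> u; exact: limit_dens_ge0.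
move=> M e M0 e0.
have [N HN] := tv_limit_uniform k2 (L ^+ 2) ug up k10 C0 M0 e0.
pose B := (maxn N (Num.truncn ((M / k1) ^+ 2)).+1).
have [n20|[N2 H2]] := size2_eq0_or_large a01 B.
  apply: filterS (no_signal M0 e0 n20) => n H v mu0 x Kv _ aY _.
  apply: le_trans (H v mu0 x Kv aY).
  rewrite le_eqVlt; apply/orP; left; apply/eqP; apply: eq_tv_dist => A mA //.
  by rewrite law_limit_no_signal.
have [N1 H1] := size1_large a01 B.
exists (maxn N1 N2) => // n /=; rewrite geq_max => /andP[/H1 + /H2].
rewrite !geq_max => /andP[h1 h1'] /andP[h2 h2'] v mu0 x Kv Kmu aY bZ.
have n10 : (0 < n1 n)%N by exact: leq_ltn_trans h1'.
have n20 : (0 < n2 n)%N by exact: leq_ltn_trans h2'.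
apply: le_trans (HN (n1 n) (n2 n) v (v + mean_sq mu0) (mean_sq (obsY x)) (mean_sq (obsZ x))
  h1 h2 (ratio n10) (Kk Kv) (sv v Kmu) aY (bZ n20)).
rewrite le_eqVlt; apply/orP; left; apply/eqP; apply: eq_tv_dist => // A mA.
exact: (signal_posterior h1' h2' Kv Kmu aY (bZ n20) mA).
Qed.

Hypothesis sep : (inf_abs_mean (n2 n) (K'_ n) *
   (((ln n%:R / n%:R) `^ 4^-1)^-1)%:E)%E @[n --> \oo] --> +oo%E.

(** With r = (ln n / n)^(1/4), eventually all |mu0_i| >= A r, and r^2 >= n^(-1/2) once ln n >= 1. So
    mean mu0^2 >= A^2 / sqrt n, while n2 >= n (1 - alpha). *)
Let separation N : alpha < 1 -> \forall n \near \oo, forall v (mu0 : rvec R (n2 n)),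
  box (K'_ n) mu0 -> N%:R <= Num.sqrt (n2 n)%:R * ((v + mean_sq mu0) - v).
Proof.
move=> a1; have a1' : 0 < 1 - alpha by rewrite subr_gt0.
have sa : 0 < Num.sqrt (1 - alpha) by rewrite sqrtr_gt0.
(* Chosen so that A >= 1 and A sqrt (1 - alpha) >= N, whence A^2 sqrt (1 - alpha) >= N. *)
pose A : R := 1 + N%:R / Num.sqrt (1 - alpha).
have A1 : 1 <= A by rewrite lerDl divr_ge0// ltW.
have [N2 H2] := size2_large a01 1 a1.
have near1 : \forall n \near \oo, (N2 <= n)%N by exact: nbhs_infty_ge.
have near2 : \forall n \near \oo, expR 1 <= n%:R :> R by exact: nbhs_infty_ger.
have near3 : \forall n \near \oo, (A%:E <= inf_abs_mean (n2 n) (K'_ n) *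
    (((ln n%:R / n%:R) `^ 4^-1)^-1)%:E)%E by exact: (cvgeyPge _).1 sep A.
apply: filterS3 near1 near2 near3 => n /H2 n20 ne Hn v mu0 Kmu.
have n0 : (0 : R) < n%:R by apply: lt_le_trans ne; exact: expR_gt0.
have ln1 : 1 <= ln n%:R :> R by rewrite -[leLHS](@expRK R) ler_ln ?posrE ?expR_gt0.
have q0 : 0 < ln n%:R / n%:R :> R by rewrite divr_gt0// (lt_le_trans ltr01).
pose r : R := (ln n%:R / n%:R) `^ 4^-1.
have r0 : 0 < r by exact: powR_gt0.
have r4 : r ^+ 4 = ln n%:R / n%:R.
  by rewrite -powR_mulrn ?(ltW r0)// -powRrM mulVf// powRr1// ltW.
have r2 : (Num.sqrt n%:R)^-1 <= r ^+ 2.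
  have s0 : (0 : R) < Num.sqrt n%:R by rewrite sqrtr_gt0.
  rewrite -(@ler_pXn2r _ 2)// ?nnegrE ?invr_ge0 ?exprn_ge0 ?(ltW s0) ?(ltW r0)//.
  rewrite -exprM r4 exprVn sqr_sqrtr ?(ltW n0)// -[leLHS]mul1r.
  by apply: ler_wpM2r => //; rewrite invr_ge0 ltW.
have lower i : A * r <= `|tnth mu0 i|.
  rewrite -ler_pdivlMr// -lee_fin EFinM; apply: le_trans Hn _.
  apply: lee_wpmul2r; first by rewrite lee_fin invr_ge0 ltW.
  by apply: ereal_inf_lbound; exists mu0 => //; exists i.
have ms : (A * r) ^+ 2 <= mean_sq mu0.
  by apply: mean_sq_lower => //; rewrite mulr_ge0 ?(ltW r0)// (le_trans ler01).
rewrite addrAC subrr add0r.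
have n2n : Num.sqrt n%:R * Num.sqrt (1 - alpha) <= Num.sqrt (n2 n)%:R.
  by rewrite -sqrtrM ?(ltW n0)//; apply: ler_wsqrtr; exact: size2_ge.
have s0 : (0 : R) < Num.sqrt n%:R by rewrite sqrtr_gt0.
apply: (@le_trans _ _ (Num.sqrt n%:R * Num.sqrt (1 - alpha) * (A ^+ 2 * (Num.sqrt n%:R)^-1))).
  have -> : Num.sqrt n%:R * Num.sqrt (1 - alpha) * (A ^+ 2 * (Num.sqrt n%:R)^-1) =
     A ^+ 2 * Num.sqrt (1 - alpha) by field; rewrite gt_eqF.
  apply: (@le_trans _ _ (A * Num.sqrt (1 - alpha))).
    by rewrite /A mulrDl mul1r divfK ?gt_eqF// lerDr ltW.
  by rewrite ler_pM2r// expr2; apply: ler_peMl => //; rewrite (le_trans ler01).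
apply: ler_pM => //.
- by rewrite mulr_ge0 ?sqr_ge0// invr_ge0 ltW.
- by apply: le_trans ms; rewrite exprMn; apply: ler_wpM2l => //; exact: sqr_ge0.
Qed.

Lemma tilde_tv_risk_cvg0 :
  sup_risk K (K'_ n) (@tilde_tv_risk R (n1 n) (n2 n) (nu n) prior) @[n --> \oo] --> 0%E.
Proof.
apply: (@sup_risk_cvg0 R alpha a01 K K'_ k1 k2 L (fun n v mu0 x =>
  tv_dist (law_propto (posterior_dens (nu n) prior (obsY x) (obsZ x)))
     (law_propto (tilde_limit_dens v (obsY x))))) => //.
  move=> n v mu0 x; rewrite tv_dist_ge0/=; apply: tv_dist_law_propto_le1.
    by move=> u; exact: posterior_dens_ge0.
  by move=> u; exact: tilde_limit_dens_ge0.
move=> M e M0 e0.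
have [N HN] := tv_tilde_limit_uniform k2 (L ^+ 2) ug up k10 C0 M0 e0.
pose B := (maxn N (Num.truncn ((M / k1) ^+ 2)).+1).
have /andP[_] := a01; rewrite le_eqVlt => /predU1P[a1|a1].
  have n20 n : n2 n = 0%N by exact: size2_eq0.
  by apply: filterS (no_signal M0 e0 n20) => n H v mu0 x Kv _ aY _; exact: H.
have [N2 H2] := size2_large a01 B a1.
have [N1 H1] := size1_large a01 B.
have near12 : \forall n \near \oo, (maxn N1 N2 <= n)%N by exact: nbhs_infty_ge.
apply: filterS2 near12 (separation N a1) => n.
rewrite geq_max => /andP[/H1 + /H2].
rewrite !geq_max => /andP[h1 h1'] /andP[h2 h2'] S v mu0 x Kv Kmu aY bZ.
have n10 : (0 < n1 n)%N by exact: leq_ltn_trans h1'.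
have n20 : (0 < n2 n)%N by exact: leq_ltn_trans h2'.
apply: le_trans (HN (n1 n) (n2 n) v (v + mean_sq mu0) (mean_sq (obsY x)) (mean_sq (obsZ x))
  h1 h2 (ratio n10) (Kk Kv) (sv v Kmu) aY (bZ n20) (S v mu0 Kmu)).
rewrite le_eqVlt; apply/orP; left; apply/eqP; apply: eq_tv_dist => A mA.
  exact: (signal_posterior h1' h2' Kv Kmu aY (bZ n20) mA).
by rewrite tilde_limit_densE.
Qed.

End risk_limits.

Theorem theorem5p2 (R : realType) (alpha : R) (gamma prior : R -> R)
    (nu : forall n, probability (rvec R (size2 alpha n)) R)
    (K K' : set R) :
  0 < alpha <= 1 ->
  prob_density gamma -> prob_density prior ->
  (forall x, 0 <= x -> 0 < gamma x) -> (forall x, 0 <= x -> 0 < prior x) ->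
  unif_continuous_on `[0, +oo[ gamma -> unif_continuous_on `[0, +oo[ prior ->
  (forall n, is_gaussian_mixture gamma (nu n)) ->
  compact K -> K `<=` `]0, +oo[ -> compact K' ->
  (sup_risk K K' (@tv_risk R (size1 alpha n) (size2 alpha n) (nu n) prior)
     @[n --> \oo] --> 0%E) /\
  (forall K'_ : nat -> set R, (forall n, K'_ n `<=` K') ->
     (inf_abs_mean (size2 alpha n) (K'_ n) *
        (((ln n%:R / n%:R) `^ 4^-1)^-1)%:E)%E @[n --> \oo] --> +oo%E ->
     sup_risk K (K'_ n)
       (@tilde_tv_risk R (size1 alpha n) (size2 alpha n) (nu n) prior)
       @[n --> \oo] --> 0%E).
Proof.
move=> a01 dg dp g0 p0 ucg ucp nuE cK K0 cK'.
have ug := ucpos_clamp dg g0 ucg.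
have up := ucpos_clamp dp p0 ucp.
have [k1 [k2 [k10 Kk]]] := compact_pos_bounds cK K0.
have [L L0 K'L] := compact_abs_bound cK'.
(* Both limits are proved for sets [K'_ n] inside a common ball of radius L; the first claim takes
   them all equal to K'. *)
split; first exact: (tv_risk_cvg0 (K'_ := fun=> K') a01 dg p0 ug up nuE k10 Kk L0 (fun _ => K'L)).
move=> K'_ subK' sep.
exact: (tilde_tv_risk_cvg0 a01 dg p0 ug up nuE k10 Kk L0 (fun n x Kx => K'L x (subK' n x Kx)) sep).
Qed.
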